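(* Let $s \ge 11$ be an integer, let $\eta > 0$, and let $\mu_1, \ldots, \mu_s$ be real numbers with $\mu_1$ irrational. Put $F(x_1,\ldots,x_s) = (x_1-\mu_1)^3 + \cdots + (x_s-\mu_s)^3$, and for $\tau > 0$ let $N(\tau)$ be the number of $\mathbf{x} \in \mathbb{Z}^s \cap \big((\mu_1,\infty)\times\cdots\times(\mu_s,\infty)\big)$ with $|F(\mathbf{x}) - \tau| < \eta$. Then, as $\tau \to \infty$, \[ N(\tau) \sim 2\eta\, \Gamma(4/3)^s\, \Gamma(s/3)^{-1}\, \tau^{s/3-1}. \] *)

(* Defs.v *)
From HB Require Import structures.
From mathcomp Require Export all_boot all_order all_algebra finmap.
From mathcomp Require Export all_classical all_reals all_analysis.
Import Order.TTheory GRing.Theory Num.Theory.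
Import numFieldNormedType.Exports.

Set Implicit Arguments.
Unset Strict Implicit.
Unset Printing Implicit Defensive.

Local Open Scope classical_set_scope.
Local Open Scope ring_scope.

(* Euler's integral; only meaningful for z > 0, where it converges
   ([Rintegral] returns 0 if the integral is infinite). *)
Definition Gamma {R : realType} (z : R) : R :=
  \int[@lebesgue_measure R]_(t in `]0, +oo[) (t `^ (z - 1) * expR (- t)).

Definition shifted_cubes {R : realType} (s : nat) (mu : 'I_s -> R)
    (x : {ffun 'I_s -> int}) : R :=
  \sum_(i < s) ((x i)%:~R - mu i) ^+ 3.

Definition solutions {R : realType} (s : nat) (mu : 'I_s -> R) (eta tau : R) :
    set {ffun 'I_s -> int} :=
  [set x : {ffun 'I_s -> int} | (forall i, mu i < (x i)%:~R) /\
           `|shifted_cubes mu x - tau| < eta].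

(* [fset_set] is a junk value on infinite sets; [finite_solutions] below shows
   that this case never occurs. *)
Definition Nsol {R : realType} (s : nat) (mu : 'I_s -> R) (eta tau : R) : nat :=
  #|` fset_set (solutions mu eta tau)|%fset.

Lemma finite_solutions (R : realType) (s : nat) (mu : 'I_s -> R) (eta tau : R) :
  finite_set (solutions mu eta tau).
Proof.
pose C : R := 1 + `|tau| + `|eta|.
have C1 : 1 <= C by rewrite /C -addrA lerDl addr_ge0.
pose K := Num.bound (C + \sum_i `|mu i|).
have bnd x i : solutions mu eta tau x -> (`|x i| < K)%N.
  move=> [xpos xlt]; set y := (x i)%:~R - mu i.
  have y0 : 0 < y by rewrite subr_gt0.
  have ylt : y ^+ 3 <= C.
    have : y ^+ 3 <= shifted_cubes mu x.
      rewrite /shifted_cubes (bigD1 i)//= lerDl sumr_ge0// => j _.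
      by rewrite exprn_ge0// subr_ge0 ltW.
    move/le_trans; apply.
    have := ler_norm tau; have := ler_norm eta.
    have := le_lt_trans (ler_norm _) xlt; rewrite /C => a b c.
    rewrite ltrBlDr in a; apply: (le_trans (ltW a)).
    by rewrite addrC lerD//; apply: (le_trans c); rewrite lerDr.
  have yC : y <= C.
    have [y1|/ltW y1] := leP y 1; first exact: le_trans C1.
    by apply: le_trans ylt; rewrite -[leLHS]expr1 ler_weXn2l.
  have : `|(x i)%:~R : R| <= C + \sum_i `|mu i|.
    have -> : (x i)%:~R = y + mu i by rewrite subrK.
    apply: le_trans (ler_normD _ _) _; apply: lerD; first by rewrite gtr0_norm.
    by rewrite (bigD1 i)//= lerDl sumr_ge0.
  have S0 : 0 <= C + \sum_i `|mu i|.
    by rewrite addr_ge0 ?sumr_ge0// (le_trans ler01).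
  move/le_lt_trans => /(_ _ (archi_boundP S0)).
  by rewrite -intr_norm -[K%:R]/(K%:Z%:~R) ltr_int -abszE ltz_nat.
pose g (f : {ffun 'I_s -> 'I_(K + K)}) : {ffun 'I_s -> int} :=
  [ffun i => (f i : nat)%:Z - K%:Z].
apply: (@sub_finite_set _ _ (g @` setT)); last exact: finite_image.
move=> x /(fun h i => bnd x i h) xK.
have lt i : (absz (x i + K%:Z)%R < K + K)%N.
  have := xK i; rewrite -!ltz_nat !abszE PoszD ltr_norml => /andP[a b].
  rewrite ger0_norm; first by rewrite ltrD2r.
  by rewrite -lerBlDr sub0r ltW.
exists [ffun i => Ordinal (lt i)] => //.
apply/ffunP => i; rewrite !ffunE /= abszE ger0_norm ?addrK//.
by have := xK i; rewrite -ltz_nat abszE ltr_norml => /andP[a _];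
  rewrite -lerBlDr sub0r ltW.
Qed.

(* Main.v *)
(** The circle method with finite grid sums in place of integrals. Writing
x_i = floor(mu_i) + 1 + k_i, the solutions become points k in [0, P)^s, with
P of order tau^(1/3), for which sum_i (theta_i + k_i)^3 lies within eta of tau.
Their exponential sum is the product of the sums f_i(alpha) =
sum_(k < P) e(alpha (theta_i + k)^3), to be compared at the points alpha = k/L,
k < T L, with h(alpha)^s. Here h is the polynomial obtained by truncating a
multiple of (1 - z)^(-1/3) at z = e(alpha/M); the coefficients of h^s are, by
Vandermonde's identity, those of (1 - z)^(-s/3), whose growth
n^(s/3-1) / Gamma(s/3) produces the main term.

Near alpha = 0, f_i and h agree by partial summation. Off the major arcs,
Weyl's inequality |f| << P^(3/4 + eps) and the mean square sum |f|^2 << L P give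
sum |f|^11 << L P^(9 * 3/4 + 1 + eps) = o(L P^8), which is why s >= 11 suffices.
On the major arcs away from 0, irrationality of theta_1 forces f_1 = o(P), since
a van der Corput step of length a multiple of the denominator leaves linear
phases of slope n theta_1 with 1 <= n = O(1), up to a negligible error. Hence prod f_i and h^s are close in mean, so
both point measures have nearly the same Fejer means, and the interval of
half-width eta is sandwiched between sums of translated Fejer kernels. *)

Require Import Defs.
From mathcomp Require Import ring lra zify.
From mathcomp Require Import complex measurable_realfun.
Import Order.TTheory GRing.Theory Num.Theory.
Import numFieldNormedType.Exports.
Local Open Scope classical_set_scope.
Local Open Scope ring_scope.

Set Implicit Arguments.
Unset Strict Implicit.
Unset Printing Implicit Defensive.

(** * Exponential sums on the unit circle *)

Section Exponential.
Variable R : realType.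
Implicit Types (x y : R) (z w : R[i]).

(** Irrationality of one shift gives [o(P)] without a rate, so it can be used only on boundedly many
    major arcs and below a fixed frequency [T]. This dictates the order of choices: the accuracy
    fixes [T], then [M = 2 * T] and the size [B] of the major arcs, then [tau] with [P], and at last
    [L], as large as wished. Smoothing at scale [1 / T] leaves an error governed by [T] alone. The
    grid denominator [L] is free because a kernel with frequencies [k / L] has period [L], longer
    than the range of the points; sums over residues then replace integrals. The model has period
    [M] in [alpha] and must be small on the whole grid away from 0, hence [2 * T <= M]. Fejer
    kernels have tails of order [1 / u^2], so the lower bound for the count first needs an upper
    bound for the points outside the interval; the comparison with [T = 1] supplies it. Exponents
    such as 3/4, 5/2 or 1/36 are mostly avoided by raising inequalities to integer powers, which is
    the origin of exponents like 144. *)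

Lemma sumr_ord_const (n : nat) x : \sum_(i < n) x = n%:R * x.
Proof. by rewrite sumr_const card_ord mulr_natl. Qed.

(** Real-valued modulus: the norm of [R[i]] takes its values in [R[i]] itself, whereas all estimates
    are made in the ordered field [R]. *)
Definition cnorm z : R := Normc.normc z.

Definition expi x : R[i] := Complex (cos (2 * pi * x)) (sin (2 * pi * x)).

Lemma cnormE z : (cnorm z)%:C%C = `|z|.
Proof. by case: z. Qed.

Lemma cnorm_ge0 z : 0 <= cnorm z.
Proof. by case: z => a b; exact: sqrtr_ge0. Qed.

Lemma cnorm0 : cnorm 0 = 0. Proof. exact: Normc.normc0. Qed.
Lemma cnorm1 : cnorm 1 = 1. Proof. exact: Normc.normc1. Qed.
Lemma cnormM z w : cnorm (z * w) = cnorm z * cnorm w.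
Proof. exact: Normc.normcM. Qed.
Lemma cnormX z n : cnorm (z ^+ n) = cnorm z ^+ n.
Proof. by elim: n => [|n IH]; rewrite ?expr0 ?cnorm1// !exprS cnormM IH. Qed.
Lemma cnormN z : cnorm (- z) = cnorm z. Proof. exact: normcN. Qed.
Lemma cnormB z w : cnorm (z - w) = cnorm (w - z).
Proof. by rewrite -cnormN opprB. Qed.
Lemma ler_cnormD z w : cnorm (z + w) <= cnorm z + cnorm w.
Proof. exact: le_normcD. Qed.
Lemma ler_cnormB z w : cnorm (z - w) <= cnorm z + cnorm w.
Proof. by rewrite -(cnormN w); exact: ler_cnormD. Qed.

Lemma cnorm_sqr z : cnorm z ^+ 2 = complex.Re z ^+ 2 + complex.Im z ^+ 2.
Proof. by case: z => a b /=; rewrite sqr_sqrtr// addr_ge0// sqr_ge0. Qed.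

Lemma cnorm_real x : cnorm x%:C%C = `|x|.
Proof. by rewrite /cnorm /= expr0n /= addr0 sqrtr_sqr. Qed.

Lemma cnorm_conj z : cnorm z^*%C = cnorm z.
Proof. by case: z => a b; rewrite /cnorm /= sqrrN. Qed.

Lemma ler_Re_cnorm z : `|complex.Re z| <= cnorm z.
Proof.
rewrite -(@ler_pXn2r _ 2%N)// ?nnegrE ?cnorm_ge0//.
by rewrite real_normK ?num_real// cnorm_sqr lerDl sqr_ge0.
Qed.

Lemma cnorm_prod (I : Type) (r : seq I) (P : pred I) (F : I -> R[i]) :
  cnorm (\prod_(i <- r | P i) F i) = \prod_(i <- r | P i) cnorm (F i).
Proof. by apply: (big_morph cnorm cnormM cnorm1). Qed.

Lemma ler_cnorm_sum (I : Type) (r : seq I) (P : pred I) (F : I -> R[i]) :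
  cnorm (\sum_(i <- r | P i) F i) <= \sum_(i <- r | P i) cnorm (F i).
Proof.
elim/big_rec2: _ => [|i y z _ IH]; first by rewrite cnorm0.
by apply: le_trans (ler_cnormD _ _) _; rewrite lerD2l.
Qed.

Lemma Re_sum (I : Type) (r : seq I) (P : pred I) (F : I -> R[i]) :
  complex.Re (\sum_(i <- r | P i) F i) = \sum_(i <- r | P i) complex.Re (F i).
Proof. by apply: (big_morph (@complex.Re R)) => // -[a b] [c d]. Qed.

Lemma Re_mulC x z : complex.Re (x%:C%C * z) = x * complex.Re z.
Proof. by case: z => a b /=; rewrite mul0r subr0. Qed.

Lemma conjc_sum (I : Type) (r : seq I) (P : pred I) (F : I -> R[i]) :
  (\sum_(i <- r | P i) F i)^*%C = \sum_(i <- r | P i) ((F i)^*%C).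
Proof. exact: rmorph_sum. Qed.

Lemma cnorm_sqr_conj z : (cnorm z ^+ 2)%:C%C = z * z^*%C.
Proof. by rewrite rmorphXn /= cnormE sqr_normc. Qed.

Lemma expiD x y : expi (x + y) = expi x * expi y.
Proof.
rewrite /expi mulrDr cosD sinD.
by apply/eqP; rewrite eq_complex /= eqxx /= addrC mulrC [X in _ + X]mulrC addrC.
Qed.

Lemma expi0 : expi 0 = 1.
Proof. by rewrite /expi mulr0 cos0 sin0. Qed.

Lemma expiN x : expi (- x) = (expi x)^*%C.
Proof. by rewrite /expi mulrN cosN sinN. Qed.

Lemma cnorm_expi x : cnorm (expi x) = 1.
Proof. by rewrite /cnorm /= cos2Dsin2 sqrtr1. Qed.

Lemma expiM_nat x (n : nat) : expi (n%:R * x) = expi x ^+ n.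
Proof.
elim: n => [|n IH]; first by rewrite mul0r expi0 expr0.
by rewrite -addn1 natrD mulrDl mul1r expiD IH exprD expr1.
Qed.

Lemma expi1 : expi 1 = 1.
Proof. by rewrite /expi mulr1 mulr_natl cos2pi sin2pi. Qed.

Lemma expi_nat (n : nat) : expi n%:R = 1.
Proof. by rewrite -(mulr1 n%:R) expiM_nat expi1 expr1n. Qed.

Lemma expi_int (n : int) : expi n%:~R = 1.
Proof.
case: n => n; first exact: expi_nat.
by rewrite NegzE mulrNz expiN expi_nat rmorph1.
Qed.

Lemma expiB x y : expi (x - y) = expi x * (expi y)^*%C.
Proof. by rewrite expiD expiN. Qed.

Lemma cnorm_expi_sub1_sqr x : cnorm (expi x - 1) ^+ 2 = 4 * sin (pi * x) ^+ 2.
Proof.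
rewrite cnorm_sqr /expi /= subr0.
have -> : 2 * pi * x = (pi * x) *+ 2 by rewrite mulr2n; ring.
rewrite cos_mulr2n sin_mulr2n.
have := cos2Dsin2 (pi * x); set c := cos _; set d := sin _ => h.
have -> : (c ^+ 2 *+ 2 - 1 - 1) ^+ 2 + (c * d *+ 2) ^+ 2 =
  4 * (c ^+ 2 - 1) ^+ 2 + 4 * c ^+ 2 * d ^+ 2 by ring.
have -> : c ^+ 2 = 1 - d ^+ 2 by rewrite -h addrK.
ring.
Qed.

Lemma sin_le_id x : 0 <= x -> sin x <= x.
Proof.
rewrite le_eqVlt => /predU1P[<-|x0]; first by rewrite sin0.
have [|] := @MVT R sin cos 0 x x0 (fun y _ => is_derive_sin y).
  by apply: continuous_subspaceT => y; exact: continuous_sin.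
move=> c _; rewrite sin0 !subr0 => ->.
by apply: ler_piMl; [exact: ltW | exact: cos_le1].
Qed.

Lemma abs_sin_le x : `|sin x| <= `|x|.
Proof.
have H y : 0 <= y -> `|sin y| <= y.
  move=> y0; rewrite ler_norml sin_le_id// andbT.
  have [y1|y1] := leP 1 y.
    by apply: le_trans (sin_geN1 _); rewrite lerN2.
  apply: le_trans (_ : 0 <= _); first by rewrite oppr_le0.
  apply: sin_ge0_pi; rewrite y0 /= (le_trans (ltW y1))//.
  by apply: le_trans (pi_ge2 _); rewrite ler1n.
have [x0|x0] := leP 0 x; first by rewrite (ger0_norm x0) H.
by rewrite -normrN -sinN -(normrN x) (gtr0_norm (_ : 0 < - x)) ?oppr_gt0// H// oppr_ge0 ltW.
Qed.

(** The sharp constant is [2 * pi]; the integer 8 comes from [pi < 4]. *)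
Lemma cnorm_expi_sub1_le x : cnorm (expi x - 1) <= 8 * `|x|.
Proof.
rewrite -(@ler_pXn2r _ 2%N)// ?nnegrE ?cnorm_ge0// ?mulr_ge0//.
rewrite cnorm_expi_sub1_sqr exprMn.
have h : sin (pi * x) ^+ 2 <= (4 * `|x|) ^+ 2.
  rewrite -(real_normK (num_real (sin _))) lerXn2r ?nnegrE ?mulr_ge0//.
  apply: le_trans (abs_sin_le _) _; rewrite normrM ger0_norm ?pi_ge0//.
  rewrite ler_wpM2r//.
  by have := @pihalf_lt2 R; lra.
by apply: le_trans (_ : 4 * (4 * `|x|) ^+ 2 <= _); [rewrite ler_wpM2l | rewrite exprMn; lra].
Qed.

Lemma cnorm_expiB_le x y : cnorm (expi x - expi y) <= 8 * `|x - y|.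
Proof.
have -> : expi x - expi y = expi y * (expi (x - y) - 1).
  by rewrite mulrBr mulr1 -expiD; congr (expi _ - _); ring.
by rewrite cnormM cnorm_expi mul1r cnorm_expi_sub1_le.
Qed.

(* The mean value theorem on [0, y] and on [y, pi/2], together with the
   monotonicity of cos, gives the concavity bound. *)
Lemma jordan_sin x : 0 <= x <= pi / 2 -> 2 * x <= pi * sin x.
Proof.
move=> /andP[]; rewrite le_eqVlt => /predU1P[<- _|x0].
  by rewrite sin0 !mulr0.
rewrite le_eqVlt => /predU1P[->|xpi].
  by rewrite sin_pihalf mulr1 mulrCA divff// mulr1.
have cs (a b : R) : {within `[a, b], continuous (@sin R)}.
  by apply: continuous_subspaceT => y; exact: continuous_sin.
have [c] := @MVT R sin cos 0 x x0 (fun y _ => is_derive_sin y) (cs _ _).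
rewrite in_itv /= => /andP[c0 cx]; rewrite sin0 !subr0 => sx.
have [d] := @MVT R sin cos x (pi / 2) xpi (fun y _ => is_derive_sin y) (cs _ _).
rewrite in_itv /= => /andP[dx dpi]; rewrite sin_pihalf => sd.
have p0 := @pi_gt0 R.
have cd : cos d <= cos c.
  by apply: ltW; rewrite ltr_cos ?in_itv /= ?(lt_trans cx)//; apply/andP; split; lra.
have {}sd : 1 - sin x <= cos c * (pi / 2 - x) by rewrite sd ler_wpM2r// subr_ge0 ltW.
have : x * (1 - sin x) <= (cos c * x) * (pi / 2 - x).
  by rewrite mulrAC [cos c * _ * x]mulrC ler_wpM2l// ltW.
by rewrite -sx; lra.
Qed.

Lemma cnorm_expi_sub1_ge x : `|x| <= 1 / 2 -> 4 * `|x| <= cnorm (expi x - 1).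
Proof.
move=> hx.
rewrite -(@ler_pXn2r _ 2%N)// ?nnegrE ?cnorm_ge0// ?mulr_ge0//.
rewrite cnorm_expi_sub1_sqr.
have -> : sin (pi * x) ^+ 2 = sin (pi * `|x|) ^+ 2.
  have [x0|x0] := leP 0 x; first by rewrite ger0_norm.
  by rewrite ltr0_norm// mulrN sinN sqrrN.
have p0 := @pi_gt0 R.
have := @jordan_sin (pi * `|x|); rewrite mulr_ge0 ?pi_ge0//=.
have -> : pi * `|x| <= pi / 2 by rewrite ler_pM2l// ; lra.
move=> /(_ isT) h.
have {}h : 2 * `|x| <= sin (pi * `|x|).
  by rewrite -(ler_pM2l p0) (le_trans _ h)// mulrCA.
have : (2 * `|x|) ^+ 2 <= sin (pi * `|x|) ^+ 2.
  by rewrite lerXn2r ?nnegrE// ?(le_trans _ h)// ?mulr_ge0.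
rewrite !exprMn; lra.
Qed.

(* The representative of [x] modulo 1 in [-1/2, 1/2). *)
Definition rho x : R := x - (Num.floor (x + 1 / 2))%:~R.

Lemma rho_itv x : - (1 / 2) <= rho x < 1 / 2.
Proof.
rewrite /rho; have := Num.Theory.floor_itv (x + 1 / 2).
rewrite intrD => /andP[h1 h2]; apply/andP; split; lra.
Qed.

Lemma abs_rho_le x : `|rho x| <= 1 / 2.
Proof. by have := rho_itv x; rewrite ler_norml => /andP[-> /ltW ->]. Qed.

Lemma expi_rho x : expi (rho x) = expi x.
Proof. by rewrite /rho expiB expi_int rmorph1 mulr1. Qed.

Lemma rho_eq x (n : int) : - (1 / 2) <= x - n%:~R < 1 / 2 -> rho x = x - n%:~R.
Proof.
move=> h; rewrite /rho (_ : Num.floor _ = n)//; apply: floor_def.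
by rewrite intrD; lra.
Qed.

Lemma rho_le_dist x (n : int) : `|rho x| <= `|x - n%:~R|.
Proof.
have [h|h] := leP (1 / 2) `|x - n%:~R|; first exact: le_trans (abs_rho_le x) h.
by rewrite (@rho_eq x n)//; move: h; rewrite ltr_norml => /andP[h1 ->]; rewrite ltW.
Qed.

Lemma cnorm_expi_rho_ge x : 4 * `|rho x| <= cnorm (expi x - 1).
Proof. by rewrite -expi_rho; exact: cnorm_expi_sub1_ge (abs_rho_le x). Qed.

(* The minimum of N and 1 / (2 |rho x|), immune to the junk value of 1 / 0. *)
Definition mbound (N : nat) x : R :=
  if 2 * `|rho x| * N%:R <= 1 then N%:R else (2 * `|rho x|)^-1.

Lemma mbound_ge0 N x : 0 <= mbound N x.
Proof. by rewrite /mbound; case: ifP => // _; rewrite invr_ge0 mulr_ge0. Qed.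

Lemma mbound_leN N x : mbound N x <= N%:R.
Proof.
rewrite /mbound; case: ifPn => //; rewrite -ltNge => h.
have r0 : 0 < 2 * `|rho x|.
  rewrite lt_def mulr_ge0// andbT; apply: contraTneq h => ->.
  by rewrite mul0r -leNgt.
by rewrite -(ler_pM2l r0) divff ?gt_eqF// ltW.
Qed.

Lemma mbound_le_inv N x r : 0 < r -> r <= `|rho x| -> mbound N x <= (2 * r)^-1.
Proof.
move=> r0 rx; have x0 : 0 < 2 * `|rho x| by rewrite mulr_gt0// (lt_le_trans r0).
have h : (2 * `|rho x|)^-1 <= (2 * r)^-1.
  by rewrite lef_pV2 ?posrE// ?mulr_gt0// ler_pM2l.
rewrite /mbound; case: ifPn => // h'; apply: le_trans h.
by rewrite -(ler_pM2l x0) divff ?gt_eqF.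
Qed.

Lemma mbound_ge N x c : c <= N%:R -> 2 * `|rho x| * c <= 1 -> c <= mbound N x.
Proof.
move=> cN h; rewrite /mbound; case: ifPn => //; rewrite -ltNge => h'.
have r0 : 0 < 2 * `|rho x|.
  rewrite lt_def mulr_ge0// andbT; apply: contraTneq h' => ->.
  by rewrite mul0r -leNgt.
by rewrite -(ler_pM2l r0) divff ?gt_eqF.
Qed.

Lemma cnorm_geom_le z (n : nat) : cnorm z = 1 ->
  cnorm (z - 1) * cnorm (\sum_(k < n) z ^+ k) <= 2.
Proof.
move=> z1; rewrite -cnormM -subrX1.
by apply: le_trans (ler_cnormB _ _) _; rewrite cnormX z1 expr1n cnorm1.
Qed.

Lemma cnorm_geom_expi x (n N : nat) : (n <= N)%N ->
  cnorm (\sum_(k < n) expi x ^+ k) <= mbound N x.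
Proof.
move=> nN; apply: mbound_ge.
  apply: le_trans (ler_cnorm_sum _ _ _) _.
  under eq_bigr do rewrite cnormX cnorm_expi expr1n.
  by rewrite sumr_const card_ord ler_nat.
have := @cnorm_geom_le (expi x) n (cnorm_expi x).
set S := cnorm (\sum_(_ < _) _) => h.
have S0 : 0 <= S by exact: cnorm_ge0.
have := ler_wpM2r S0 (cnorm_expi_rho_ge x); lra.
Qed.

(** [rho] is not odd, since the class of 1/2 is represented by -1/2; its absolute value is even,
    being the distance to the nearest integer. *)
Lemma mboundN N x : mbound N (- x) = mbound N x.
Proof.
rewrite /mbound; suff -> : `|rho (- x)| = `|rho x| by [].
apply/eqP; rewrite eq_le; apply/andP; split.
  rewrite (le_trans (rho_le_dist _ (- Num.floor (x + 1 / 2))))//.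
  by rewrite mulrNz opprK /rho -normrN opprD opprK.
rewrite (le_trans (rho_le_dist _ (- Num.floor (- x + 1 / 2))))//.
by rewrite mulrNz opprK /rho -normrN opprD.
Qed.
End Exponential.

(** * Weyl's inequality *)

Section Weyl.
Variable R : realType.
Implicit Types (a : nat -> R[i]) (al theta : R).

Lemma sqr_sum_le (n : nat) (x : 'I_n -> R) :
  (\sum_(i < n) x i) ^+ 2 <= n%:R * \sum_(i < n) x i ^+ 2.
Proof.
elim: n x => [|n IH] x; first by rewrite !big_ord0 expr0n /= mulr0.
rewrite !big_ord_recr /=; set S := \sum_(i < n) _; set Q := \sum_(i < n) _.
set y := x ord_max; have {IH}h : S ^+ 2 <= n%:R * Q by exact: IH.
have Q0 : 0 <= Q by apply: sumr_ge0 => i _; exact: sqr_ge0.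
have h2 : S * y *+ 2 <= Q + n%:R * y ^+ 2.
  case: n x S Q y h Q0 => [|n] x S Q y h Q0.
    rewrite mul0r in h; have S0 : S = 0.
      by apply/eqP; rewrite -sqrf_eq0 eq_le h sqr_ge0.
    by rewrite S0 mul0r mul0rn mul0r addr0.
  have n0 : 0 < n.+1%:R :> R by rewrite ltr0n.
  rewrite -(ler_pM2l n0) mulrDr.
  have : 0 <= (S - n.+1%:R * y) ^+ 2 by exact: sqr_ge0.
  by nra.
by rewrite -[n.+1%:R]natr1 sqrrD mulrDl mul1r !mulrDr -/Q; lra.
Qed.

(** Pairs of indices are grouped by their difference [i.+1], and conjugate pairs merge into a real
    part. *)
Lemma cnorm_sum_sqr a (n : nat) :
  cnorm (\sum_(k < n) a k) ^+ 2 = \sum_(k < n) cnorm (a k) ^+ 2 +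
    2 * \sum_(i < n) complex.Re (\sum_(k < n - i.+1) a (k + i.+1)%N * ((a k)^*)%C).
Proof.
elim: n => [|n IH]; first by rewrite !big_ord0 cnorm0 expr0n mulr0 addr0.
have DE (z w : R[i]) : cnorm (z + w) ^+ 2 =
    cnorm z ^+ 2 + cnorm w ^+ 2 + 2 * complex.Re (w * (z^*)%C).
  by rewrite !cnorm_sqr; case: z => ? ?; case: w => ? ? /=; ring.
rewrite big_ord_recr /= DE IH [in RHS]big_ord_recr /=.
suff -> : \sum_(i < n.+1) complex.Re (\sum_(k < n.+1 - i.+1) a (k + i.+1)%N * ((a k)^*)%C)
  = \sum_(i < n) complex.Re (\sum_(k < n - i.+1) a (k + i.+1)%N * ((a k)^*)%C)
  + complex.Re (a n * ((\sum_(k < n) a k)^*)%C) by ring.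
rewrite big_ord_recr /= subnn big_ord0 addr0 conjc_sum mulr_sumr Re_sum.
rewrite -(big_mkord xpredT (fun k => complex.Re (a n * ((a k)^*)%C))).
(* At difference [i.+1] the new term [a n] pairs with the index [n - i.+1], hence the reversal. *)
rewrite big_nat_rev /= big_mkord -big_split /=; apply: eq_bigr => i _.
rewrite subSn ?ltn_ord// big_ord_recr /= add0n subnK ?ltn_ord//.
by case: (\sum_(_ < _) _) => ? ?; case: (_ * _).
Qed.

Lemma van_der_corput a (n : nat) : (forall k, cnorm (a k) = 1) ->
  cnorm (\sum_(k < n) a k) ^+ 2 <= n%:R +
    2 * \sum_(i < n) cnorm (\sum_(k < n - i.+1) a (k + i.+1)%N * ((a k)^*)%C).
Proof.
move=> a1; rewrite cnorm_sum_sqr; apply: lerD.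
  by under eq_bigr do rewrite a1 expr1n; rewrite sumr_const card_ord.
rewrite ler_wpM2l// ler_sum// => i _.
exact: le_trans (ler_norm _) (ler_Re_cnorm _).
Qed.

Definition cubesum theta (P : nat) al : R[i] :=
  \sum_(k < P) expi (al * (theta + k%:R) ^+ 3).

Lemma cnorm_cubesum_le theta P al : cnorm (cubesum theta P al) <= P%:R.
Proof.
apply: le_trans (ler_cnorm_sum _ _ _) _.
by under eq_bigr do rewrite cnorm_expi; rewrite sumr_const card_ord.
Qed.

(** Differencing by [i] makes the phase quadratic in [k]; differencing again by [j.+1] makes it
    linear with slope [6 * al * i * j.+1], so that only geometric sums remain. *)
Lemma cnorm_cubesum_diff theta (P i n : nat) al : (n <= P)%N ->
  cnorm (\sum_(k < n) expi (al * (theta + (k + i)%:R) ^+ 3) *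
     ((expi (al * (theta + k%:R) ^+ 3))^*)%C) ^+ 2 <=
  P%:R + 2 * \sum_(j < P) mbound P (6 * al * (i * j.+1)%:R).
Proof.
move=> nP; under eq_bigr do rewrite -expiB.
set b := fun k : nat => expi (al * (theta + (k + i)%:R) ^+ 3 - al * (theta + k%:R) ^+ 3).
apply: le_trans (van_der_corput (a := b) n _) _; first by move=> k; rewrite cnorm_expi.
apply: lerD; first by rewrite ler_nat.
rewrite ler_wpM2l// (big_ord_widen_cond P (fun _ => true)
  (fun j => cnorm (\sum_(k < n - j.+1) b (k + j.+1)%N * ((b k)^*)%C)))//.
rewrite [leRHS](bigID (fun j : 'I_P => (j < n)%N)) /=.
rewrite ler_wpDr//; first by apply: sumr_ge0 => j _; exact: mbound_ge0.
apply: ler_sum => j _.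
set x := 6 * al * (i * j.+1)%:R.
have E (k : nat) : b (k + j.+1)%N * ((b k)^*)%C =
   expi (x * theta + 3 * al * (i * j.+1)%:R * (i%:R + j.+1%:R)) * expi x ^+ k.
  rewrite /b -expiB -expiM_nat -expiD; congr expi.
  by rewrite /x !natrM !natrD; ring.
under eq_bigr do rewrite E.
rewrite -mulr_sumr cnormM cnorm_expi mul1r; apply: cnorm_geom_expi.
by rewrite (leq_trans (leq_subr _ _)).
Qed.

(** Two differencings with Cauchy's inequality between them. With [G] the sum of the [g i], the
    bounds [(p + 2 * G)^2 <= 2 * p^2 + 8 * G^2] and [G^2 <= p * (p^2 + 2 * B)] give [10 = 2 + 8] and
    [16 = 8 * 2]. *)
Lemma weyl_cubic theta (P : nat) al :
  cnorm (cubesum theta P al) ^+ 4 <= 10 * P%:R ^+ 3 +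
    16 * P%:R * \sum_(i < P) \sum_(j < P) mbound P (6 * al * (i.+1 * j.+1)%:R).
Proof.
set B := \sum_(i < P) _; set p : R := P%:R.
have p0 : 0 <= p by rewrite ler0n.
have B0 : 0 <= B by do 2 (apply: sumr_ge0 => ? _); exact: mbound_ge0.
set a := fun k : nat => expi (al * (theta + k%:R) ^+ 3).
set g := fun i : 'I_P => cnorm (\sum_(k < P - i.+1) a (k + i.+1)%N * ((a k)^*)%C).
have h1 : cnorm (cubesum theta P al) ^+ 2 <= p + 2 * \sum_i g i.
  by apply: (van_der_corput (a := a)) => k; rewrite cnorm_expi.
have h2 : (\sum_i g i) ^+ 2 <= p * (p * p + 2 * B).
  apply: le_trans (sqr_sum_le _) _; rewrite ler_wpM2l//.
  apply: le_trans (_ : \sum_(i < P) (p + 2 * \sum_(j < P) mbound P (6 * al * (i.+1 * j.+1)%:R)) <= _).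
    apply: ler_sum => i _; apply: cnorm_cubesum_diff; exact: leq_subr.
  by rewrite big_split /= sumr_const card_ord -mulr_sumr -/B -[p *+ _]mulr_natr.
have [P0|P0] := posnP P.
  by rewrite /cubesum P0 big_ord0 cnorm0 !expr0n /= -/B addr_ge0 ?mulr_ge0.
have p1 : 1 <= p by rewrite ler1n.
have g0 : 0 <= \sum_i g i by apply: sumr_ge0 => ? _; exact: cnorm_ge0.
have h3 : (cnorm (cubesum theta P al) ^+ 2) ^+ 2 <= (p + 2 * \sum_i g i) ^+ 2.
  by rewrite lerXn2r ?nnegrE ?sqr_ge0// addr_ge0// mulr_ge0.
rewrite -(exprM _ 2 2) in h3.
apply: le_trans h3 _.
have h4 : (p + 2 * \sum_i g i) ^+ 2 <= 2 * p ^+ 2 + 8 * (\sum_i g i) ^+ 2.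
  have : 0 <= (p - 2 * \sum_i g i) ^+ 2 by exact: sqr_ge0.
  by nra.
have h5 : p ^+ 2 <= p ^+ 3 by rewrite [leRHS]exprS ler_peMl// exprn_ge0.
by apply: le_trans h4 _; nra.
Qed.
End Weyl.

(** * The divisor bound *)

Section DivisorBound.
Local Open Scope nat_scope.

Definition ndiv (n : nat) : nat := size (divisors n).

Lemma dvdn_div_gcdn (q i j : nat) : 0 < q -> q %| i * j -> q %/ gcdn q i %| j.
Proof.
move=> q0 qij; have g0 : 0 < gcdn q i by rewrite gcdn_gt0 q0.
have cop : coprime (q %/ gcdn q i) (i %/ gcdn q i).
  rewrite /coprime -(eqn_pmul2l g0) muln_gcdr muln1 ![gcdn q i * _]mulnC.
  by rewrite !divnK ?dvdn_gcdl ?dvdn_gcdr.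
rewrite -(Gauss_dvdr _ cop) -(dvdn_pmul2l g0) mulnA ![gcdn q i * _]mulnC.
by rewrite !divnK ?dvdn_gcdl ?dvdn_gcdr.
Qed.

(** Sending [d] to [gcdn d a] and its cofactor embeds the divisors of [a * b] in the pairs of a
    divisor of [a] and a divisor of [b]. *)
Lemma ndivM (a b : nat) : 0 < a -> 0 < b -> ndiv (a * b) <= ndiv a * ndiv b.
Proof.
move=> a0 b0; rewrite /ndiv -(size_allpairs pair) -(size_map (fun d => (gcdn d a, d %/ gcdn d a))).
apply: uniq_leq_size.
  rewrite map_inj_uniq ?divisors_uniq// => d d' [e1 e2].
  by rewrite -(divnK (dvdn_gcdl d a)) e2 e1 (divnK (dvdn_gcdl d' a)).
move=> _ /mapP[d + ->]; rewrite -dvdn_divisors ?muln_gt0 ?a0// => dab.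
apply/allpairsP; exists (gcdn d a, d %/ gcdn d a); split => //=.
  by rewrite -dvdn_divisors// dvdn_gcdr.
rewrite -dvdn_divisors//; apply: dvdn_div_gcdn => //.
by rewrite (dvdn_gt0 _ dab)// muln_gt0 a0.
Qed.

Lemma ndiv_pX (p e : nat) : prime p -> ndiv (p ^ e) <= e.+1.
Proof.
move=> pp; rewrite -[leqRHS](size_iota 0) -(size_map (expn p)) /ndiv.
apply: uniq_leq_size => [|d]; first exact: divisors_uniq.
rewrite -dvdn_divisors ?expn_gt0 ?prime_gt0// => /(dvdn_pfactor _ _ pp)[m me ->].
by apply: map_f; rewrite mem_iota.
Qed.

(** With [q = e %/ k.+1] one has [e.+1 <= k.+1 * q.+1 <= k.+1 * 2 ^ q], and the power [k.+1] of
    [2 ^ q] is at most [2 ^ e]. *)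
Lemma succX_le (k e p : nat) : 1 < p -> e.+1 ^ k.+1 <= k.+1 ^ k.+1 * p ^ e.
Proof.
move=> p1; set q := e %/ k.+1.
have h : e.+1 <= k.+1 * 2 ^ q.
  apply: leq_trans (_ : k.+1 * q.+1 <= _).
    by rewrite mulnC; exact: ltn_ceil.
  by rewrite leq_mul2l ltn_expl.
apply: leq_trans (_ : (k.+1 * 2 ^ q) ^ k.+1 <= _); first by rewrite leq_exp2r.
rewrite expnMn -expnM leq_mul2l; apply/orP; right.
apply: leq_trans (_ : 2 ^ e <= _); first by rewrite leq_exp2l// leq_trunc_div.
by have [->//|e0] := posnP e; rewrite leq_exp2r.
Qed.

Lemma leq_subS_neq (N j q : nat) : q != N - j.+1 -> N - j.+1 <= q -> N - j <= q.
Proof. by lia. Qed.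

(** A prime [p >= 2 ^ k.+1] costs nothing, because [e.+1 <= 2 ^ e] gives [e.+1 ^ k.+1 <= p ^ e];
    each smaller prime costs one factor [k.+1 ^ k.+1]. The induction on [j] lowers the threshold for
    the prime factors by one. *)
Lemma ndiv_le_rough (k j n : nat) : 0 < n ->
  (forall p, prime p -> p %| n -> 2 ^ k.+1 - j <= p) ->
  ndiv n ^ k.+1 <= (k.+1 ^ k.+1) ^ j * n.
Proof.
have split_p p m : prime p -> 0 < m -> exists e m', [/\ m = p ^ e * m', 0 < m',
    ~~ (p %| m'), (p %| m -> 0 < e) & ndiv m <= e.+1 * ndiv m'].
  move=> pp m0; have [m' cop em] := pfactor_coprime pp m0.
  have m'0 : 0 < m' by move: m0; rewrite em muln_gt0 => /andP[].
  exists (logn p m), m'; split => //; first by rewrite mulnC.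
  - by rewrite -prime_coprime.
  - by move=> pm; rewrite logn_gt0 mem_primes pp m0 pm.
  - rewrite {1}em mulnC; apply: leq_trans (ndivM _ _) _ => //.
    by rewrite leq_mul2r ndiv_pX ?orbT.
elim: j n => [|j IH] n n0 hp.
  rewrite expn0 mul1n; elim/ltn_ind: n n0 hp => n IH n0 hp.
  have [n1|n1] := leqP n 1.
    have -> : n = 1 by apply/eqP; rewrite eqn_leq n1.
    by rewrite exp1n.
  have pp := pdiv_prime n1; have pd := pdiv_dvd n.
  have [e [m [en m0 _ e0 hd]]] := split_p _ _ pp n0.
  have hm : ndiv m ^ k.+1 <= m.
    apply: IH => //.
      rewrite en ltn_Pmull// -[X in X < _](expn0 (pdiv n)).
      by rewrite ltn_exp2l ?prime_gt1// e0.
    move=> p pr pm; apply: hp => //; rewrite en; exact: dvdn_mull.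
  apply: leq_trans (_ : (e.+1 * ndiv m) ^ k.+1 <= _); first by rewrite leq_exp2r.
  rewrite expnMn [leqRHS]en leq_mul//.
  apply: leq_trans (_ : (2 ^ e) ^ k.+1 <= _); first by rewrite leq_exp2r// ltn_expl.
  rewrite -expnM mulnC expnM; have [->//|e0'] := posnP e.
  by rewrite leq_exp2r//; have := hp _ pp pd; rewrite subn0.
set p := 2 ^ k.+1 - j.+1.
have [pr|npr] := boolP (prime p); last first.
  apply: leq_trans (IH n n0 _) _; last by rewrite leq_mul2r leq_pexp2l ?expn_gt0 ?orbT.
  move=> q qp qn; have := hp _ qp qn.
  have : q != p by apply: contraNneq npr => <-.
  by rewrite /p; exact: leq_subS_neq.
have [e [m [en m0 pm _ hd]]] := split_p _ _ pr n0.
have hm : ndiv m ^ k.+1 <= (k.+1 ^ k.+1) ^ j * m.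
  apply: IH => // q qp qm; have qn : q %| n by rewrite en dvdn_mull.
  have := hp _ qp qn; have : q != p by apply: contraNneq pm => <-.
  by rewrite /p; exact: leq_subS_neq.
apply: leq_trans (_ : (e.+1 * ndiv m) ^ k.+1 <= _); first by rewrite leq_exp2r.
by rewrite expnMn en (expnS _ j) mulnACA leq_mul// succX_le// prime_gt1.
Qed.

(** The estimate [ndiv n << n^(1/(k+1))] in integer powers: at [j = 2 ^ k.+1] the condition on the
    prime factors becomes empty. *)
Lemma divisor_bound (k : nat) : exists C : nat, 0 < C /\
  forall n, 0 < n -> ndiv n ^ k.+1 <= C * n.
Proof.
exists ((k.+1 ^ k.+1) ^ 2 ^ k.+1); split=> [|n n0]; first by rewrite !expn_gt0.
by apply: ndiv_le_rough => // p _ _; rewrite subnn.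
Qed.
End DivisorBound.

(** * Rational approximation and sums over residues *)

Section Diophantine.
Variable R : realType.
Implicit Types (w : R).

Lemma dirichlet w (Q : nat) : 0 <= w -> (0 < Q)%N -> exists q a : nat,
  [/\ (0 < q)%N, (q <= Q)%N, coprime a q & `|q%:R * w - a%:R| < Q%:R^-1].
Proof.
move=> w0 Q0; have Qr : 0 < Q%:R :> R by rewrite ltr0n.
pose A (q : nat) := (0 < q)%N && `[< exists a : nat, `|q%:R * w - a%:R| < Q%:R^-1 >].
have [q0 q0Q Aq0] : exists2 q, (q <= Q)%N & A q.
  pose fr (j : nat) : R := j%:R * w - (Num.floor (j%:R * w))%:~R.
  have fr_itv j : 0 <= fr j < 1.
    have := Num.Theory.floor_itv (j%:R * w); rewrite intrD /fr => /andP[h1 h2].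
    by apply/andP; split; lra.
  have box_lt j : (`|Num.floor (Q%:R * fr j)| < Q)%N.
    have /andP[f0 f1] := fr_itv j.
    have h : 0 <= Num.floor (Q%:R * fr j) by rewrite floor_ge0 mulr_ge0// ltW.
    rewrite -ltz_nat abszE ger0_norm// -(ltr_int R) (le_lt_trans (floor_le_tmp _))//.
    by rewrite -[X in _ < X]mulr1 ltr_pM2l.
  have [i [j [ij eb]]] : exists i j : 'I_Q.+1, (i < j)%N /\
      Num.floor (Q%:R * fr i) = Num.floor (Q%:R * fr j).
    pose box (j : 'I_Q.+1) := Ordinal (box_lt j).
    have : ~ injective box.
      by move/leq_card; rewrite !card_ord ltnn.
    move=> H; apply: contrapT => nex; apply: H => i j /(congr1 val) /= e.
    have e' : Num.floor (Q%:R * fr i) = Num.floor (Q%:R * fr j).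
      have g (k : nat) : 0 <= Num.floor (Q%:R * fr k).
        by rewrite floor_ge0 mulr_ge0 ?ler0n//; case/andP: (fr_itv k).
      by rewrite -(gez0_abs (g i)) e gez0_abs.
    apply/val_inj; case: (ltngtP i j) => // h; exfalso; apply: nex.
      by exists i, j.
    by exists j, i.
  have hd : `|fr j - fr i| < Q%:R^-1.
    have h1 := Num.Theory.floor_itv (Q%:R * fr i).
    have h2 := Num.Theory.floor_itv (Q%:R * fr j).
    move: h1 h2; rewrite eb intrD => /andP[a1 a2] /andP[b1 b2].
    rewrite -(ltr_pM2l Qr) divff ?gt_eqF// -[X in X * _](gtr0_norm Qr) -normrM.
    by rewrite ltr_norml mulrBr; apply/andP; split; lra.
  have q0 : (0 < j - i)%N by rewrite subn_gt0.
  exists (j - i)%N; first by rewrite (leq_trans (leq_subr _ _))// -ltnS.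
  rewrite /A q0 /=; apply/asboolP.
  pose z : int := Num.floor (j%:R * w) - Num.floor (i%:R * w).
  have hz : `|(j - i)%:R * w - z%:~R| < Q%:R^-1.
    by rewrite (_ : _ - _ = fr j - fr i)// /fr /z intrB natrB ?(ltnW ij)//; ring.
  have z0 : 0 <= z.
    have : -1 < z%:~R :> R.
      have h : 0 <= (j - i)%:R * w by rewrite mulr_ge0.
      have Q1 : Q%:R^-1 <= 1 :> R by rewrite invf_le1// ler1n.
      by move: hz; rewrite ltr_norml => /andP[_ hz]; lra.
    by rewrite -[-1]/((-1)%:~R) ltr_int; lia.
  exists `|z|%N; suff -> : (`|z|%N)%:R = z%:~R :> R by [].
  by rewrite natr_absz ger0_norm.
have exA : exists q, A q by exists q0.
(* The least admissible [q] is coprime to its [a]: cancelling the gcd gives a denominator with no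
   larger error, which minimality forbids to be smaller. *)
case: (ex_minnP exA) => q /andP[qp /asboolP[a ha]] qmin.
have qQ : (q <= Q)%N by apply: leq_trans q0Q; exact: qmin.
exists q, a; split => //; rewrite /coprime; set d := gcdn a q.
have d0 : (0 < d)%N by rewrite gcdn_gt0 qp orbT.
have dr : 0 < d%:R :> R by rewrite ltr0n.
have qE : q = (q %/ d * d)%N by rewrite divnK// dvdn_gcdr.
have aE : a = (a %/ d * d)%N by rewrite divnK// dvdn_gcdl.
have : A (q %/ d)%N.
  rewrite /A divn_gt0// dvdn_leq ?dvdn_gcdr//=; apply/asboolP; exists (a %/ d)%N.
  apply: le_lt_trans ha.
  rewrite {2}qE {2}aE !natrM.
  have -> : (q %/ d)%:R * d%:R * w - (a %/ d)%:R * d%:R = d%:R * ((q %/ d)%:R * w - (a %/ d)%:R) :> R.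
    by ring.
  by rewrite normrM (gtr0_norm dr) ler_peMl// ler1n.
move/qmin => h; rewrite eqn_leq d0 andbT -(leq_pmul2l qp) muln1.
apply: leq_trans (_ : (q %/ d) * d <= _)%N; first by rewrite leq_mul2r h orbT.
by rewrite -qE.
Qed.

(** When [q] does not divide [n], the fraction [a * n / q] is at distance at least [1 / q] from the
    integers; [c] bounds the effect of replacing it by [w * n]. *)
Lemma rho_frac_ge w (q a n : nat) (c : R) : (0 < q)%N -> coprime a q -> ~~ (q %| n)%N ->
  `|n%:R * (w - a%:R / q%:R)| <= c -> q%:R^-1 - c <= `|rho (w * n%:R)|.
Proof.
move=> q0 cop qn hc; have qr : 0 < q%:R :> R by rewrite ltr0n.
have qr0 : q%:R != 0 :> R by rewrite gt_eqF.
rewrite /rho; set N := Num.floor _.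
have h1 : q%:R^-1 <= `|a%:R * n%:R / q%:R - N%:~R| :> R.
  have -> : a%:R * n%:R / q%:R - N%:~R = ((a * n)%:Z - N * q%:Z)%:~R / q%:R :> R.
    by rewrite intrB intrM -!pmulrn natrM; field.
  rewrite normrM normfV (gtr0_norm qr) ler_peMl ?invr_ge0 ?ler0n//.
  rewrite -intr_norm ler1z -gtz0_ge1 normr_gt0 subr_eq0.
  apply: contra qn => /eqP e.
  rewrite -(Gauss_dvdr _ (_ : coprime q a)) 1?coprime_sym//.
  suff : (q%:Z %| (a * n)%:Z)%Z by rewrite /dvdz /=.
  by rewrite e dvdz_mull.
apply: le_trans (_ : `|a%:R * n%:R / q%:R - N%:~R| - `|n%:R * (w - a%:R / q%:R)| <= _).
  by apply: lerB.
rewrite lerBlDr; apply: le_trans (_ : _ <= `|(w * n%:R - N%:~R) - n%:R * (w - a%:R / q%:R)|) _.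
  by rewrite le_eqVlt; apply/orP; left; apply/eqP; congr (Num.norm _); field.
by apply: ler_normB.
Qed.

Definition harmonic_number (n : nat) : R := \sum_(t < n) t.+1%:R^-1.

Lemma harmonic_number_ge0 n : 0 <= harmonic_number n.
Proof. by apply: sumr_ge0 => t _; rewrite invr_ge0. Qed.

Lemma le_harmonic_number (m n : nat) : (m <= n)%N -> harmonic_number m <= harmonic_number n.
Proof.
move=> mn; rewrite /harmonic_number (big_ord_widen n (fun t => t.+1%:R^-1) mn).
rewrite [leRHS](bigID (fun t : 'I_n => (t < m)%N)) /= lerDl.
by apply: sumr_ge0 => t _; rewrite invr_ge0.
Qed.

Lemma sum_inj_le (m n : nat) (A : pred 'I_m) (t : 'I_m -> 'I_n) (F : 'I_n -> R) :
  (forall j, 0 <= F j) -> {in A &, injective t} ->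
  \sum_(i | A i) F (t i) <= \sum_j F j.
Proof.
move=> F0 tinj; have -> : \sum_(i | A i) F (t i) = \sum_(j in [set t i | i in A]%SET) F j.
  by rewrite big_imset.
rewrite [leRHS](bigID (fun j => j \in [set t i | i in A]%SET)) /= lerDl.
by apply: sumr_ge0.
Qed.

(* The residues of [w * n] along a block of length at most [q / 2 + 1] are
   [1 / (2 q)]-separated, so [Num.floor (2 * q * |rho|)] is injective on each
   of the two half-lines. *)
Lemma block_sum_le w (P Q q a n0 : nat) (good : pred nat) :
  (0 < q)%N -> (q <= Q)%N -> coprime a q -> `|q%:R * w - a%:R| < Q%:R^-1 ->
  (forall n, good n -> (n < n0 + (q./2).+1)%N -> mbound P (w * n%:R) <= q%:R) ->
  \sum_(i < (q./2).+1 | good (n0 + i)%N) mbound P (w * (n0 + i)%:R) <=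
    2 * q%:R * (1 + harmonic_number q).
Proof.
move=> q0 qQ cop hw hgood; have qr : 0 < q%:R :> R by rewrite ltr0n.
set F := fun t : 'I_q.+1 => q%:R / (maxn 1 t)%:R : R.
have FE : \sum_t F t = q%:R * (1 + harmonic_number q).
  rewrite big_ord_recl /F /= divr1 mulrDr mulr1; congr (_ + _).
  by rewrite mulr_sumr; apply: eq_bigr => i _; rewrite /bump leq0n add1n (maxn_idPr _).
pose r i : R := rho (w * (n0 + i)%:R).
have t_lt i : (`|Num.floor (2 * q%:R * `|r i|)| < q.+1)%N.
  have h : 0 <= Num.floor (2 * q%:R * `|r i|) by rewrite floor_ge0 !mulr_ge0.
  rewrite ltnS -lez_nat abszE ger0_norm// -(ler_int R) (le_trans (floor_le_tmp _))//.
  by have := abs_rho_le (w * (n0 + i)%:R); rewrite -/(r i) -pmulrn; nra.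
pose t (i : 'I_(q./2).+1) : 'I_q.+1 := Ordinal (t_lt i).
have t_itv (i : 'I_(q./2).+1) : (t i)%:R <= 2 * q%:R * `|r i| < (t i)%:R + 1.
  have h : 0 <= Num.floor (2 * q%:R * `|r i|) by rewrite floor_ge0 !mulr_ge0.
  have := Num.Theory.floor_itv (2 * q%:R * `|r i|).
  by rewrite intrD /= natr_absz (ger0_norm h).
have key (sg : bool) :
  \sum_(i < (q./2).+1 | good (n0 + i)%N && ((0 <= r i) == sg)) mbound P (w * (n0 + i)%:R)
    <= q%:R * (1 + harmonic_number q).
  rewrite -FE.
  apply: le_trans (_ : \sum_(i < (q./2).+1 | good (n0 + i)%N && ((0 <= r i) == sg)) F (t i) <= _).
    apply: ler_sum => i /andP[gi _]; rewrite /F.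
    have [t1|t1] := leqP (t i) 1.
      by rewrite divr1 hgood// ltn_add2l.
    have tr : 0 < (t i)%:R :> R by rewrite ltr0n ltnW.
    have -> : q%:R / (t i)%:R = (2 * ((t i)%:R / (2 * q%:R)))^-1 :> R.
      by field; rewrite ?gt_eqF.
    apply: mbound_le_inv; first by rewrite divr_gt0// mulr_gt0.
    by rewrite ler_pdivrMr ?mulr_gt0// mulrC; case/andP: (t_itv i).
  apply: sum_inj_le => [j|i j]; first by rewrite /F divr_ge0.
  rewrite !unfold_in => /andP[_ /eqP si] /andP[_ /eqP sj] et.
  have hd : `|r i - r j| < (2 * q%:R)^-1.
    have hi := t_itv i; have hj := t_itv j; rewrite et in hi.
    have q2 : 0 < 2 * q%:R :> R by rewrite mulr_gt0.
    rewrite -(ltr_pM2l q2) divff ?gt_eqF// -[X in X * _](gtr0_norm q2) -normrM mulrBr.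
    case: sg si sj => si sj.
      rewrite (ger0_norm si) in hi; rewrite (ger0_norm sj) in hj.
      by move: hi hj => /andP[? ?] /andP[? ?]; rewrite ltr_norml; apply/andP; split; lra.
    move/negbT: si; move/negbT: sj; rewrite -!ltNge => sj si.
    rewrite (ltr0_norm si) in hi; rewrite (ltr0_norm sj) in hj.
    by move: hi hj => /andP[? ?] /andP[? ?]; rewrite ltr_norml; apply/andP; split; lra.
  have sep (u v : 'I_(q./2).+1) : (u < v)%N -> (2 * q%:R)^-1 <= `|r u - r v|.
    move=> uv; set d := (v - u)%N.
    have d0 : (0 < d)%N by rewrite subn_gt0.
    have d2 : (2 * d <= q)%N by have := ltn_ord v; rewrite /d; lia.
    have : q%:R^-1 - (2 * q%:R)^-1 <= `|rho (w * d%:R)|.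
      apply: (@rho_frac_ge _ q a d) => //.
        by rewrite gtnNdvd//; move: d2 d0; lia.
      have -> : d%:R * (w - a%:R / q%:R) = d%:R / q%:R * (q%:R * w - a%:R) by field; rewrite gt_eqF.
      rewrite normrM ger0_norm ?divr_ge0//.
      have h1 : d%:R / q%:R <= 1 / 2 :> R.
        by rewrite ler_pdivrMr// mulrAC ler_pdivlMr// mul1r mulrC -natrM ler_nat.
      have h2 : `|q%:R * w - a%:R| <= q%:R^-1.
        apply: le_trans (ltW hw) _; rewrite lef_pV2 ?posrE ?ltr0n ?(leq_trans q0)//.
        by rewrite ler_nat.
      rewrite invfM; apply: ler_pM => //; rewrite ?divr_ge0//.
      by rewrite -[2^-1]mul1r.
    have -> : q%:R^-1 - (2 * q%:R)^-1 = (2 * q%:R)^-1 :> R by field; rewrite gt_eqF.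
    move/le_trans; apply.
    have -> : w * d%:R = w * (n0 + v)%:R - w * (n0 + u)%:R.
      by rewrite -mulrBr -natrB ?leq_add2l ?(ltnW uv)// subnDl.
    rewrite (le_trans (rho_le_dist _ (Num.floor (w * (n0 + v)%:R + 1 / 2) - Num.floor (w * (n0 + u)%:R + 1 / 2))))//.
    rewrite le_eqVlt; apply/orP; left; apply/eqP; rewrite -normrN; congr (Num.norm _).
    by rewrite /r /rho intrB; ring.
  apply/val_inj; case: (ltngtP i j) => // h; have := sep _ _ h.
    by rewrite leNgt hd.
  by rewrite distrC leNgt hd.
rewrite (bigID (fun i : 'I_(q./2).+1 => (0 <= r i))) /=.
have k1 := key true; have k2 := key false.
rewrite -mulrA mulr_natl mulr2n; apply: lerD.
  by apply: le_trans k1; under eq_bigl do rewrite -[0 <= r _](eqb_id).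
by apply: le_trans k2; under eq_bigl do rewrite -eqbF_neg.
Qed.

Lemma sum_blocks_le (F : nat -> R) (l K m : nat) (B : R) : (forall n, 0 <= F n) ->
  (forall k, (k < K)%N -> \sum_(i < l) F (k * l + i)%N <= B) -> (m <= K * l)%N ->
  \sum_(n < m) F n <= K%:R * B.
Proof.
move=> F0 hB mK.
apply: le_trans (_ : \sum_(n < K * l) F n <= _).
  rewrite (big_ord_widen (K * l) F mK).
  rewrite [leRHS](bigID (fun t : 'I_(K * l) => (t < m)%N)) /= lerDl.
  by apply: sumr_ge0.
elim: K hB {mK} => [|K IH] hB; first by rewrite big_ord0 mul0r.
rewrite mulSn addnC big_split_ord /= -natr1 mulrDl mul1r lerD//.
  by apply: IH => k kK; apply: hB; rewrite ltnW.
exact: hB.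
Qed.

(** An integer [n] is a product [i.+1 * j.+1] in at most [ndiv n] ways. *)
Lemma sum_pairs_le (F : nat -> R) (P : nat) (D : R) : 0 <= D -> (forall n, 0 <= F n) ->
  (forall n, (0 < n)%N -> (n <= P * P)%N -> (ndiv n)%:R <= D) ->
  \sum_(i < P) \sum_(j < P) F (i.+1 * j.+1)%N <= D * \sum_(n < (P * P).+1) F n.
Proof.
move=> D0 F0 hD.
have lt (ij : 'I_P * 'I_P) : (ij.1.+1 * ij.2.+1 < (P * P).+1)%N by rewrite ltnS leq_mul.
rewrite pair_big /= (partition_big (fun ij => Ordinal (lt ij)) xpredT)//= mulr_sumr.
apply: ler_sum => n _.
apply: le_trans (_ : \sum_(ij | Ordinal (lt ij) == n) F n <= _).
  by apply: ler_sum => ij /eqP <-.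
rewrite sumr_const -mulr_natl.
have [n0|n0] := posnP n.
  rewrite (eq_card0 (_ : _ =i pred0)) ?mul0r ?mulr_ge0//.
  by move=> ij; rewrite unfold_in /= n0.
rewrite ler_wpM2r//; apply: le_trans (hD n n0 _); last by rewrite -ltnS.
rewrite ler_nat /ndiv cardE -(size_map (fun ij : 'I_P * 'I_P => ij.1.+1)).
apply: uniq_leq_size.
  rewrite map_inj_in_uniq ?enum_uniq// => -[i j] [i' j'].
  rewrite !mem_enum !unfold_in /= => /eqnP e1 /eqnP e2 [e3].
  have ei : i = i' by exact: val_inj.
  rewrite ei in e1 *; congr pair; apply/val_inj/succn_inj/eqP.
  by rewrite -(eqn_pmul2l (ltn0Sn i')) e1 e2.
move=> x /mapP[[i j]]; rewrite mem_enum unfold_in /= => /eqnP e ->.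
by rewrite -dvdn_divisors// -e dvdn_mulr.
Qed.

(** The terms left out are those with [q <= P] and [q] dividing the product. Each of the others is
    at most [q], so blocks of about [q / 2] consecutive integers can be summed by separation of the
    residues. *)
Lemma minor_sum_le w (P q a : nat) (D : R) : (0 < P)%N ->
  (0 < q)%N -> (q <= 2 * P ^ 2)%N -> coprime a q ->
  `|q%:R * w - a%:R| < (2 * P ^ 2)%:R^-1 ->
  (forall n, (0 < n)%N -> (n <= P * P)%N -> (ndiv n)%:R <= D) ->
  \sum_(i < P) \sum_(j < P) (if (P < q)%N || ~~ (q %| i.+1 * j.+1)%N
     then mbound P (w * (i.+1 * j.+1)%:R) else 0) <=
  D * (16 * P%:R ^+ 2 * (1 + harmonic_number (2 * P ^ 2))).
Proof.
move=> P0 q0 qQ cop hw hD.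
pose good n := (n <= P * P)%N && ((P < q)%N || ~~ (q %| n)%N).
pose F n := if good n then mbound P (w * n%:R) else 0.
have F0 n : 0 <= F n by rewrite /F; case: ifP => // _; exact: mbound_ge0.
have D0 : 0 <= D by apply: le_trans (hD 1%N _ _) => //; rewrite muln_gt0 P0.
apply: le_trans (_ : \sum_(i < P) \sum_(j < P) F (i.+1 * j.+1)%N <= _).
  apply: ler_sum => i _; apply: ler_sum => j _.
  by rewrite /F /good leq_mul.
apply: le_trans (sum_pairs_le D0 F0 hD) _; rewrite ler_wpM2l//.
set l := (q./2).+1; set K := ((P * P) %/ l).+1.
have qr : 0 < q%:R :> R by rewrite ltr0n.
apply: le_trans (_ : _ <= K%:R * (2 * q%:R * (1 + harmonic_number q))) _.
  apply: (sum_blocks_le (l := l)) => //; last first.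
    by rewrite /K -ltn_divLR// ltnS.
  move=> k kK; rewrite /F -big_mkcond /=.
  apply: (@block_sum_le _ P (2 * P ^ 2) q a) => // n /andP[nP hn] _.
  have [Pq|qP] := ltnP P q.
    by rewrite (le_trans (mbound_leN _ _))// ler_nat ltnW.
  rewrite ltnNge qP /= in hn.
  (* The Dirichlet parameter [2 * P ^ 2] keeps the error [n * |w - a / q|] within [1 / (2 * q)] for
     all [n <= P * P], half of the available distance. *)
  have -> : q%:R = (2 * (q%:R^-1 - (2 * q%:R)^-1))^-1 :> R by field; rewrite gt_eqF.
  apply: mbound_le_inv.
    by rewrite subr_gt0 ltf_pV2 ?posrE ?mulr_gt0//; lra.
  apply: (@rho_frac_ge _ q a n) => //.
  have -> : n%:R * (w - a%:R / q%:R) = n%:R / q%:R * (q%:R * w - a%:R) by field; rewrite gt_eqF.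
  rewrite normrM ger0_norm ?divr_ge0//.
  apply: le_trans (_ : (P * P)%:R / q%:R * (2 * P ^ 2)%:R^-1 <= _).
    apply: ler_pM; rewrite ?divr_ge0//; last exact: ltW.
    by rewrite ler_pM2r ?invr_gt0// ler_nat.
  rewrite le_eqVlt; apply/orP; left; apply/eqP.
  have Pr : P%:R != 0 :> R by rewrite pnatr_eq0 -lt0n.
  by rewrite !natrM; field; rewrite gt_eqF// Pr.
have h1 : harmonic_number q <= harmonic_number (2 * P ^ 2) by exact: le_harmonic_number.
have h0 := harmonic_number_ge0 q.
apply: le_trans (_ : (K%:R * (2 * q%:R)) * (1 + harmonic_number (2 * P ^ 2)) <= _).
  by rewrite mulrA ler_wpM2l ?mulr_ge0// lerD2l.
rewrite ler_wpM2r ?addr_ge0 ?harmonic_number_ge0//.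
have : (K * (2 * q) <= 16 * P ^ 2)%N.
  have : (((P * P) %/ l) * l <= P * P)%N by exact: leq_trunc_div.
  have : (q <= 2 * l)%N by rewrite /l; lia.
  move: qQ; rewrite /K -mulnn; move: ((P * P) %/ l)%N (P * P)%N => d p; nia.
by rewrite -(ler_nat R) !natrM expr2.
Qed.
End Diophantine.

(** * The multiples of the denominator in Weyl's double sum *)

Section WeylSup.
Variable R : realType.
Implicit Types (w x y : R).

Definition qroot x : R := x `^ (1 / 4).

Lemma qroot_ge0 x : 0 <= qroot x. Proof. exact: powR_ge0. Qed.
Lemma qroot_gt0 x : 0 < x -> 0 < qroot x. Proof. exact: powR_gt0. Qed.
Lemma qroot4 x : 0 <= x -> qroot x ^+ 4 = x.
Proof.
move=> x0; rewrite -powR_mulrn ?qroot_ge0// /qroot -powRrM.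
by rewrite (_ : 1 / 4 * 4%:R = 1)// ?powRr1//; field.
Qed.
Lemma qrootM x y : 0 <= x -> 0 <= y -> qroot (x * y) = qroot x * qroot y.
Proof. exact: powRM. Qed.
Lemma qrootV x : 0 < x -> qroot x^-1 = (qroot x)^-1.
Proof.
move=> x0; have q0 : qroot x != 0 by rewrite gt_eqF// qroot_gt0.
by apply: (mulfI q0); rewrite -qrootM ?invr_ge0 ?ltW// divff ?gt_eqF// divff// /qroot powR1.
Qed.
Lemma le_qroot x y : 0 <= x -> x <= y -> qroot x <= qroot y.
Proof.
by move=> x0 xy; apply: ge0_ler_powR => //; rewrite ?nnegrE; lra.
Qed.

(** Telescoping: if [a] and [b] are the fourth roots of [U + 1] and [U], then
    [1 = a^4 - b^4 <= 4 * a^3 * (a - b)]. *)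
Lemma sum_qroot_le (U : nat) : \sum_(u < U) (qroot u.+1%:R ^+ 3)^-1 <= 4 * qroot U%:R.
Proof.
elim: U => [|U IH]; first by rewrite big_ord0 mulr_ge0// qroot_ge0.
rewrite big_ord_recr /=; set a := qroot U.+1%:R; set b := qroot U%:R in IH *.
have a0 : 0 < a by rewrite qroot_gt0.
have b0 : 0 <= b by exact: qroot_ge0.
have ba : b <= a by rewrite le_qroot// ler_nat.
suff : (a ^+ 3)^-1 <= 4 * a - 4 * b by lra.
rewrite -(ler_pM2l (exprn_gt0 3 a0)) divff ?gt_eqF ?exprn_gt0//.
have e : a ^+ 4 - b ^+ 4 = 1 by rewrite !qroot4// -natr1; ring.
have : 0 <= (a - b) ^+ 2 * (3 * a ^+ 2 + 2 * a * b + b ^+ 2).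
  by rewrite mulr_ge0 ?sqr_ge0//; have := ltW a0; nra.
rewrite (_ : _ * _ = a ^+ 3 * (4 * a - 4 * b) - (a ^+ 4 - b ^+ 4)); last by ring.
by rewrite e subr_ge0.
Qed.

Lemma sum_multiples (F : nat -> R) (P g : nat) : (0 < g)%N ->
  \sum_(i < P) (if (g %| i.+1)%N then F i.+1 else 0) = \sum_(u < P %/ g) F (g * u.+1)%N.
Proof.
move=> g0; elim: P => [|P IH]; first by rewrite div0n !big_ord0.
rewrite big_ord_recr /= IH divnS//; case: ifPn => gP; last by rewrite addr0 add0n.
rewrite add1n big_ord_recr /=; congr (_ + F _).
have := divnS P g0; rewrite gP add1n => <-.
by rewrite mulnC divnK.
Qed.

(** If [q] divides [x * y] and [g = gcdn q x], then [q %/ g] divides [y]. Summing over all divisors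
    [g] of [q] overcounts, and each contributes at most [(S / g) * (S / (q / g)) = S^2 / q]. *)
Lemma sum_divisor_pairs (F : nat -> R) (P q : nat) (S : R) : (0 < q)%N ->
  (forall n, 0 <= F n) ->
  (forall g, (0 < g)%N -> \sum_(i < P) (if (g %| i.+1)%N then F i.+1 else 0) <= S / g%:R) ->
  \sum_(i < P) \sum_(j < P) (if (q %| i.+1 * j.+1)%N then F i.+1 * F j.+1 else 0) <=
    (ndiv q)%:R / q%:R * S ^+ 2.
Proof.
move=> q0 F0 hS.
pose G g i := if (g %| i.+1)%N then F i.+1 else 0.
have G0 g i : 0 <= G g i by rewrite /G; case: ifP.
apply: le_trans (_ : \sum_(g <- divisors q) \sum_(i < P) \sum_(j < P) G g i * G (q %/ g)%N j <= _).
  rewrite [leRHS]exchange_big /=; apply: ler_sum => i _.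
  rewrite [leRHS]exchange_big /=; apply: ler_sum => j _.
  case: ifPn => [qij|_]; last by apply: sumr_ge0 => g _; rewrite mulr_ge0.
  have gd : gcdn q i.+1 \in divisors q by rewrite -dvdn_divisors// dvdn_gcdl.
  rewrite (big_rem _ gd) /= /G dvdn_gcdr.
  rewrite dvdn_div_gcdn//.
  rewrite lerDl; apply: sumr_ge0 => g _; exact: (mulr_ge0 (G0 g i) (G0 (q %/ g)%N j)).
rewrite big_seq; apply: le_trans (_ : \sum_(g <- divisors q | g \in divisors q) S ^+ 2 / q%:R <= _).
  apply: ler_sum => g; rewrite -dvdn_divisors// => gq.
  have g0 : (0 < g)%N by rewrite (dvdn_gt0 q0).
  have g'0 : (0 < q %/ g)%N by rewrite divn_gt0// dvdn_leq.
  under eq_bigr do rewrite -mulr_sumr.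
  rewrite -mulr_suml.
  have h1 := hS _ g0; have h2 := hS _ g'0.
  apply: le_trans (_ : (S / g%:R) * (S / (q %/ g)%:R) <= _).
    by apply: ler_pM => //; apply: sumr_ge0 => i _; exact: G0.
  rewrite -[in leRHS](divnK gq) natrM le_eqVlt; apply/orP; left; apply/eqP.
  by field; rewrite !pnatr_eq0 -!lt0n g0.
rewrite -big_seq big_const_seq count_predT iter_addr_0 /ndiv -[_ *+ _]mulr_natl.
by rewrite le_eqVlt; apply/orP; left; apply/eqP; ring.
Qed.

(** The minimum of [P] and [1 / (2 * |b| * n)] is at most the interpolation
    [P^(1/4) * (2 * |b| * n)^(-3/4)], where [b = w - a / q]. The exponent 3/4 instead of 1 avoids
    logarithms in the sum over [n]; the result is a sum [<< (ndiv q / q) * P^3 * Y^(-3/4)] with [Y]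
    the maximum on the left. *)
Lemma major_sum_le w (P q a : nat) : (0 < P)%N -> (0 < q)%N ->
  `|q%:R * w - a%:R| < (2 * P ^ 2)%:R^-1 ->
  (\sum_(i < P) \sum_(j < P) (if (q %| i.+1 * j.+1)%N
     then mbound P (w * (i.+1 * j.+1)%:R) else 0)) ^+ 4 *
     Num.max 1 (P%:R ^+ 3 * `|w - a%:R / q%:R|) ^+ 3 <=
  (16 * ((ndiv q)%:R / q%:R) * P%:R ^+ 3) ^+ 4.
Proof.
move=> P0 q0 hw; set S := \sum_(i < P) _.
have Pr : 0 < P%:R :> R by rewrite ltr0n.
have qr : 0 < q%:R :> R by rewrite ltr0n.
have S0 : 0 <= S.
  by do 2 (apply: sumr_ge0 => ? _); case: ifP => // _; exact: mbound_ge0.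
set d : R := (ndiv q)%:R / q%:R.
have d0 : 0 <= d by rewrite divr_ge0.
have hS1 : S <= d * P%:R ^+ 3.
  apply: le_trans (_ : P%:R * \sum_(i < P) \sum_(j < P)
      (if (q %| i.+1 * j.+1)%N then 1 * 1 else 0 : R) <= _).
    rewrite mulr_sumr; apply: ler_sum => i _; rewrite mulr_sumr; apply: ler_sum => j _.
    by case: ifP => _; rewrite ?mulr0// !mulr1 mbound_leN.
  have := @sum_divisor_pairs (fun=> 1) P q P%:R q0 (fun=> ler01).
  move=> h; have -> : d * P%:R ^+ 3 = P%:R * (d * P%:R ^+ 2) by ring.
  rewrite ler_pM2l//; apply: h => g g0.
  rewrite (@sum_multiples (fun=> 1))// sumr_const card_ord ler_pdivlMr ?ltr0n//.
  by rewrite -natrM ler_nat leq_trunc_div.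
set b := w - a%:R / q%:R; set Y := P%:R ^+ 3 * `|b|.
have [Y1|Y1] := leP Y 1.
  rewrite expr1n mulr1 lerXn2r ?nnegrE ?mulr_ge0 ?exprn_ge0//.
  by apply: le_trans hS1 _; rewrite ler_wpM2r ?exprn_ge0// ler_peMl//; lra.
have b0 : 0 < `|b|.
  by rewrite normr_gt0; apply: contraTneq Y1 => b0; rewrite /Y b0 normr0 mulr0 -leNgt.
set c := qroot P%:R * qroot (2 * `|b|)^-1 ^+ 3.
have c0 : 0 <= c by rewrite mulr_ge0 ?exprn_ge0 ?qroot_ge0.
have hS2 : S <= c * (d * (4 * qroot P%:R) ^+ 2).
  apply: le_trans (_ : c * \sum_(i < P) \sum_(j < P)
      (if (q %| i.+1 * j.+1)%N then (qroot i.+1%:R ^+ 3)^-1 * (qroot j.+1%:R ^+ 3)^-1 else 0) <= _).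
    rewrite mulr_sumr; apply: ler_sum => i _; rewrite mulr_sumr; apply: ler_sum => j _.
    case: ifPn => qij; rewrite ?mulr0//.
    set n := (i.+1 * j.+1)%N; set m := mbound _ _.
    have n0 : 0 < n%:R :> R by rewrite ltr0n muln_gt0.
    have m0 : 0 <= m by exact: mbound_ge0.
    have h1 : m <= P%:R by exact: mbound_leN.
    have h2 : m <= (2 * (`|b| * n%:R))^-1.
      apply: mbound_le_inv; first by rewrite mulr_gt0.
      (* Below 1/2 nothing is reduced modulo 1: [rho (w * n)] is [b * n] for a multiple [n] of
         [q]. *)
      have hb : `|b * n%:R| < 1 / 2.
        have -> : b = (q%:R * w - a%:R) / q%:R by rewrite /b; field; rewrite gt_eqF.
        rewrite 2!normrM normfV (gtr0_norm qr) (gtr0_norm n0) mulrAC ltr_pdivrMr//.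
        have P20 : 0 < (P ^ 2)%:R :> R by rewrite ltr0n expn_gt0 P0.
        apply: le_lt_trans (_ : _ <= `|q%:R * w - a%:R| * (P ^ 2)%:R) _.
          by rewrite ler_wpM2l// ler_nat -mulnn leq_mul.
        apply: lt_le_trans (_ : _ < (2 * P ^ 2)%:R^-1 * (P ^ 2)%:R) _.
          by rewrite ltr_pM2r.
        rewrite (natrM _ 2) invfM -mulrA mulVf ?gt_eqF// mulr1 mul1r.
        by rewrite ler_peMr ?invr_ge0// ler1n.
      have [k nk] : exists k, n = (k * q)%N by exact/dvdnP.
      have e : w * n%:R - (a * k)%:Z%:~R = b * n%:R.
        by rewrite /b -pmulrn nk !natrM; field; rewrite gt_eqF.
      rewrite (@rho_eq _ _ (a * k)%:Z) e; last first.
        by move: hb; rewrite ltr_norml => /andP[/ltW -> ->].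
      by rewrite normrM (gtr0_norm n0).
    rewrite -[m]qroot4// exprS.
    have -> : c * ((qroot i.+1%:R ^+ 3)^-1 * (qroot j.+1%:R ^+ 3)^-1) =
        qroot P%:R * qroot (2 * (`|b| * n%:R))^-1 ^+ 3.
      have -> : (2 * (`|b| * n%:R))^-1 = (2 * `|b|)^-1 * (i.+1%:R^-1 * j.+1%:R^-1) :> R.
        by rewrite /n natrM !invfM; ring.
      rewrite !qrootM ?invr_ge0 ?mulr_ge0 ?invr_ge0//.
      by rewrite (qrootV (ltr0Sn _ i)) (qrootV (ltr0Sn _ j)) /c !exprMn !exprVn !mulrA.
    apply: ler_pM; rewrite ?exprn_ge0 ?qroot_ge0 ?le_qroot//.
    by rewrite lerXn2r ?nnegrE ?qroot_ge0 ?le_qroot.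
  rewrite ler_wpM2l//.
  apply: (@sum_divisor_pairs (fun n => (qroot n%:R ^+ 3)^-1)) => // [n|g g0].
    by rewrite invr_ge0 exprn_ge0 ?qroot_ge0.
  rewrite (@sum_multiples (fun n => (qroot n%:R ^+ 3)^-1))//.
  have gr : 0 < g%:R :> R by rewrite ltr0n.
  have qg : 0 < qroot g%:R by exact: qroot_gt0.
  under eq_bigr do rewrite natrM qrootM// exprMn invfM.
  rewrite -mulr_sumr -[g%:R in leRHS]qroot4//.
  apply: le_trans (_ : (qroot g%:R ^+ 3)^-1 * (4 * qroot (P %/ g)%:R) <= _).
    by rewrite ler_wpM2l ?invr_ge0 ?exprn_ge0 ?qroot_ge0// sum_qroot_le.
  have : qroot (P %/ g)%:R * qroot g%:R <= qroot P%:R.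
    by rewrite -qrootM// -natrM le_qroot// ler_nat leq_trunc_div.
  move=> h; rewrite ler_pdivlMr ?exprn_gt0// mulrC (exprS _ 3) -mulrA mulVKf//.
    by rewrite mulrCA ler_pM2l// mulrC.
  by rewrite gt_eqF// exprn_gt0.
have hS4 : S ^+ 4 <= (c * (d * (4 * qroot P%:R) ^+ 2)) ^+ 4.
  by rewrite lerXn2r ?nnegrE//; exact: le_trans S0 hS2.
apply: le_trans (_ : (c * (d * (4 * qroot P%:R) ^+ 2)) ^+ 4 * Y ^+ 3 <= _).
  by rewrite ler_wpM2r// exprn_ge0// mulr_ge0// exprn_ge0.
have -> : (c * (d * (4 * qroot P%:R) ^+ 2)) ^+ 4 =
   (qroot P%:R ^+ 4) ^+ 3 * (qroot (2 * `|b|)^-1 ^+ 4) ^+ 3 * d ^+ 4 * 4 ^+ 8.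
  by rewrite /c; ring.
rewrite !qroot4 ?invr_ge0 ?mulr_ge0// /Y.
rewrite (_ : _ * _ = (P%:R ^+ 12 * d ^+ 4) * (4 ^+ 8 / 8)); last by field; rewrite gt_eqF.
rewrite (_ : (16 * d * P%:R ^+ 3) ^+ 4 = (P%:R ^+ 12 * d ^+ 4) * (16 ^+ 4)); last by ring.
by rewrite ler_wpM2l ?mulr_ge0 ?exprn_ge0//; lra.
Qed.
End WeylSup.

(** * Weyl's inequality as a dichotomy *)

Section WeylDichotomy.
Variable R : realType.
Implicit Types (al theta x y : R).

Lemma harmonic_number_le_ln (n : nat) : (0 < n)%N -> harmonic_number R n <= 1 + ln n%:R.
Proof.
case: n => // n _; elim: n => [|n IH].
  by rewrite /harmonic_number big_ord_recl big_ord0 invr1 ln1 addr0.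
rewrite /harmonic_number big_ord_recr /= -/(harmonic_number R n.+1).
have n2 : 0 < n.+2%:R :> R by rewrite ltr0n.
have n1 : 0 < n.+1%:R :> R by rewrite ltr0n.
have : ln (1 + - n.+2%:R^-1) <= - n.+2%:R^-1 :> R.
  by apply: le_ln1Dx; rewrite ltrN2 invf_lt1// ltr1n.
have -> : 1 + - n.+2%:R^-1 = n.+1%:R / n.+2%:R :> R.
  have -> : n.+1%:R = n.+2%:R - 1 :> R by rewrite -[n.+2%:R]natr1 addrK.
  by rewrite mulrBl divff ?gt_eqF// mul1r.
rewrite ln_div ?posrE//; move: IH.
by move: (harmonic_number R _) (ln _) (ln _) (n.+2%:R^-1) => w x y z; lra.
Qed.

(** With [r = n^(1/72)] one has [ln n = 72 * ln r <= 72 * r], so the base is at most [74 * r], and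
    [r^36] is the square root of [n = 2 * P^2]. *)
Lemma harmonic_numberX_le : exists C : R, 0 < C /\
  forall P : nat, (0 < P)%N -> (1 + harmonic_number R (2 * P ^ 2)) ^+ 36 <= C * P%:R.
Proof.
exists (74 ^+ 36 * 2); split; first by rewrite mulr_gt0// exprn_gt0.
move=> P P0; set n := (2 * P ^ 2)%N.
have n0 : (0 < n)%N by rewrite muln_gt0 expn_gt0 P0.
have nr : 1 <= n%:R :> R by rewrite ler1n.
set r := n%:R `^ (1 / 72) : R.
have r1 : 1 <= r.
  by rewrite /r -[X in X <= _](powRr0 n%:R) ler_powR//; lra.
have rn : r ^+ 72 = n%:R.
  by rewrite -powR_mulrn ?powR_ge0// /r -powRrM (_ : 1 / 72 * 72%:R = 1) ?powRr1//; field.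
have h : 1 + harmonic_number R n <= 74 * r.
  have h1 := harmonic_number_le_ln n0; have : ln n%:R = 72%:R * ln r :> R.
    by rewrite -rn lnXn ?mulr_natl// (lt_le_trans ltr01).
  by have := ln_sublinear (lt_le_trans ltr01 r1); lra.
have H0 : 0 <= 1 + harmonic_number R n by rewrite addr_ge0// harmonic_number_ge0.
apply: le_trans (_ : (74 * r) ^+ 36 <= _); first by rewrite lerXn2r ?nnegrE//; lra.
rewrite exprMn -mulrA ler_pM2l ?exprn_gt0//.
have r0 : 0 <= r by exact: powR_ge0.
rewrite -(@ler_pXn2r _ 2%N)// ?nnegrE ?mulr_ge0 ?exprn_ge0//.
rewrite -exprM rn /n natrM natrX exprMn.
have pp : 0 <= P%:R ^+ 2 :> R by rewrite exprn_ge0.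
by rewrite ler_wpM2r//; lra.
Qed.

(* 111/144 = 3/4 + 1/48 is Weyl's exponent plus the loss from the divisor bound
   and the logarithm; it is small enough that 9 * 111/144 + 1 < 8. *)
Lemma weyl_dichotomy : exists C : R, 0 < C /\
  forall (P : nat) theta al, (0 < P)%N -> 0 <= al ->
  exists q a : nat, [/\ (0 < q)%N, coprime a q,
    `|q%:R * (6 * al) - a%:R| < (2 * P ^ 2)%:R^-1 &
    cnorm (cubesum theta P al) ^+ 144 <= C * P%:R ^+ 111 \/
    (q <= P)%N /\ cnorm (cubesum theta P al) ^+ 11 * (Num.sqrt q%:R ^+ 5 *
      Num.max 1 (P%:R ^+ 3 * `|6 * al - a%:R / q%:R|) ^+ 2) <= C * P%:R ^+ 11].
Proof.
(* The exponent 1/36, applied to products up to [P^2], costs only [P^(1/18)] in [f^4]; the exponent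
   1/11, applied to [q], turns [(ndiv q / q)^(11/4)] into [q^(-5/2)], which stays summable after the
   sum over numerators. *)
have [C1 [C10 hC1]] := divisor_bound 35.
have [C2 [C20 hC2]] := divisor_bound 10.
have [C3 [C30 hC3]] := harmonic_numberX_le.
(* Hidden behind an existential so that powers like [c1 ^+ 36] stay symbolic. Here
   [266 = 10 + 16 * 16] combines the coefficients of [weyl_cubic] and [minor_sum_le]. *)
have [c1 [c1E c11]] : exists c1 : R, c1 = 2 * 266 /\ 1 <= c1 by exists (2 * 266); split=> //; lra.
have [c2 [c2E c21]] : exists c2 : R, c2 = 32 * 16 /\ 1 <= c2 by exists (32 * 16); split=> //; lra.
have c10 : 0 < c1 by exact: lt_le_trans ltr01 c11.
have c20 : 0 < c2 by exact: lt_le_trans ltr01 c21.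
pose A : R := c1 ^+ 36 * C1%:R * C3.
pose B : R := c2 ^+ 11 * C2%:R.
have C1r : 1 <= C1%:R :> R by rewrite ler1n.
have C2r : 1 <= C2%:R :> R by rewrite ler1n.
have A0 : 0 < A by rewrite !mulr_gt0 ?exprn_gt0// ltr0n.
have B1 : 1 <= B by apply: mulr_ege1 => //; exact: exprn_ege1.
have B0 : 0 < B by rewrite (lt_le_trans ltr01).
exists (A + B); split; first by rewrite addr_gt0.
move=> P theta al P0 al0.
set p : R := P%:R; have p1 : 1 <= p by rewrite ler1n.
have p0 : 0 < p by rewrite (lt_le_trans ltr01).
have pn n : 0 <= p ^+ n by exact: exprn_ge0 (ltW p0).
have [q [a [q0 qQ cop hw]]] : exists q a : nat, [/\ (0 < q)%N, (q <= 2 * P ^ 2)%N,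
    coprime a q & `|q%:R * (6 * al) - a%:R| < (2 * P ^ 2)%:R^-1].
  by apply: dirichlet; [rewrite mulr_ge0 | rewrite muln_gt0 expn_gt0 P0].
exists q, a; split => //.
set f := cnorm _; have f0 : 0 <= f by exact: cnorm_ge0.
set Y := Num.max _ _; have Y1 : 1 <= Y by rewrite le_max lexx.
pose D : R := (C1%:R * p ^+ 2) `^ (1 / 36).
have D0 : 0 <= D by exact: powR_ge0.
have DE : D ^+ 36 = C1%:R * p ^+ 2.
  rewrite -powR_mulrn// /D -powRrM (_ : 1 / 36 * 36%:R = 1) ?powRr1//; last by field.
  by rewrite mulr_ge0// exprn_ge0// ltW.
have D1 : 1 <= D.
  rewrite -(@ler_pXn2r _ 36%N)// ?nnegrE// expr1n DE.
  by apply: mulr_ege1 => //; exact: exprn_ege1.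
have hD n : (0 < n)%N -> (n <= P * P)%N -> (ndiv n)%:R <= D.
  move=> n0 nP; rewrite -(@ler_pXn2r _ 36%N)// ?nnegrE// DE.
  apply: le_trans (_ : (C1 * n)%:R <= _); first by rewrite -natrX ler_nat hC1.
  by rewrite natrM ler_pM2l ?(lt_le_trans ltr01)// expr2 -natrM ler_nat.
set H := 1 + harmonic_number R (2 * P ^ 2).
have H1 : 1 <= H by rewrite lerDl harmonic_number_ge0.
have hmin := minor_sum_le P0 q0 qQ cop hw hD.
set Smin := \sum_(i < P) _ in hmin.
pose Smaj : R := if (q <= P)%N then \sum_(i < P) \sum_(j < P) (if (q %| i.+1 * j.+1)%N
     then mbound P (6 * al * (i.+1 * j.+1)%:R) else 0) else 0.
have Smaj0 : 0 <= Smaj.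
  rewrite /Smaj; case: ifP => // _.
  by do 2 (apply: sumr_ge0 => ? _); case: ifP => // _; exact: mbound_ge0.
have hf : f ^+ 4 <= 10 * p ^+ 3 + 16 * p * (Smin + Smaj).
  have := weyl_cubic theta P al; rewrite -/f -/p.
  suff -> : \sum_(i < P) \sum_(j < P) mbound P (6 * al * (i.+1 * j.+1)%:R) = Smin + Smaj by [].
  rewrite /Smin /Smaj; have [qP|Pq] := leqP q P.
    rewrite -big_split; apply: eq_bigr => i _; rewrite -big_split; apply: eq_bigr => j _ /=.
    by case: (q %| _)%N; rewrite ?addr0 ?add0r.
  by rewrite addr0.
pose E := 266 * p ^+ 3 * D * H.
have E0 : 0 <= E.
  apply: mulr_ge0; last exact: le_trans ler01 H1.
  apply: mulr_ge0; last exact: D0.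
  by apply: mulr_ge0; [exact: ler0n | exact: pn].
have hE : 10 * p ^+ 3 + 16 * p * Smin <= E.
  have DH : 1 <= D * H by exact: mulr_ege1.
  have : 10 * p ^+ 3 <= 10 * p ^+ 3 * (D * H) by rewrite ler_peMr// mulr_ge0// exprn_ge0// ltW.
  have : 16 * p * Smin <= 16 * p * (D * (16 * p ^+ 2 * H)).
    by rewrite ler_wpM2l// mulr_ge0// ltW.
  rewrite /E (_ : 16 * p * (D * (16 * p ^+ 2 * H)) = 256 * (p ^+ 3 * D * H)); last by ring.
  rewrite (_ : 10 * p ^+ 3 * (D * H) = 10 * (p ^+ 3 * D * H)); last by ring.
  by rewrite -!(mulrA 266); lra.
(* The larger of the two contributions to [f ^+ 4] decides the alternative. *)
have [hc|hc] := leP (16 * p * Smaj) E.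
  left; have h : f ^+ 4 <= 2 * E by lra.
  have : (f ^+ 4) ^+ 36 <= (2 * E) ^+ 36.
    by rewrite lerXn2r ?nnegrE ?exprn_ge0// (le_trans _ h)// exprn_ge0.
  rewrite -exprM; move/le_trans; apply.
  rewrite (_ : (2 * E) ^+ 36 = c1 ^+ 36 * p ^+ 108 * D ^+ 36 * H ^+ 36); last first.
    by rewrite /E (_ : 2 * _ = c1 * (p ^+ 3 * D * H)); [rewrite exprMn (exprMn 36 _ H) (exprMn 36 _ D) -(exprM _ 3 36) !mulrA | rewrite c1E; ring].
  rewrite DE; apply: le_trans (_ : c1 ^+ 36 * p ^+ 108 * (C1%:R * p ^+ 2) * (C3 * p) <= _).
    apply: ler_wpM2l; last exact: hC3.
    apply: mulr_ge0; first by apply: mulr_ge0; [exact: exprn_ge0 (ltW c10) | exact: pn].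
    by apply: mulr_ge0; [exact: ler0n | exact: pn].
  rewrite (_ : _ * (C3 * p) = A * p ^+ 111); last first.
    rewrite /A (_ : 111 = 108 + 2 + 1)%N// !exprD expr1; move: (c1 ^+ 36) (p ^+ 108) => u v; ring.
  by rewrite ler_wpM2r ?exprn_ge0 ?(ltW p0)// lerDl ltW.
right; have [qP|Pq] := leqP q P; last first.
  by move: hc; rewrite /Smaj leqNgt Pq /= mulr0 ltNge E0.
split => //; rewrite /Smaj qP in hf hc Smaj0; set S := \sum_(i < P) _ in hf hc Smaj0.
have h : f ^+ 4 <= 32 * p * S by lra.
have hmaj := major_sum_le P0 q0 hw; rewrite -/S -/Y in hmaj.
have qr : 0 < q%:R :> R by rewrite ltr0n.
set d : R := (ndiv q)%:R; have d0 : 0 <= d by [].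
have dd : d ^+ 11 <= C2%:R * q%:R by rewrite -natrX -natrM ler_nat hC2.
have h16 : f ^+ 16 * q%:R ^+ 4 * Y ^+ 3 <= c2 ^+ 4 * d ^+ 4 * p ^+ 16.
  apply: le_trans (_ : (32 * p * S) ^+ 4 * q%:R ^+ 4 * Y ^+ 3 <= _).
    rewrite ler_wpM2r ?exprn_ge0 ?(le_trans ler01)// ler_wpM2r ?exprn_ge0//.
    rewrite (exprM f 4 4) lerXn2r ?nnegrE ?exprn_ge0//; exact: le_trans (exprn_ge0 4 f0) h.
  rewrite (_ : _ * _ = (32 * p * q%:R) ^+ 4 * (S ^+ 4 * Y ^+ 3)); last by ring.
  apply: le_trans (ler_wpM2l _ hmaj) _.
    by rewrite exprn_ge0// !mulr_ge0// ltW.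
  rewrite le_eqVlt; apply/orP; left; apply/eqP; rewrite -/d -/p c2E.
  by field; rewrite gt_eqF.
set r := Num.sqrt q%:R; have r2 : r ^+ 2 = q%:R by rewrite sqr_sqrtr.
have r0 : 0 <= r by exact: sqrtr_ge0.
apply: le_trans (_ : B * p ^+ 11 <= _); last first.
  by rewrite ler_wpM2r ?exprn_ge0 ?(ltW p0)// lerDr ltW.
have Y0 : 0 <= Y by exact: le_trans Y1.
have L0 : 0 <= f ^+ 11 * (r ^+ 5 * Y ^+ 2) by rewrite mulr_ge0 ?exprn_ge0// mulr_ge0 ?exprn_ge0.
have R0 : 0 <= B * p ^+ 11 by exact: mulr_ge0 (ltW B0) (pn 11%N).
(* The claim is in essence the 11/4-th power of [f^4 << p * S], and the sixteenth power clears the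
   fractional exponents. In the eleventh power of [h16], four of the 44 factors [q] pay for [d^44],
   leaving [q^40], and [Y^33] dominates [Y^32]. *)
rewrite -(@ler_pXn2r _ 16%N)//.
have e1 : (f ^+ 11 * (r ^+ 5 * Y ^+ 2)) ^+ 16 = f ^+ 176 * q%:R ^+ 40 * Y ^+ 32.
  rewrite (exprMn 16 (f ^+ 11)) (exprMn 16 (r ^+ 5)) -(exprM f 11 16) -(exprM r 5 16).
  by rewrite -(exprM Y 2 16) -r2 -(exprM r 2 40) mulrA.
have e2 : q%:R ^+ 4 * (f ^+ 176 * q%:R ^+ 40 * Y ^+ 33) = (f ^+ 16 * q%:R ^+ 4 * Y ^+ 3) ^+ 11.
  rewrite (exprMn 11 _ (Y ^+ 3)) (exprMn 11 (f ^+ 16)) -(exprM f 16 11) -(exprM Y 3 11).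
  by rewrite -(exprM q%:R 4 11) (exprD q%:R 4 40); move: (f ^+ _) (q%:R ^+ 4) (q%:R ^+ 40) (Y ^+ _) => u v s t; ring.
have e3 : (c2 ^+ 4 * d ^+ 4 * p ^+ 16) ^+ 11 = c2 ^+ 44 * (d ^+ 11) ^+ 4 * p ^+ 176.
  rewrite (exprMn 11 _ (p ^+ 16)) (exprMn 11 (c2 ^+ 4)) -(exprM c2 4 11) -(exprM p 16 11).
  by rewrite -(exprM d 4 11) -(exprM d 11 4).
have e4 : (B * p ^+ 11) ^+ 16 = c2 ^+ 176 * C2%:R ^+ 16 * p ^+ 176.
  by rewrite /B (exprMn 16 _ (p ^+ 11)) (exprMn 16 (c2 ^+ 11)) -(exprM c2 11 16) -(exprM p 11 16).
rewrite e1 e4.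
have f1760 : 0 <= f ^+ 176 * q%:R ^+ 40 by rewrite mulr_ge0 ?exprn_ge0.
apply: le_trans (_ : f ^+ 176 * q%:R ^+ 40 * Y ^+ 33 <= _).
  by rewrite (ler_wpM2l f1760)// ler_weXn2l.
have q40 : 0 < q%:R ^+ 4 :> R by rewrite exprn_gt0.
have p1760 : 0 <= p ^+ 176 by rewrite exprn_ge0// ltW.
have c40 : 0 <= c2 ^+ 44 by rewrite exprn_ge0// ltW.
rewrite -(ler_pM2l q40) e2.
apply: le_trans (_ : (c2 ^+ 4 * d ^+ 4 * p ^+ 16) ^+ 11 <= _).
  have f160 : 0 <= f ^+ 16 * q%:R ^+ 4 * Y ^+ 3 by rewrite !mulr_ge0 ?exprn_ge0.
  by rewrite lerXn2r// nnegrE// (le_trans f160).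
rewrite e3; apply: le_trans (_ : c2 ^+ 44 * (C2%:R * q%:R) ^+ 4 * p ^+ 176 <= _).
  rewrite (ler_wpM2r p1760)// (ler_wpM2l c40)//.
  by rewrite lerXn2r ?nnegrE ?exprn_ge0// mulr_ge0.
have c44 : c2 ^+ 44 <= c2 ^+ 176 by rewrite ler_weXn2l.
have C44 : C2%:R ^+ 4 <= C2%:R ^+ 16 :> R by rewrite ler_weXn2l.
rewrite (exprMn 4 C2%:R) (_ : _ * p ^+ 176 = q%:R ^+ 4 * (c2 ^+ 44 * C2%:R ^+ 4 * p ^+ 176)); last first.
  by move: (c2 ^+ _) (q%:R ^+ _) (C2%:R ^+ _) (p ^+ _) => u v s t; ring.
rewrite (ler_pM2l q40) (ler_wpM2r p1760)//.
by apply: ler_pM => //; rewrite exprn_ge0.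
Qed.
End WeylDichotomy.

(** * Minor arcs *)

Section GridSums.
Variable R : realType.
Implicit Types (c W x y theta al : R).

(** Telescoping from [1 / t^2 <= 1 / (t - 1/2) - 1 / (t + 1/2)]. *)
Lemma inv_sq_sum_up (N : nat) c W : 1 <= W ->
  \sum_(k < N | W <= k%:R - c) ((k%:R - c) ^+ 2)^-1 <= 2 / W.
Proof.
move=> W1.
suff h : \sum_(k < N | W <= k%:R - c) ((k%:R - c) ^+ 2)^-1 <=
    (W - 1 / 2)^-1 - (Num.max (N%:R - c) W - 1 / 2)^-1.
  apply: le_trans h _; apply: le_trans (_ : (W - 1 / 2)^-1 <= _).
    by rewrite gerBl invr_ge0 subr_ge0 (le_trans (_ : _ <= W))//; [lra | rewrite le_max lexx orbT].
  rewrite -[leRHS]invf_div lef_pV2 ?posrE; lra.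
elim: N => [|N IH].
  rewrite big_ord0 subr_ge0 lef_pV2 ?posrE ?lerD2r ?le_max ?lexx ?orbT//; first by rewrite subr_gt0 lt_max; apply/orP; right; lra.
  by lra.
rewrite big_mkcond big_ord_recr -big_mkcond /=; case: ifPn => h.
  apply: le_trans (lerD IH (lexx _)) _.
  rewrite !max_l//; last by rewrite -natr1; lra.
  set t := N%:R - c in h *; have t1 : 1 <= t by exact: le_trans h.
  have -> : N.+1%:R - c = t + 1 by rewrite /t -natr1; ring.
  suff : (t ^+ 2)^-1 <= (t - 1 / 2)^-1 - (t + 1 - 1 / 2)^-1 by lra.
  have -> : (t - 1 / 2)^-1 - (t + 1 - 1 / 2)^-1 = (t ^+ 2 - 1 / 4)^-1.
    by field; apply/and3P; split; apply/eqP; nra.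
  by rewrite lef_pV2 ?posrE; nra.
rewrite addr0; apply: le_trans IH _.
rewrite lerD2l lerN2 lef_pV2 ?posrE.
- by rewrite lerD2r ge_max !le_max lexx orbT andbT -natr1; apply/orP; left; lra.
- by rewrite subr_gt0 lt_max; apply/orP; right; lra.
- by rewrite subr_gt0 lt_max; apply/orP; right; lra.
Qed.

Lemma inv_sq_sum_le (N : nat) c W : 1 <= W ->
  \sum_(k < N | W <= `|k%:R - c|) ((k%:R - c) ^+ 2)^-1 <= 4 / W.
Proof.
move=> W1; have -> : 4 / W = 2 / W + 2 / W by rewrite -mulrDl; congr (_ / _); ring.
rewrite (bigID (fun k : 'I_N => W <= k%:R - c)) /=; apply: lerD.
  apply: le_trans (inv_sq_sum_up N c W1).
  rewrite (eq_bigl (fun k : 'I_N => W <= k%:R - c))// => k.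
  by rewrite ler_normr; case: (W <= k%:R - c); rewrite ?andbF ?orTb.
pose c' : R := N%:R - 1 - c.
have e (k : 'I_N) : (rev_ord k)%:R - c' = - (k%:R - c).
  by rewrite /= /c' natrB -?natr1 ?ltn_ord//; ring.
apply: le_trans (inv_sq_sum_up N c' W1).
rewrite [leRHS](reindex_inj rev_ord_inj) /=.
rewrite big_mkcond [leRHS]big_mkcond /=; apply: ler_sum => k _.
rewrite -/(nat_of_ord (rev_ord k)) e sqrrN ler_normr.
case: (W <= k%:R - c) => /=; rewrite ?andbF ?andbT//.
by case: ifP => // _; rewrite invr_ge0 sqr_ge0.
Qed.

Lemma count_near_le (N : nat) c W : 0 <= W ->
  \sum_(k < N | `|k%:R - c| <= W) 1 <= 2 * W + 1.
Proof.
move=> W0; pose A (k : nat) := (k < N)%N && (`|k%:R - c| <= W).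
have [[k0 Ak0]|nA] := pselect (exists k, A k); last first.
  rewrite big_pred0; first by rewrite addr_ge0// mulr_ge0.
  by move=> k; apply/negbTE/negP => h; apply: nA; exists k; rewrite /A ltn_ord.
case: (ex_minnP (ex_intro _ k0 Ak0)) => m /andP[mN hm] mmin.
set D := Num.truncn (2 * W).
have DW : D%:R <= 2 * W by rewrite truncn_le ?mulr_ge0.
have hA (k : 'I_N) : `|k%:R - c| <= W -> (m <= k)%N /\ (k - m < D.+1)%N.
  move=> hk; have mk : (m <= k)%N by apply: mmin; rewrite /A ltn_ord.
  split=> //; rewrite ltnS truncn_ge_nat ?mulr_ge0// natrB//.
  by move: hk hm; rewrite !ler_norml => /andP[? ?] /andP[? ?]; lra.
apply: le_trans (_ : \sum_(j < D.+1) 1 <= _); last first.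
  by rewrite sumr_const card_ord -[D.+1%:R]natr1 lerD2r.
apply: (@sum_inj_le _ _ _ (fun k : 'I_N => `|k%:R - c| <= W)
  (fun k : 'I_N => inord (k - m) : 'I_D.+1) (fun=> 1)) => // i j.
rewrite !unfold_in => /hA[mi iD] /hA[mj jD] /(congr1 val) /=.
by rewrite !inordK// => e; apply/val_inj; rewrite /= -(subnK mi) e subnK.
Qed.

(** After expansion the diagonal gives [P * J]. Off it [|X x - X y| >= |x - y|^3], so the geometric
    sum over [k] is at most [L / (2 * (x - y)^2)]; the condition [2 * P ^ 3 <= L] keeps the
    frequencies within half a period. *)
Lemma parseval_grid theta (P L J : nat) : 0 <= theta <= 1 -> (2 * P ^ 3 <= L)%N ->
  \sum_(k < J) cnorm (cubesum theta P (k%:R / L%:R)) ^+ 2 <= P%:R * (J%:R + 2 * L%:R).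
Proof.
move=> /andP[t0 t1] hL; have [P0|P0] := posnP P.
  rewrite P0 mul0r big1// => k _.
  by rewrite /cubesum big_ord0 cnorm0 expr0n.
have L0 : (0 < L)%N by apply: leq_trans hL; rewrite muln_gt0 expn_gt0 P0.
have Lr : 0 < L%:R :> R by rewrite ltr0n.
pose X (x : nat) : R := (theta + x%:R) ^+ 3.
have E (k : nat) : cnorm (cubesum theta P (k%:R / L%:R)) ^+ 2 =
   complex.Re (\sum_(x < P) \sum_(y < P) expi ((X x - X y) / L%:R) ^+ k).
  rewrite -[LHS]/(complex.Re (_%:C)%C) cnorm_sqr_conj; congr complex.Re.
  rewrite /cubesum conjc_sum mulr_suml; apply: eq_bigr => x _.
  rewrite mulr_sumr; apply: eq_bigr => y _.
  by rewrite -expiB -expiM_nat; congr expi; rewrite /X; ring.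
under eq_bigr do rewrite E.
rewrite -Re_sum exchange_big /=; under eq_bigr do rewrite exchange_big /=.
apply: le_trans (ler_norm _) _; apply: le_trans (ler_Re_cnorm _) _.
apply: le_trans (ler_cnorm_sum _ _ _) _.
apply: le_trans (_ : \sum_(x < P) (J%:R + 2 * L%:R) <= _); last first.
  by rewrite sumr_const card_ord [leRHS]mulr_natl.
apply: ler_sum => x _; apply: le_trans (ler_cnorm_sum _ _ _) _.
rewrite (bigD1 x)//=; apply: lerD.
  by apply: le_trans (cnorm_geom_expi _ (leqnn J)) _; exact: mbound_leN.
apply: le_trans (_ : L%:R / 2 * \sum_(y < P | 1 <= `|y%:R - x%:R| :> R) ((y%:R - x%:R) ^+ 2)^-1 <= _).
  rewrite mulr_sumr [leLHS]big_mkcond [leRHS]big_mkcond /=; apply: ler_sum => y _.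
  have d1 : (y != x) -> 1 <= `|y%:R - x%:R| :> R.
    move=> yx; have -> : (y%:R - x%:R : R) = (y%:Z - x%:Z)%:~R by rewrite intrB -!pmulrn.
    by rewrite -intr_norm ler1z -gtz0_ge1 normr_gt0 subr_eq0.
  case: ifPn => [yx|]; last by rewrite ?if_same; case: ifP => // _ _; rewrite mulr_ge0 ?divr_ge0// invr_ge0 sqr_ge0.
  have dge := d1 yx; rewrite ifT//; set d := y%:R - x%:R : R; rewrite -/d in dge.
  have Xd : X x - X y = - d * ((theta + x%:R) ^+ 2 + (theta + x%:R) * (theta + y%:R) + (theta + y%:R) ^+ 2).
    by rewrite /X /d; ring.
  have hx0 : 0 <= theta + x%:R by rewrite addr_ge0.
  have hy0 : 0 <= theta + y%:R by rewrite addr_ge0.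
  have Xge : `|d| ^+ 3 <= `|X x - X y|.
    rewrite Xd normrM normrN exprS ler_wpM2l// real_normK ?num_real//.
    rewrite ger0_norm ?addr_ge0 ?sqr_ge0 ?mulr_ge0//.
    have -> : d = (theta + y%:R) - (theta + x%:R) by rewrite /d; ring.
    by move: hx0 hy0; move: (theta + x%:R) (theta + y%:R) => u v; nra.
  have XP (z : 'I_P) : 0 <= X z <= P%:R ^+ 3.
    have z0 : 0 <= theta + z%:R by rewrite addr_ge0.
    rewrite /X exprn_ge0//= lerXn2r ?nnegrE//.
    apply: le_trans (_ : 1 + z%:R <= _); first by rewrite lerD2r.
    by rewrite addrC natr1 ler_nat.
  have Xle : `|X x - X y| <= L%:R / 2.
    have hL' : P%:R ^+ 3 <= L%:R / 2 :> R.
      by rewrite ler_pdivlMr// mulrC -natrX -natrM ler_nat.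
    have := XP x; have := XP y => /andP[? ?] /andP[? ?].
    by rewrite ler_norml; apply/andP; split; lra.
  apply: le_trans (cnorm_geom_expi _ (leqnn J)) _.
  have -> : L%:R / 2 / d ^+ 2 = (2 * (d ^+ 2 / L%:R))^-1.
    by field; rewrite gt_eqF//= -normr_gt0 (lt_le_trans ltr01).
  have d20 : 0 < d ^+ 2 by rewrite -(real_normK (num_real d)) exprn_gt0// (lt_le_trans ltr01).
  apply: mbound_le_inv; first by rewrite divr_gt0.
  have le1 : d ^+ 2 / L%:R <= `|(X x - X y) / L%:R|.
    rewrite normrM normfV (gtr0_norm Lr) ler_pM2r ?invr_gt0//; apply: le_trans Xge.
    by rewrite -(real_normK (num_real d)) [leRHS]exprS ler_peMl// exprn_ge0.
  have le2 : `|(X x - X y) / L%:R| <= 1 / 2.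
    by rewrite normrM normfV (gtr0_norm Lr) ler_pdivrMr//; lra.
  (* The endpoint 1/2 is represented by -1/2, with the same absolute value. *)
  have [eq|ne] := eqVneq ((X x - X y) / L%:R) (1 / 2).
    have -> : rho ((X x - X y) / L%:R) = - (1 / 2).
      by rewrite eq (@rho_eq _ _ 1)//; lra.
    by rewrite normrN; apply: le_trans le1 _; rewrite eq.
  rewrite (@rho_eq _ _ 0) ?subr0//.
  by move: le2; rewrite ler_norml => /andP[-> h]; rewrite lt_neqAle ne.
have := inv_sq_sum_le P x%:R (lexx 1); rewrite divr1 => h.
apply: le_trans (ler_wpM2l _ h) _; first by rewrite divr_ge0.
by lra.
Qed.

(** In the variable [k] the arc around [a / q] has centre [c] and natural unit
    [W = L / (6 * P^3) >= 1]: at most [2 * W + 1] indices are within one unit, and the others form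
    an inverse square tail. *)
Lemma sum_Y_le (N P L q a : nat) : (0 < P)%N -> (0 < q)%N -> (6 * P ^ 3 <= L)%N ->
  \sum_(k < N) (Num.max 1 (P%:R ^+ 3 * `|6 * (k%:R / L%:R) - a%:R / q%:R|) ^+ 2)^-1
    <= 2 * L%:R / P%:R ^+ 3 :> R.
Proof.
move=> P0 q0 hL; have L0 : (0 < L)%N by apply: leq_trans hL; rewrite muln_gt0 expn_gt0 P0.
have Lr : 0 < L%:R :> R by rewrite ltr0n.
have Pr : 0 < P%:R :> R by rewrite ltr0n.
have qr : 0 < q%:R :> R by rewrite ltr0n.
pose W : R := L%:R / (6 * P%:R ^+ 3).
have W1 : 1 <= W.
  by rewrite ler_pdivlMr ?mulr_gt0 ?exprn_gt0// mul1r -natrX -natrM ler_nat.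
pose c : R := a%:R * L%:R / (6 * q%:R).
have E (k : nat) : P%:R ^+ 3 * `|6 * (k%:R / L%:R) - a%:R / q%:R| = `|k%:R - c| / W.
  have -> : 6 * (k%:R / L%:R) - a%:R / q%:R = (k%:R - c) * (6 / L%:R).
    by rewrite /c; field; rewrite !gt_eqF.
  rewrite normrM (gtr0_norm (divr_gt0 _ Lr))// /W; field.
  by rewrite !gt_eqF.
under eq_bigr do rewrite E.
rewrite (bigID (fun k : 'I_N => W <= `|k%:R - c|)) /=.
have W0 : 0 < W by exact: lt_le_trans W1.
apply: le_trans (_ : W ^+ 2 * (4 / W) + (2 * W + 1) <= _).
  apply: lerD.
    apply: le_trans (ler_wpM2l (sqr_ge0 W) (inv_sq_sum_le N c W1)).
    rewrite mulr_sumr; apply: ler_sum => k hk.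
    rewrite max_r; last by rewrite ler_pdivlMr// mul1r.
    rewrite exprMn real_normK ?num_real// exprVn invfM invrK mulrC lexx//.
  apply: le_trans (count_near_le N c (ltW W0)).
  rewrite big_mkcond [leRHS]big_mkcond /=; apply: ler_sum => k _.
  rewrite -ltNge; case: ifPn => [h|_]; last by case: ifP.
  rewrite (ltW h) max_l ?expr1n ?invr1//.
  by rewrite ler_pdivrMr// mul1r ltW.
have -> : W ^+ 2 * (4 / W) = 4 * W by field; rewrite gt_eqF.
have -> : 2 * L%:R / P%:R ^+ 3 = 12 * W by rewrite /W; field; rewrite gt_eqF.
by lra.
Qed.

Lemma sum_Y_tail_le (N P L q a B : nat) : (0 < P)%N -> (0 < q)%N -> (0 < B)%N ->
  (6 * P ^ 3 <= L)%N ->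
  \sum_(k < N | B%:R < P%:R ^+ 3 * `|6 * (k%:R / L%:R) - a%:R / q%:R| :> R)
    (Num.max 1 (P%:R ^+ 3 * `|6 * (k%:R / L%:R) - a%:R / q%:R|) ^+ 2)^-1
    <= L%:R / P%:R ^+ 3 / B%:R :> R.
Proof.
move=> P0 q0 B0 hL; have L0 : (0 < L)%N by apply: leq_trans hL; rewrite muln_gt0 expn_gt0 P0.
have Lr : 0 < L%:R :> R by rewrite ltr0n.
have Pr : 0 < P%:R :> R by rewrite ltr0n.
have qr : 0 < q%:R :> R by rewrite ltr0n.
have Br : 1 <= B%:R :> R by rewrite ler1n.
pose W : R := L%:R / (6 * P%:R ^+ 3).
have W1 : 1 <= W.
  by rewrite ler_pdivlMr ?mulr_gt0 ?exprn_gt0// mul1r -natrX -natrM ler_nat.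
pose c : R := a%:R * L%:R / (6 * q%:R).
have E (k : nat) : P%:R ^+ 3 * `|6 * (k%:R / L%:R) - a%:R / q%:R| = `|k%:R - c| / W.
  have -> : 6 * (k%:R / L%:R) - a%:R / q%:R = (k%:R - c) * (6 / L%:R).
    by rewrite /c; field; rewrite !gt_eqF.
  rewrite normrM (gtr0_norm (divr_gt0 _ Lr))// /W; field.
  by rewrite !gt_eqF.
under eq_bigl do rewrite E.
under eq_bigr do rewrite E.
have W0 : 0 < W by exact: lt_le_trans W1.
have BW1 : 1 <= B%:R * W by exact: mulr_ege1.
apply: le_trans (_ : W ^+ 2 * (4 / (B%:R * W)) <= _).
  apply: le_trans (ler_wpM2l (sqr_ge0 W) (inv_sq_sum_le N c BW1)).
  rewrite mulr_sumr big_mkcond [leRHS]big_mkcond /=; apply: ler_sum => k _.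
  rewrite ltr_pdivlMr//; case: ifPn => [h|_]; last first.
    by case: ifP => // _; rewrite mulr_ge0 ?invr_ge0 ?sqr_ge0.
  rewrite (ltW h) max_r; last by rewrite ler_pdivlMr// mul1r (le_trans _ (ltW h))// ler_peMl// ltW.
  by rewrite exprMn real_normK ?num_real// exprVn invfM invrK mulrC.
have -> : W ^+ 2 * (4 / (B%:R * W)) = 4 * W / B%:R.
  by field; rewrite !gt_eqF// (lt_le_trans ltr01).
rewrite ler_pM2r ?invr_gt0 ?(lt_le_trans ltr01)//.
have -> : L%:R / P%:R ^+ 3 = 6 * W by rewrite /W; field; rewrite gt_eqF.
by lra.
Qed.

(** Telescoping against [2 / sqrt q]. *)
Lemma sum_q32_tail (N B : nat) : (0 < B)%N ->
  \sum_(q < N | (B < q.+1)%N) (q.+1%:R * Num.sqrt q.+1%:R)^-1 <= 2 / Num.sqrt B%:R :> R.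
Proof.
move=> B0.
have s0 (n : nat) : (0 < n)%N -> 0 < Num.sqrt n%:R :> R by move=> n0; rewrite sqrtr_gt0 ltr0n.
suff h : \sum_(q < N | (B < q.+1)%N) (q.+1%:R * Num.sqrt q.+1%:R)^-1 <=
    2 / Num.sqrt B%:R - 2 / Num.sqrt (maxn N B)%:R :> R.
  apply: le_trans h _; rewrite gerBl divr_ge0// sqrtr_ge0.
elim: N => [|N IH].
  by rewrite big_ord0 max0n subrr.
rewrite big_mkcond big_ord_recr -big_mkcond /=; case: ifPn => h; last first.
  rewrite addr0; apply: le_trans IH _; rewrite -leqNgt in h.
  by rewrite (maxn_idPr h) (maxn_idPr (ltnW h)).
apply: le_trans (lerD IH (lexx _)) _.
have BN : (B <= N)%N by [].
rewrite (maxn_idPl BN) (maxn_idPl (leqW BN)).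
set s := Num.sqrt N.+1%:R; set t := Num.sqrt N%:R.
have N0 : (0 < N)%N by apply: leq_trans B0 h.
have sp : 0 < s by exact: s0.
have tp : 0 < t by exact: s0.
have ss : s ^+ 2 = N.+1%:R by rewrite sqr_sqrtr.
have tt : t ^+ 2 = N%:R by rewrite sqr_sqrtr.
have st : t <= s by rewrite ler_sqrt// ler_nat.
suff h' : (N.+1%:R * s)^-1 <= 2 / t - 2 / s.
  by rewrite -addrA lerD2l -lerBrDl opprK addrC.
have -> : 2 / t - 2 / s = 2 / (t * s * (s + t)).
  have : (s - t) * (s + t) = 1 by rewrite -subr_sqr ss tt -natr1; ring.
  move=> e; apply: (mulIf (_ : t * s * (s + t) != 0)).
    by rewrite gt_eqF// !mulr_gt0// addr_gt0.
  rewrite mulfVK; last by rewrite gt_eqF// !mulr_gt0// addr_gt0.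
  transitivity (2 * ((s - t) * (s + t))); last by rewrite e mulr1.
  by field; rewrite !gt_eqF.
rewrite -ss -[2 / _]invf_div lef_pV2 ?posrE ?divr_gt0 ?mulr_gt0 ?exprn_gt0 ?addr_gt0//.
rewrite ler_pdivrMr//.
have h1 : t * s <= s * s by rewrite ler_pM2r.
apply: le_trans (ler_wpM2r _ h1) _; first by rewrite addr_ge0// ltW.
have : s * s * (s + t) <= s * s * (s + s).
  by apply: ler_wpM2l; [rewrite mulr_ge0// ltW | rewrite lerD2l].
by move=> h2; apply: le_trans h2 _; rewrite expr2; lra.
Qed.

Lemma sum_q32 (N : nat) :
  \sum_(q < N) (q.+1%:R * Num.sqrt q.+1%:R)^-1 <= 3 :> R.
Proof.
case: N => [|N]; first by rewrite big_ord0.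
have := sum_q32_tail N.+1 (ltn0Sn 0).
rewrite big_mkcond big_ord_recl /= add0r sqrtr1 divr1 => h.
rewrite big_ord_recl /= sqrtr1 mulr1 invr1.
by have -> : 3 = 1 + 2 :> R; [ring | rewrite lerD2l].
Qed.
End GridSums.

(** * The eleventh moment off the major arcs *)

Section MinorArcs.
Variable R : realType.
Implicit Types (theta al eps : R).

(* The major arcs for 6 * al; differencing the cube twice leaves the linear
   phase 6 * al * h1 * h2. *)
Definition near_frac (B P : nat) al : Prop := exists q a : nat,
  [/\ (0 < q)%N, (q <= B)%N, coprime a q &
      P%:R ^+ 3 * `|6 * al - a%:R / q%:R| <= B%:R].

(** The saving over [P^11] in the second alternative of [weyl_dichotomy], set to 0 on the major arc
    of [a / q]. *)
Definition arc_term (B P : nat) al (q a : nat) : R :=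
  if (B < q)%N || (B%:R < P%:R ^+ 3 * `|6 * al - a%:R / q%:R|)
  then (Num.sqrt q%:R ^+ 5)^-1 *
    (Num.max 1 (P%:R ^+ 3 * `|6 * al - a%:R / q%:R|) ^+ 2)^-1 else 0.

Lemma arc_term_ge0 B P al q a : 0 <= arc_term B P al q a.
Proof.
by rewrite /arc_term; case: ifP.
Qed.

(** For fixed [q] the numerators contribute a factor [K * q], so [q^(-5/2)] becomes the summable
    [q^(-3/2)]. What survives the cutoff has [q > B] or lies far out on its arc, and either way
    decays in [B]. *)
Lemma sum_arc_term (B P L N K : nat) : (0 < P)%N -> (0 < B)%N -> (6 * P ^ 3 <= L)%N ->
  \sum_(k < N) \sum_(i < P) \sum_(a < K * i.+1) arc_term B P (k%:R / L%:R) i.+1 a <=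
  K%:R * (L%:R / P%:R ^+ 3) * (4 / Num.sqrt B%:R + 3 / B%:R).
Proof.
move=> P0 B0 hL.
have Pr : 0 < P%:R :> R by rewrite ltr0n.
have L0 : 0 <= L%:R / P%:R ^+ 3 :> R by rewrite divr_ge0// exprn_ge0.
have key (i a : nat) : \sum_(k < N) arc_term B P (k%:R / L%:R) i.+1 a <=
   (Num.sqrt i.+1%:R ^+ 5)^-1 * (L%:R / P%:R ^+ 3) *
     ((if (B < i.+1)%N then 2 else 0) + B%:R^-1).
  have s0 : 0 <= (Num.sqrt i.+1%:R ^+ 5)^-1 :> R by rewrite invr_ge0 exprn_ge0 ?sqrtr_ge0.
  rewrite -mulrA /arc_term; case: ltnP => [Bi|Bi] /=.
    rewrite -mulr_sumr ler_wpM2l//; apply: le_trans (@sum_Y_le R N P L i.+1 a P0 (ltn0Sn i) hL) _.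
    have Bi0 : 0 <= B%:R^-1 :> R by rewrite invr_ge0.
    by rewrite -mulrA [leRHS]mulrC ler_wpM2r// lerDl.
  rewrite -big_mkcond /= -mulr_sumr ler_wpM2l// add0r.
  exact: (@sum_Y_tail_le R N P L i.+1 a B P0 (ltn0Sn i) B0 hL).
rewrite exchange_big /=.
apply: le_trans (_ : \sum_(i < P) (K%:R * (L%:R / P%:R ^+ 3)) *
    ((i.+1%:R * Num.sqrt i.+1%:R)^-1 * ((if (B < i.+1)%N then 2 else 0) + B%:R^-1)) <= _).
  apply: ler_sum => i _; rewrite exchange_big /=.
  apply: le_trans (_ : \sum_(a < K * i.+1) (Num.sqrt i.+1%:R ^+ 5)^-1 * (L%:R / P%:R ^+ 3) *
     ((if (B < i.+1)%N then 2 else 0) + B%:R^-1) <= _).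
    by apply: ler_sum => a _; exact: key.
  rewrite sumr_const card_ord -[leLHS]mulr_natl natrM.
  set s := Num.sqrt i.+1%:R; have s0 : 0 < s by rewrite sqrtr_gt0.
  have ss : s ^+ 2 = i.+1%:R by rewrite sqr_sqrtr.
  rewrite -ss; set X := _ + B%:R^-1; rewrite le_eqVlt; apply/orP; left; apply/eqP.
  by field; rewrite gt_eqF//= gt_eqF.
rewrite -mulr_sumr ler_wpM2l ?mulr_ge0//.
under eq_bigr do rewrite mulrDr.
rewrite big_split /=; apply: lerD.
  apply: le_trans (_ : 2 * (2 / Num.sqrt B%:R) <= _); last by rewrite mulrA; lra.
  apply: le_trans (ler_wpM2l _ (sum_q32_tail R P B0)) => //.
  rewrite mulr_sumr [leRHS]big_mkcond /=; apply: ler_sum => i _.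
  by case: ifP => _; rewrite ?mulr0// mulrC.
rewrite -mulr_suml ler_wpM2r ?invr_ge0//; exact: sum_q32.
Qed.

Lemma minor_arcs (T : nat) eps : 0 < eps -> exists B P0 : nat, [/\ (0 < B)%N, (0 < P0)%N &
  forall (P L : nat) theta, (P0 <= P)%N -> (6 * P ^ 3 <= L)%N -> 0 <= theta <= 1 ->
  \sum_(k < T * L | ~~ `[< near_frac B P (k%:R / L%:R) >])
    cnorm (cubesum theta P (k%:R / L%:R)) ^+ 11 <= eps * L%:R * P%:R ^+ 8].
Proof.
move=> e0; have [C [C0 hC]] := weyl_dichotomy R.
pose e1 := eps / (2 * (T%:R + 2)) : R.
have T2 : 0 < T%:R + 2 :> R by rewrite ltr_wpDl.
have e10 : 0 < e1 by rewrite divr_gt0// mulr_gt0.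
(* From [al < T] and a Dirichlet error below 1 follows [a < 6 * T * q + 1], hence [a < K * q]. *)
pose K := (6 * T + 2)%N.
have K0 : 0 < K%:R :> R by rewrite ltr0n /K addn2.
(* Makes [C * K * (7 / x)] equal to [eps / 2]; [B] is then a perfect square so that its square root
   is an integer above [x]. *)
pose x : R := 14 * C * K%:R / eps.
have x0 : 0 < x by rewrite divr_gt0// !mulr_gt0.
pose B := ((Num.truncn x).+1 ^ 2)%N.
have B0 : (0 < B)%N by rewrite expn_gt0.
have sB : Num.sqrt B%:R = (Num.truncn x).+1%:R :> R.
  by rewrite /B natrX sqrtr_sqr ger0_norm.
have xB : x <= Num.sqrt B%:R by rewrite sB ltW// truncnS_gt.
have sB1 : 1 <= Num.sqrt B%:R :> R by rewrite sB ler1n.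
have hB : 4 / Num.sqrt B%:R + 3 / B%:R <= 7 / x :> R.
  have s0 : 0 < Num.sqrt B%:R :> R by exact: lt_le_trans sB1.
  have i1 : (Num.sqrt B%:R)^-1 <= x^-1 :> R by rewrite lef_pV2 ?posrE.
  have i2 : (B%:R)^-1 <= x^-1 :> R.
    rewrite lef_pV2 ?posrE ?ltr0n//; apply: le_trans xB _.
    by rewrite -[leRHS](@sqr_sqrtr _ B%:R)// expr2 ler_peMl// ltW.
  by move: i1 i2; move: (Num.sqrt _)^-1 (B%:R^-1) (x^-1) => u v t; lra.
pose P0 := (Num.truncn (C / e1 ^+ 16)).+1.
exists B, P0; split => // P L theta hP hL ht.
have Pp : (0 < P)%N by exact: leq_trans hP.
have Pr : 0 < P%:R :> R by rewrite ltr0n.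
have L0 : (0 < L)%N by apply: leq_trans hL; rewrite muln_gt0 expn_gt0 Pp.
have Lr : 0 < L%:R :> R by rewrite ltr0n.
(* Turns [f^144 <= C * P^111] into [f^9 <= e1 * P^7]; the two remaining factors of [f^11] go to
   [parseval_grid]. *)
have CP : C <= e1 ^+ 16 * P%:R.
  rewrite mulrC -ler_pdivrMr ?exprn_gt0//; apply: le_trans (_ : P0%:R <= _).
    by rewrite ltW// truncnS_gt.
  by rewrite ler_nat.
pose f k := cnorm (cubesum theta P (k%:R / L%:R)).
have f0 k : 0 <= f k by exact: cnorm_ge0.
have pw (k : 'I_(T * L)) : ~~ `[< near_frac B P (k%:R / L%:R) >] -> f k ^+ 11 <=
    e1 * P%:R ^+ 7 * f k ^+ 2 + C * P%:R ^+ 11 *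
      \sum_(i < P) \sum_(a < K * i.+1) arc_term B P (k%:R / L%:R) i.+1 a.
  move=> /asboolPn nf; set al := k%:R / L%:R.
  have al0 : 0 <= al by rewrite divr_ge0.
  have alT : al < T%:R by rewrite /al ltr_pdivrMr// -natrM ltr_nat.
  have S0 : 0 <= \sum_(i < P) \sum_(a < K * i.+1) arc_term B P al i.+1 a.
    by do 2 (apply: sumr_ge0 => ? _); exact: arc_term_ge0.
  have [q [a [q0 cop hw]]] := hC P theta al Pp al0.
  rewrite -/(f k); case=> [h144|[qP h11]].
    rewrite ler_wpDr//; first by rewrite !mulr_ge0 ?exprn_ge0// ltW.
    rewrite (exprD _ 9 2) ler_wpM2r ?sqr_ge0//.
    have ep0 : 0 <= e1 * P%:R ^+ 7 by rewrite mulr_ge0 ?exprn_ge0// ltW.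
    rewrite -(@ler_pXn2r _ 16%N)// ?nnegrE ?exprn_ge0//.
    rewrite -(exprM _ 9 16) exprMn -(exprM _ 7 16).
    apply: le_trans h144 _; apply: le_trans (ler_wpM2r _ CP) _; first by rewrite exprn_ge0.
    by rewrite -mulrA -exprS.
  rewrite ler_wpDl//; first by rewrite !mulr_ge0 ?exprn_ge0// ltW.
  have s0 : 0 < Num.sqrt q%:R ^+ 5 :> R by rewrite exprn_gt0// sqrtr_gt0 ltr0n.
  set Y := Num.max _ _ in h11.
  have Y0 : 0 < Y ^+ 2 by rewrite exprn_gt0// lt_max ltr01.
  have : f k ^+ 11 <= C * P%:R ^+ 11 * ((Num.sqrt q%:R ^+ 5)^-1 * (Y ^+ 2)^-1).
    by rewrite -invfM ler_pdivlMr// mulr_gt0.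
  move/le_trans; apply; rewrite ler_wpM2l ?mulr_ge0 ?exprn_ge0 ?(ltW C0)//.
  have qlt : (q.-1 < P)%N by rewrite prednK.
  have aK : (a < K * q)%N.
    rewrite -(ltr_nat R) natrM.
    have : a%:R < q%:R * (6 * al) + 1 :> R.
      have : (2 * P ^ 2)%:R^-1 <= 1 :> R.
        by rewrite invf_le1 ?ltr0n ?ler1n ?muln_gt0 ?expn_gt0 ?Pp.
      by move: hw; rewrite ltr_norml => /andP[? ?]; lra.
    have qr1 : 1 <= q%:R :> R by rewrite ler1n.
    have : q%:R * (6 * al) <= q%:R * (6 * T%:R) by rewrite ler_wpM2l// ler_wpM2l// ltW.
    by rewrite /K natrD natrM mulrDl; nra.
  rewrite (bigD1 (Ordinal qlt))//= prednK//.
  rewrite (bigD1 (Ordinal aK))//=.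
  have -> : arc_term B P al q a = (Num.sqrt q%:R ^+ 5)^-1 / Y ^+ 2.
    rewrite /arc_term ifT//; case: ltnP => // qB /=.
    by rewrite ltNge; apply/negP => h; apply: nf; exists q, a.
  rewrite -addrA lerDl addr_ge0//; do ?(apply: sumr_ge0 => ? _); exact: arc_term_ge0.
apply: le_trans (_ : \sum_(k < T * L) (e1 * P%:R ^+ 7 * f k ^+ 2 + C * P%:R ^+ 11 *
      \sum_(i < P) \sum_(a < K * i.+1) arc_term B P (k%:R / L%:R) i.+1 a) <= _).
  rewrite big_mkcond /=; apply: ler_sum => k _; case: ifPn => [h|_]; first exact: pw.
  apply: addr_ge0; first by apply: mulr_ge0 (sqr_ge0 _); exact: mulr_ge0 (ltW e10) (exprn_ge0 _ (ltW Pr)).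
  apply: mulr_ge0; first exact: mulr_ge0 (ltW C0) (exprn_ge0 _ (ltW Pr)).
  by do 2 (apply: sumr_ge0 => ? _); exact: arc_term_ge0.
rewrite big_split /= -!mulr_sumr.
have h1 : \sum_(k < T * L) f k ^+ 2 <= P%:R * ((T * L)%:R + 2 * L%:R).
  by apply: parseval_grid => //; apply: leq_trans hL; rewrite leq_mul2r orbT.
have h2 := @sum_arc_term B P L (T * L) K Pp B0 hL.
have eE : eps * L%:R * P%:R ^+ 8 = eps / 2 * L%:R * P%:R ^+ 8 + eps / 2 * L%:R * P%:R ^+ 8 by field.
rewrite eE; apply: lerD.
  apply: le_trans (ler_wpM2l _ h1) _; first by rewrite mulr_ge0 ?exprn_ge0// ltW.
  rewrite /e1 natrM le_eqVlt; apply/orP; left; apply/eqP; field.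
  by rewrite gt_eqF.
apply: le_trans (ler_wpM2l _ h2) _; first by rewrite mulr_ge0 ?exprn_ge0// ltW.
apply: le_trans (_ : C * P%:R ^+ 11 * (K%:R * (L%:R / P%:R ^+ 3) * (7 / x)) <= _).
  rewrite ler_wpM2l ?mulr_ge0 ?exprn_ge0 ?(ltW C0)//.
  by rewrite ler_wpM2l// mulr_ge0// divr_ge0// exprn_ge0.
rewrite /x le_eqVlt; apply/orP; left; apply/eqP; field.
by rewrite !gt_eqF.
Qed.
End MinorArcs.

(** * Major arcs and irrational shifts *)

Section Irrational.
Variable R : realType.
Implicit Types (theta al eps bt : R).

Lemma shift_sum_le (a : nat -> R[i]) (P m : nat) : (forall k, cnorm (a k) = 1) ->
  cnorm (\sum_(k < P) a k - \sum_(k < P) a (k + m)%N) <= 2 * m%:R.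
Proof.
move=> a1; elim: m => [|m IH].
  by under [X in _ - X]eq_bigr do rewrite addn0; rewrite subrr cnorm0 mulr0.
have step : cnorm (\sum_(k < P) a (k + m)%N - \sum_(k < P) a (k + m.+1)%N) <= 2.
  have e : \sum_(k < P) a (k + m)%N + a (P + m)%N = a m + \sum_(k < P) a (k + m.+1)%N.
    rewrite -(big_ord_recr P (fun k => a (k + m)%N)) big_ord_recl /=; congr (_ + _).
    by apply: eq_bigr => k _; rewrite /bump leq0n addnS add1n addSn.
  have -> : \sum_(k < P) a (k + m)%N - \sum_(k < P) a (k + m.+1)%N = a m - a (P + m)%N.
    by apply/eqP; rewrite subr_eq addrAC -subr_eq opprK e.
  by apply: le_trans (ler_cnormB _ _) _; rewrite !a1; lra.
rewrite -[m.+1%:R]natr1 mulrDr mulr1.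
have -> : \sum_(k < P) a k - \sum_(k < P) a (k + m.+1)%N =
  (\sum_(k < P) a k - \sum_(k < P) a (k + m)%N) +
  (\sum_(k < P) a (k + m)%N - \sum_(k < P) a (k + m.+1)%N) by ring.
by apply: le_trans (ler_cnormD _ _) _; apply: lerD.
Qed.

(** The sum is averaged over [H] shifts by multiples of [q] before Cauchy's inequality; in contrast
    to [van_der_corput], only these shifts are correlated, so that [H] can stay fixed while [P]
    grows. *)
Lemma vdc_shift (a : nat -> R[i]) (P q H : nat) (M : R) : (forall k, cnorm (a k) = 1) ->
  (forall h h' : nat, (h < H)%N -> (h' < H)%N -> h != h' ->
    cnorm (\sum_(k < P) a (k + q * h)%N * ((a (k + q * h')%N)^*)%C) <= M) ->
  0 <= M ->
  H%:R * cnorm (\sum_(k < P) a k) <=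
    2 * (q * H * H)%:R + Num.sqrt (P%:R * (H%:R * P%:R + H%:R ^+ 2 * M)).
Proof.
move=> a1 hM M0; set f := \sum_(k < P) a k.
set S := \sum_(k < P) \sum_(h < H) a (k + q * h)%N.
have h1 : cnorm (H%:R * f - S) <= 2 * (q * H * H)%:R.
  rewrite /S exchange_big /=.
  have -> : H%:R * f = \sum_(h < H) f by rewrite sumr_const card_ord mulr_natl.
  rewrite -sumrB; apply: le_trans (ler_cnorm_sum _ _ _) _.
  apply: le_trans (_ : \sum_(h < H) 2 * (q * H)%:R <= _).
    apply: ler_sum => h _; apply: le_trans (shift_sum_le _ _ a1) _.
    by rewrite ler_wpM2l// ler_nat leq_mul2l (ltnW (ltn_ord h)) orbT.
  by rewrite sumr_ord_const (natrM _ (q * H)) mulrCA [H%:R * _]mulrC.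
have h2 : cnorm S <= Num.sqrt (P%:R * (H%:R * P%:R + H%:R ^+ 2 * M)).
  have S2 : cnorm S ^+ 2 <= P%:R * (H%:R * P%:R + H%:R ^+ 2 * M).
    apply: le_trans (_ : (\sum_(k < P) cnorm (\sum_(h < H) a (k + q * h)%N)) ^+ 2 <= _).
      by rewrite lerXn2r ?nnegrE ?cnorm_ge0 ?sumr_ge0 ?ler_cnorm_sum// => k _; exact: cnorm_ge0.
    apply: le_trans (sqr_sum_le _) _; rewrite ler_wpM2l//.
    have E (k : nat) : cnorm (\sum_(h < H) a (k + q * h)%N) ^+ 2 = complex.Re
        (\sum_(h < H) \sum_(h' < H) a (k + q * h)%N * ((a (k + q * h')%N)^*)%C).
      rewrite -[LHS]/(complex.Re (_%:C)%C) cnorm_sqr_conj conjc_sum; congr complex.Re.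
      by rewrite mulr_suml; apply: eq_bigr => h _; rewrite mulr_sumr.
    under eq_bigr do rewrite E.
    rewrite -Re_sum exchange_big /=; under eq_bigr do rewrite exchange_big /=.
    apply: le_trans (ler_norm _) _; apply: le_trans (ler_Re_cnorm _) _.
    apply: le_trans (ler_cnorm_sum _ _ _) _.
    have -> : H%:R * P%:R + H%:R ^+ 2 * M = \sum_(h < H) (P%:R + H%:R * M).
      by rewrite sumr_ord_const; ring.
    apply: ler_sum => h _; apply: le_trans (ler_cnorm_sum _ _ _) _.
    rewrite (bigD1 h)//=; apply: lerD.
      apply: le_trans (ler_cnorm_sum _ _ _) _.
      under eq_bigr do rewrite cnormM cnorm_conj a1 mulr1.
      by rewrite sumr_ord_const mulr1.
    rewrite -sumr_ord_const [leRHS](bigD1 h)//= ler_wpDl//.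
    by apply: ler_sum => h' hh; apply: hM => //; rewrite eq_sym.
  by rewrite -[leLHS](ger0_norm (cnorm_ge0 S)) -sqrtr_sqr ler_sqrt// (le_trans _ S2)// sqr_ge0.
have -> : H%:R * cnorm f = cnorm (H%:R * f).
  by rewrite cnormM -[H%:R : R[i]](rmorph_nat (@real_complex R)) cnorm_real ger0_norm.
have -> : H%:R * f = (H%:R * f - S) + S by rewrite subrK.
by apply: le_trans (ler_cnormD _ _) _; apply: lerD.
Qed.

(** Shifts by multiples of [q] cancel the denominator of [a / q]: the part quadratic in [k] and the
    linear part free of [theta] form the integer [z]. The remaining slope is an integer multiple of
    [theta]. *)
Lemma cube_phase theta (a q h h' k : nat) : (0 < q)%N ->
  expi (a%:R / q%:R * ((theta + (k + q * h)%:R) ^+ 3 - (theta + (k + q * h')%:R) ^+ 3)) =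
  expi (a%:R * (h%:R - h'%:R) * (3 * theta ^+ 2 + 3 * theta * q%:R * (h%:R + h'%:R)
     + q%:R ^+ 2 * (h%:R ^+ 2 + h%:R * h'%:R + h'%:R ^+ 2))) *
  expi (6 * a%:R * (h%:R - h'%:R) * theta) ^+ k.
Proof.
move=> q0; have qr : q%:R != 0 :> R by rewrite pnatr_eq0 -lt0n.
pose z : int := 3%:Z * a%:Z * (h%:Z - h'%:Z) * (k%:Z ^+ 2 + q%:Z * (h%:Z + h'%:Z) * k%:Z).
rewrite -expiM_nat -expiD -[RHS]mulr1 -(expi_int _ z) -expiD; congr expi.
rewrite /z !(intrM, intrB, intrD, rmorphXn) /= -!pmulrn !natrD !natrM.
by field.
Qed.

(** Replacing [al] by [a / q] in the differenced phase costs at most [8 * |bt| * 12 * q * H * P^2]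
    per term, and [|bt| <= B / P^3] makes the total independent of [P]. The 12 bounds
    [u^2 + u * v + v^2] for [u] and [v] up to [2 * P]. *)
Lemma cube_corr_le theta (a q P h h' H B : nat) al : (0 < q)%N -> (0 < P)%N -> 0 <= theta <= 1 ->
  (h < H)%N -> (h' < H)%N -> (q * H <= P)%N ->
  P%:R ^+ 3 * `|al - a%:R / q%:R| <= B%:R ->
  cnorm (\sum_(k < P) expi (al * (theta + (k + q * h)%:R) ^+ 3) *
     ((expi (al * (theta + (k + q * h')%:R) ^+ 3))^*)%C) <=
  mbound P (6 * a%:R * (h%:R - h'%:R) * theta) + (96 * B * q * H)%:R.
Proof.
move=> q0 P0 /andP[t0 t1] hH h'H qHP hal; set bt := al - a%:R / q%:R in hal.
have Pr : 0 < P%:R :> R by rewrite ltr0n.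
pose D k : R := (theta + (k + q * h)%:R) ^+ 3 - (theta + (k + q * h')%:R) ^+ 3.
pose c0 : R := a%:R * (h%:R - h'%:R) * (3 * theta ^+ 2 + 3 * theta * q%:R * (h%:R + h'%:R)
     + q%:R ^+ 2 * (h%:R ^+ 2 + h%:R * h'%:R + h'%:R ^+ 2)).
pose x : R := 6 * a%:R * (h%:R - h'%:R) * theta.
have E (k : nat) : expi (al * (theta + (k + q * h)%:R) ^+ 3) *
     ((expi (al * (theta + (k + q * h')%:R) ^+ 3))^*)%C =
   expi c0 * expi x ^+ k + (expi (al * D k) - expi (a%:R / q%:R * D k)).
  by rewrite -expiB -mulrBr -/(D k) -cube_phase// -/(D k) addrC subrK.
under eq_bigr do rewrite E.
rewrite big_split /=; apply: le_trans (ler_cnormD _ _) _; apply: lerD.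
  by rewrite -mulr_sumr cnormM cnorm_expi mul1r cnorm_geom_expi.
apply: le_trans (ler_cnorm_sum _ _ _) _.
apply: le_trans (_ : \sum_(k < P) (96 * B * q * H)%:R / P%:R <= _); last first.
  by rewrite sumr_ord_const mulrC divfK// gt_eqF.
apply: ler_sum => k _; apply: le_trans (cnorm_expiB_le _ _) _.
rewrite -mulrBl -/bt normrM.
have hD : `|D k| <= 12 * (q * H)%:R * P%:R ^+ 2.
  rewrite /D; set u := theta + _; set v := theta + _.
  have hu (g : nat) : (g < H)%N -> 0 <= theta + (k + q * g)%:R <= 2 * P%:R.
    move=> gH; rewrite addr_ge0//=.
    apply: le_trans (_ : (1 + k)%:R + (q * g)%:R <= _).
      by rewrite !natrD addrA lerD2r lerD2r.
    rewrite mulr_natl mulr2n; apply: lerD; rewrite ler_nat//.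
    by apply: leq_trans qHP; rewrite leq_mul2l (ltnW gH) orbT.
  have /andP[u0 uP] := hu _ hH; have /andP[v0 vP] := hu _ h'H; rewrite -/u -/v in u0 uP v0 vP.
  have -> : u ^+ 3 - v ^+ 3 = (u - v) * (u ^+ 2 + u * v + v ^+ 2) by ring.
  rewrite normrM [leRHS](_ : _ = (q * H)%:R * (12 * P%:R ^+ 2)); last by ring.
  apply: ler_pM => //.
    have -> : u - v = q%:R * (h%:R - h'%:R) by rewrite /u /v !natrD !natrM; ring.
    rewrite normrM ger0_norm// natrM ler_wpM2l//.
    have : h%:R <= H%:R :> R by rewrite ler_nat ltnW.
    have : h'%:R <= H%:R :> R by rewrite ler_nat ltnW.
    have : 0 <= h%:R :> R by []. have : 0 <= h'%:R :> R by [].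
    by rewrite ler_norml => *; apply/andP; split; lra.
  rewrite ger0_norm; last by rewrite !addr_ge0 ?sqr_ge0 ?mulr_ge0.
  move: u0 uP v0 vP; move: u v (P%:R : R) => u v p *; nra.
apply: le_trans (_ : 8 * (`|bt| * (12 * (q * H)%:R * P%:R ^+ 2)) <= _).
  by rewrite ler_wpM2l// ler_wpM2l.
rewrite ler_pdivlMr//.
have -> : 8 * (`|bt| * (12 * (q * H)%:R * P%:R ^+ 2)) * P%:R = 96 * (q * H)%:R * (P%:R ^+ 3 * `|bt|) by ring.
apply: le_trans (ler_wpM2l _ hal) _; first by rewrite mulr_ge0.
by rewrite le_eqVlt; apply/orP; left; apply/eqP; rewrite !natrM; ring.
Qed.

(** The slopes [6 * a * (h - h') * theta] are finitely many nonzero multiples of [theta], so their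
    geometric sums are bounded by a constant [M0] while [P] grows. [H] is taken large to beat the
    diagonal, and then [P] to beat everything else; no rate in [P] results. *)
Lemma near_frac_small theta (B T : nat) eps : 0 <= theta <= 1 -> 0 < eps ->
  (forall n : nat, (0 < n)%N -> rho (n%:R * theta) != 0) ->
  exists P0 : nat, forall (P : nat) al, (P0 <= P)%N -> 0 <= al <= T%:R ->
    B%:R < P%:R ^+ 3 * al -> near_frac B P al ->
    cnorm (cubesum theta P al) <= eps * P%:R.
Proof.
move=> ht e0 irr.
pose H := (Num.truncn (8 / eps ^+ 2)).+1.
have Hr : 0 < H%:R :> R by rewrite ltr0n.
have hH : 8 / eps ^+ 2 <= H%:R by rewrite ltW// truncnS_gt.
pose amax := (B * (6 * T + B))%N.
pose N := (6 * amax * H)%N.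
pose M0 : R := \sum_(n < N) (2 * `|rho (n.+1%:R * theta)|)^-1.
have M00 : 0 <= M0 by apply: sumr_ge0 => n _; rewrite invr_ge0 mulr_ge0.
pose M : R := M0 + (96 * B * (6 * B) * H)%:R.
have M_0 : 0 <= M by rewrite addr_ge0.
pose P1 := (Num.truncn (8 * M / eps ^+ 2)).+1.
pose P2 := (Num.truncn (4 * (6 * B * H)%:R / eps)).+1.
exists (P1 + P2 + 6 * B * H)%N => P al hP /andP[al0 alT] hal [q [a [q0 qB cop hqa]]].
have Pp : (0 < P)%N by apply: leq_trans hP; rewrite -addnA addSn.
have Pr : 0 < P%:R :> R by rewrite ltr0n.
have qr : 0 < q%:R :> R by rewrite ltr0n.
have P31 : 1 <= P%:R ^+ 3 :> R by rewrite exprn_ege1// ler1n.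
(* Here the neighbourhood of 0 is excluded: [a = 0] forces [q = 1] by coprimality, and then
   [6 * al * P^3 <= B]. *)
have a0 : (0 < a)%N.
  rewrite lt0n; apply/eqP => a0; move: cop hqa; rewrite a0 /coprime gcd0n => /eqP ->.
  rewrite mul0r subr0 ger0_norm ?mulr_ge0// => h.
  have : 0 <= P%:R ^+ 3 * al by rewrite mulr_ge0 ?exprn_ge0.
  by move: h hal; rewrite (mulrCA _ 6); lra.
have aB : (a <= amax)%N.
  have h : `|6 * al - a%:R / q%:R| <= B%:R.
    by apply: le_trans hqa; rewrite ler_peMl.
  have : a%:R / q%:R <= 6 * T%:R + B%:R :> R.
    by move: h; rewrite ler_norml => /andP[? ?]; lra.
  rewrite ler_pdivrMr// -(ler_nat R) /amax natrM natrD natrM => h'.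
  apply: le_trans h' _; rewrite mulrC ler_wpM2r ?addr_ge0 ?mulr_ge0//.
  by rewrite ler_nat.
(* The arcs are those of [6 * al], so [al] itself is near a fraction of denominator [6 * q]. *)
set q' := (6 * q)%N; have q'0 : (0 < q')%N by rewrite muln_gt0.
have q'H : (q' * H <= P)%N.
  apply: leq_trans hP; rewrite (leq_trans _ (leq_addl _ _))//.
  by rewrite leq_mul2r /q' leq_mul2l qB !orbT.
have hal' : P%:R ^+ 3 * `|al - a%:R / q'%:R| <= B%:R.
  apply: le_trans hqa; rewrite ler_wpM2l ?exprn_ge0//.
  have -> : 6 * al - a%:R / q%:R = 6 * (al - a%:R / q'%:R).
    by rewrite /q' natrM; field; rewrite gt_eqF.
  by rewrite [leRHS]normrM ger0_norm// ler_peMl//; lra.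
have key := @vdc_shift (fun k => expi (al * (theta + k%:R) ^+ 3)) P q' H M
  (fun k => cnorm_expi _) _ M_0.
have {}key : H%:R * cnorm (cubesum theta P al) <=
    2 * (q' * H * H)%:R + Num.sqrt (P%:R * (H%:R * P%:R + H%:R ^+ 2 * M)).
  apply: key => h h' hh hh' hne.
  apply: le_trans (cube_corr_le q'0 Pp ht hh hh' q'H hal') _; apply: lerD; last first.
    by rewrite ler_nat leq_mul2r /q' !leq_mul2l qB !orbT.
  have main (g g' : nat) : (g < g')%N -> (g' < H)%N ->
      mbound P (6 * a%:R * (g'%:R - g%:R) * theta) <= M0.
    move=> gg' g'H; rewrite -natrB ?(ltnW gg')// -!natrM.
    set n := (6 * a * (g' - g))%N.
    have n0 : (0 < n)%N by rewrite !muln_gt0 a0 subn_gt0.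
    have nN : (n.-1 < N)%N.
      rewrite prednK// /n /N leq_mul ?leq_mul// (leq_trans (leq_subr _ _))// ltnW//.
    apply: le_trans (_ : (2 * `|rho (n%:R * theta)|)^-1 <= _).
      by apply: mbound_le_inv; rewrite ?normr_gt0 ?irr.
    rewrite /M0 (bigD1 (Ordinal nN))//= prednK// lerDl.
    by apply: sumr_ge0 => m _; rewrite invr_ge0 mulr_ge0.
  case: (ltngtP h h') hne => // hlt _; last exact: main.
  rewrite -mboundN; have -> : - (6 * a%:R * (h%:R - h'%:R) * theta) = 6 * a%:R * (h'%:R - h%:R) * theta.
    by ring.
  exact: main.
have e2 : 0 < eps ^+ 2 by rewrite exprn_gt0.
have MP : 8 * M <= eps ^+ 2 * P%:R.
  rewrite [leRHS]mulrC -ler_pdivrMr//.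
  apply: le_trans (_ : P1%:R <= _); first by rewrite ltW// truncnS_gt.
  by rewrite ler_nat (leq_trans _ hP)// -addnA leq_addr.
have QP : 4 * (6 * B * H)%:R <= eps * P%:R.
  rewrite [leRHS]mulrC -ler_pdivrMr//.
  apply: le_trans (_ : P2%:R <= _); first by rewrite ltW// truncnS_gt.
  by rewrite ler_nat (leq_trans _ hP)// -addnA addnCA leq_addr.
rewrite -(ler_pM2l Hr); apply: le_trans key _.
have -> : H%:R * (eps * P%:R) = H%:R * (eps * P%:R) / 2 + H%:R * (eps * P%:R) / 2 by field.
apply: lerD.
  rewrite ler_pdivlMr//.
  have : (q' * H * H)%:R <= (6 * B * H)%:R * H%:R :> R.
    by rewrite -natrM ler_nat !leq_mul2r /q' leq_mul2l qB !orbT.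
  have := ler_wpM2l (ltW Hr) QP.
  by move: (q' * H * H)%:R ((6 * B * H)%:R) (H%:R : R) => u v w; lra.
have rhs0 : 0 <= H%:R * (eps * P%:R) / 2 by rewrite !mulr_ge0// ltW.
rewrite -[leRHS](ger0_norm rhs0) -sqrtr_sqr ler_sqrt ?sqr_ge0//.
have h1 : 8 <= eps ^+ 2 * H%:R by move: hH; rewrite ler_pdivrMr// mulrC.
have -> : (H%:R * (eps * P%:R) / 2) ^+ 2 = P%:R * (H%:R * P%:R * (eps ^+ 2 * H%:R) / 8 + H%:R ^+ 2 * (eps ^+ 2 * P%:R) / 8).
  by field.
rewrite ler_wpM2l//; apply: lerD.
  by rewrite ler_pdivlMr// ler_wpM2l// mulr_ge0.
by rewrite ler_pdivlMr// -mulrA ler_wpM2l ?sqr_ge0// mulrC.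
Qed.
End Irrational.

(** * The Gamma function *)

Section GammaFunction.
Variable R : realType.
Local Notation mu := (@lebesgue_measure R).
Implicit Types (x y a b t : R).

Definition gamma_fun x t : R := t `^ (x - 1) * expR (- t).

(** Kept in the extended reals: the recurrence is derived before finiteness is known, and finiteness
    is deduced from it. *)
Definition gamma_int x : \bar R :=
  (\int[mu]_(t in `]0%R, +oo[) (gamma_fun x t)%:E)%E.

Lemma gamma_fun_ge0 x t : 0 <= gamma_fun x t.
Proof. by rewrite mulr_ge0 ?powR_ge0 ?expR_ge0. Qed.

Lemma measurable_gamma_fun x (D : set R) : measurable_fun D (gamma_fun x).
Proof.
apply: measurable_funTS; apply: measurable_funM; first exact: measurable_powR.
by apply: measurableT_comp; first exact: measurable_expR.
Qed.

Lemma measurable_gamma_EFin x (D : set R) :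
  measurable_fun D (EFin \o gamma_fun x).
Proof. by apply/measurable_EFinP; exact: measurable_gamma_fun. Qed.

Lemma gamma_int_ge0 x : (0 <= gamma_int x)%E.
Proof. by apply: integral_ge0 => t _; rewrite lee_fin gamma_fun_ge0. Qed.

Lemma continuous_powR_pos x a : 0 < a -> {for a, continuous (fun t => t `^ x)}.
Proof.
move=> a0; apply: differentiable_continuous; apply/derivable1_diffP.
by apply: derivable_powR; rewrite in_itv /= a0.
Qed.

Lemma gamma_by_parts x a b : 0 <= x -> 0 < a -> a < b ->
  (\int[mu]_(t in `[a, b]) (gamma_fun (x + 1) t)%:E =
   (a `^ x * expR (- a) - b `^ x * expR (- b))%:E +
   \int[mu]_(t in `[a, b]) (x * gamma_fun x t)%:E)%E.
Proof.
move=> x0 a0 ab.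
have tpos t : t \in `[a, b] -> 0 < t by rewrite in_itv /= => /andP[h _]; exact: lt_le_trans h.
have dG t : is_derive t 1 (fun t : R => - expR (- t)) (expR (- t)).
  by apply: is_derive_eq; rewrite mulrN1 opprK.
have dF t : 0 < t -> is_derive t 1 (fun t : R => t `^ x) (x * t `^ (x - 1)).
  by move=> t0; exact: is_derive1_powR.
have cF y : {within `[a, b], continuous (fun t : R => t `^ y)}.
  apply: continuous_in_subspaceT => t; rewrite inE /= => /tpos t0.
  exact: continuous_powR_pos.
have cexp : continuous (fun t : R => expR (- t)).
  by move=> t; apply: continuous_comp; [exact: opp_continuous | exact: continuous_expR].
have LR (H : R -> R) : (forall t, 0 < t -> derivable H t 1) -> derivable_oo_LRcontinuous H a b.
  move=> dH; have cH : {within `[a, b], continuous H}.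
    by apply: derivable_within_continuous => t /tpos; exact: dH.
  have [_ h1 h2] := (continuous_within_itvP H ab).1 cH.
  by split => // t; rewrite in_itv /= => /andP[h _]; apply: dH; exact: lt_trans h.
have h1 : {within `[a, b], continuous (fun t : R => x * t `^ (x - 1))}.
  by move=> t; apply: cvgM; [exact: cvg_cst | exact: cF].
have h2 : {within `[a, b], continuous (fun t : R => expR (- t))}.
  exact: continuous_subspaceT.
have dF' t : 0 < t -> derivable (fun t : R => t `^ x) t 1 by move=> /dF[].
have dG' t : 0 < t -> derivable (fun t : R => - expR (- t)) t 1 by case: (dG t).
have hF : {in `]a, b[, (fun t : R => t `^ x)^`()%classic =1 (fun t => x * t `^ (x - 1))}.
  by move=> t; rewrite in_itv /= => /andP[h _]; rewrite derive1E; case: (dF t (lt_trans a0 h)).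
have hG : {in `]a, b[, (fun t : R => - expR (- t))^`()%classic =1 (fun t => expR (- t))}.
  by move=> t _; rewrite derive1E; case: (dG t).
have h := integration_by_parts ab h1 (LR _ dF') hF h2 (LR _ dG') hG.
have -> : (\int[mu]_(t in `[a, b]) (gamma_fun (x + 1) t)%:E =
    \int[mu]_(t in `[a, b]) (t `^ x * expR (- t))%:E)%E.
  by apply: eq_integral => t _; rewrite /gamma_fun addrK.
rewrite h.
congr (_ + _)%E; first by congr EFin; ring.
have -> : (\int[mu]_(t in `[a, b]) (x * t `^ (x - 1) * - expR (- t))%:E =
    \int[mu]_(t in `[a, b]) (- (x * gamma_fun x t)%:E))%E.
  by apply: eq_integral => t _; rewrite -EFinN /gamma_fun; congr EFin; ring.
by rewrite integral_ge0N ?oppeK// => t _; rewrite lee_fin mulr_ge0// gamma_fun_ge0.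
Qed.

(** Monotone exhaustion by compact intervals avoiding 0; [n.+2] instead of [n.+1] makes all of them
    nondegenerate. *)
Lemma gamma_int_cvg x : (\int[mu]_(t in `[(n.+2%:R)^-1%R, n.+2%:R]) (gamma_fun x t)%:E)%E
  @[n --> \oo] --> gamma_int x.
Proof.
rewrite /gamma_int; have <- : \bigcup_n `[(n.+2%:R)^-1, n.+2%:R]%classic = `]0%R, +oo[%classic :> set R.
  apply/seteqP; split => [t [n _] /=|t /=].
    by rewrite !in_itv /= andbT => /andP[h _]; apply: lt_le_trans h; rewrite invr_gt0.
  rewrite !in_itv /= andbT => t0.
  pose m := Num.truncn (Num.max t t^-1).
  have hm : Num.max t t^-1 <= m.+2%:R.
    by apply: le_trans (ltW (truncnS_gt _)) _; rewrite ler_nat.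
  exists m => //=; rewrite in_itv /=; apply/andP; split.
    rewrite -[t]invrK lef_pV2 ?posrE ?invr_gt0//.
    by apply: le_trans hm; rewrite le_max lexx orbT.
  by apply: le_trans hm; rewrite le_max lexx.
apply: (@ge0_nondecreasing_set_cvg_integral _ (measurableTypeR R) R
  (fun n => `[(n.+2%:R)^-1, n.+2%:R]%classic) (EFin \o gamma_fun x) mu).
- apply/nondecreasing_seqP => n; rewrite subsetEset => t /=; rewrite !in_itv /=.
  move=> /andP[h1 h2]; apply/andP; split.
    by apply: le_trans h1; rewrite lef_pV2 ?posrE// ler_nat.
  by apply: le_trans h2 _; rewrite ler_nat.
- by move=> n; exact: measurable_itv.
- by move=> n; exact: measurable_gamma_EFin.
- by move=> n t _; rewrite /= lee_fin gamma_fun_ge0.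
Qed.

Lemma cvg_harmonic2 : (n.+2%:R)^-1 @[n --> \oo] --> (0 : R).
Proof. by have := @cvg_harmonic R; rewrite -cvg_shiftS. Qed.

Lemma powR_expR_le x (m : nat) t : x <= m%:R -> 1 <= t ->
  t `^ x * expR (- t) <= m.+1`!%:R / t.
Proof.
move=> xm t1; have t0 : 0 < t by exact: lt_le_trans t1.
have h : t ^+ m.+1 / m.+1`!%:R <= expR t.
  by apply: le_trans (expR_ge1Dxn m (ltW t0)); rewrite lerDr.
have h1 : t `^ x <= t ^+ m by rewrite -(powR_mulrn m (ltW t0)) ler_powR.
apply: le_trans (ler_wpM2r (expR_ge0 _) h1) _.
have f0 : 0 < m.+1`!%:R :> R by rewrite ltr0n fact_gt0.
rewrite ler_pdivlMr// mulrAC -exprSr expRN ler_pdivrMr ?expR_gt0//.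
by rewrite mulrC -ler_pdivrMr.
Qed.

Lemma gamma_bdry_cvg x : 0 < x ->
  ((n.+2%:R)^-1 `^ x * expR (- (n.+2%:R)^-1) - n.+2%:R `^ x * expR (- n.+2%:R)) @[n --> \oo] --> (0 : R).
Proof.
move=> x0; pose m := (Num.truncn x).+1.
have xm : x <= m%:R by rewrite ltW// truncnS_gt.
have h1 : (n.+2%:R)^-1 `^ x @[n --> \oo] --> (0 : R).
  apply: ((cvg_at_rightP (fun t => t `^ x) 0 0).1 (powR_cvg0 x0)); split.
    by move=> n; rewrite invr_gt0.
  exact: cvg_harmonic2.
have h2 : (- (m.+1`!%:R * (n.+2%:R)^-1)) @[n --> \oo] --> (0 : R).
  rewrite -oppr0 -[X in - X](mulr0 m.+1`!%:R); apply: cvgN; apply: cvgM; first exact: cvg_cst.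
  exact: cvg_harmonic2.
apply: squeeze_cvgr h2 h1; near=> n.
apply/andP; split.
  apply: le_trans (_ : - (n.+2%:R `^ x * expR (- n.+2%:R)) <= _).
    by rewrite lerN2; apply: powR_expR_le => //; rewrite ler1n.
  by rewrite lerDr mulr_ge0 ?powR_ge0 ?expR_ge0.
apply: le_trans (_ : (n.+2%:R)^-1 `^ x * expR (- (n.+2%:R)^-1) <= _).
  by rewrite gerBl mulr_ge0 ?powR_ge0 ?expR_ge0.
by rewrite ler_piMr ?powR_ge0// expR_le1 oppr_le0 invr_ge0.
Unshelve. all: by end_near. Qed.

Lemma gamma_int_rec x : 0 < x -> (gamma_int (x + 1) = x%:E * gamma_int x)%E.
Proof.
move=> x0; have h1 := gamma_int_cvg (x := x + 1).
have h2 : (((n.+2%:R)^-1 `^ x * expR (- (n.+2%:R)^-1) - n.+2%:R `^ x * expR (- n.+2%:R))%:E +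
   x%:E * \int[mu]_(t in `[(n.+2%:R)^-1%R, n.+2%:R]) (gamma_fun x t)%:E)%E
   @[n --> \oo] --> (0%:E + x%:E * gamma_int x)%E.
  apply: cvgeD => //.
    by apply: cvg_EFin (gamma_bdry_cvg x0); exact: nearW.
  by apply: cvgeZl => //; exact: gamma_int_cvg.
rewrite add0e in h2; apply: cvg_unique h1 _ => //.
apply: cvg_trans h2; apply: near_eq_cvg; near=> n.
have a0 : 0 < (n.+2%:R)^-1 :> R by rewrite invr_gt0.
have ab : (n.+2%:R)^-1 < n.+2%:R :> R.
  by apply: (@lt_trans _ _ 1); rewrite ?invf_lt1 ?ltr1n.
rewrite (gamma_by_parts (ltW x0) a0 ab).
congr (_ + _)%E; rewrite -ge0_integralZl_EFin//.
- by move=> t _; rewrite lee_fin gamma_fun_ge0.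
- exact: measurable_gamma_EFin.
- exact: ltW.
Unshelve. all: by end_near. Qed.

Lemma gamma_int1 : gamma_int 1 = 1%E.
Proof.
have := @integral_exponential_pdf R 1 ltr01.
rewrite /gamma_int => <-.
rewrite [RHS](_ : _ = \int[mu]_(t in `[0%R, +oo[) (expR (- t))%:E)%E; last first.
  rewrite [RHS]integral_mkcond; apply: eq_integral => t _.
  rewrite /exponential_pdf restrict_EFin /= !patchE; case: ifP => // _.
  by rewrite mul1r mulN1r.
rewrite -integral_itv_obnd_cbnd; last first.
  apply/measurable_EFinP; apply: measurable_funTS.
  by apply: measurableT_comp; first exact: measurable_expR.
by apply: eq_integral => t _; rewrite /gamma_fun subrr powRr0 mul1r.
Qed.

Lemma gamma_int_nat (n : nat) : gamma_int n.+1%:R = (n`!%:R)%:E.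
Proof.
elim: n => [|n IH]; first by rewrite gamma_int1.
by rewrite -natr1 gamma_int_rec// IH -EFinM -natrM factS.
Qed.

(** The bound [t^x <= 1 + t^m] compares the value at [x + 1] with integer arguments, and the
    recurrence descends to [x] without an estimate of the singularity at 0. *)
Lemma gamma_int_fin x : 0 < x -> gamma_int x \is a fin_num.
Proof.
move=> x0; pose m := (Num.truncn x).+1.
have xm : x <= m%:R by rewrite ltW// truncnS_gt.
have h : (gamma_int (x + 1) < +oo)%E.
  apply: le_lt_trans (_ : gamma_int 1 + gamma_int m.+1%:R < +oo)%E; last first.
    by rewrite gamma_int1 gamma_int_nat -EFinD ltry.
  rewrite /gamma_int -ge0_integralD//=.
  - apply: ge0_le_integral => //=.
    + by move=> t _; rewrite lee_fin gamma_fun_ge0.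
    + exact: measurable_gamma_EFin.
    + by apply: emeasurable_funD; exact: measurable_gamma_EFin.
    + move=> t; rewrite in_itv /= andbT => t0; rewrite -EFinD lee_fin /gamma_fun -mulrDl.
      rewrite ler_wpM2r ?expR_ge0// subrr powRr0 addrK -natr1 addrK.
      have [t1|t1] := leP 1 t.
        by apply: le_trans (ler_powR t1 xm) _; rewrite lerDr.
      apply: le_trans (_ : 1 <= _); last by rewrite lerDl powR_ge0.
      rewrite -(powRr0 t); apply: ger_powR; last exact: ltW.
      by rewrite t0 ltW.
  - by move=> t _; rewrite lee_fin gamma_fun_ge0.
  - exact: measurable_gamma_EFin.
  - by move=> t _; rewrite lee_fin gamma_fun_ge0.
  - exact: measurable_gamma_EFin.
rewrite gamma_int_rec// in h; rewrite ge0_fin_numE ?gamma_int_ge0//.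
move: h (gamma_int_ge0 x); case: (gamma_int x) => [r| |]//= h _; first exact: ltry.
by move: h; rewrite gt0_muley ?lte_fin.
Qed.

Lemma GammaE x : 0 < x -> (Gamma x)%:E = gamma_int x.
Proof. by move=> x0; rewrite /Gamma /Rintegral fineK ?gamma_int_fin. Qed.

Lemma Gamma_rec x : 0 < x -> Gamma (x + 1) = x * Gamma x.
Proof.
by move=> x0; apply: EFin_inj; rewrite EFinM !GammaE ?addr_gt0// gamma_int_rec.
Qed.

Lemma Gamma_nat (n : nat) : Gamma n.+1%:R = n`!%:R :> R.
Proof. by apply: EFin_inj; rewrite GammaE// gamma_int_nat. Qed.

Lemma powRD_gt0 t x y : 0 < t -> t `^ (x + y) = t `^ x * t `^ y.
Proof. by move=> t0; apply: powRD; rewrite (gt_eqF t0) implybT. Qed.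

Lemma powRB1 y x : 0 < x -> x `^ (y - 1) = x `^ y / x.
Proof. by move=> x0; rewrite powRD_gt0// powR_inv1// ltW. Qed.

(** The right-hand side is the tangent at [x] of the concave function [t^y]; after scaling to
    [x = 1] this is convexity of the exponential. *)
Lemma powR_tangent x y t : 0 < x -> 0 < t -> 0 <= y <= 1 ->
  t `^ y <= (1 - y) * x `^ y + y * x `^ (y - 1) * t.
Proof.
move=> x0 t0 /andP[y0 y1].
have xy := powRB1 y x0.
pose u := t / x; have u0 : 0 < u by rewrite divr_gt0.
have -> : t = x * u by rewrite /u mulrCA divff ?mulr1 ?gt_eqF.
rewrite (powRM _ (ltW x0) (ltW u0)) xy.
have -> : (1 - y) * x `^ y + y * (x `^ y / x) * (x * u) = x `^ y * (1 - y + y * u).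
  by field; rewrite gt_eqF.
rewrite ler_wpM2l ?powR_ge0//.
have -> : u `^ y = expR (y * ln u) by rewrite /powR gt_eqF.
have := @convex_expR R (Itv01 y0 y1) (ln u) 0.
rewrite !convRE /= mulr0 addr0 lnK ?posrE// expR0 mulr1 => h.
by rewrite [leRHS]addrC; exact: h.
Qed.

Lemma integrable_gamma x : 0 < x -> mu.-integrable `]0%R, +oo[ (EFin \o gamma_fun x).
Proof.
move=> x0; apply/integrableP; split; first exact: measurable_gamma_EFin.
under eq_integral do rewrite /= (ger0_norm (gamma_fun_ge0 _ _)).
by have := gamma_int_fin x0; rewrite ge0_fin_numE ?gamma_int_ge0.
Qed.

Lemma integrableZ_gamma (k : R) x : 0 < x ->
  mu.-integrable `]0%R, +oo[ (EFin \o (fun t => k * gamma_fun x t)).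
Proof.
move=> x0; rewrite (_ : _ \o _ = (fun t => k%:E * (EFin \o gamma_fun x) t)%E)//.
by apply: integrableZl => //; exact: integrable_gamma.
Qed.

(** Wendel's inequality: the tangent bound is integrated against [gamma_fun x]. The point of
    tangency is the mean [x] of the gamma density, so by [Gamma (x + 1) = x * Gamma x] the two terms
    combine exactly. *)
Lemma Gamma_add_le x y : 0 < x -> 0 <= y <= 1 -> Gamma (x + y) <= Gamma x * x `^ y.
Proof.
move=> x0 y01; have /andP[y0 y1] := y01.
have x10 : 0 < x + 1 by rewrite addr_gt0.
have xy0 : 0 < x + y by rewrite ltr_pwDl.
have -> : Gamma x * x `^ y = (1 - y) * x `^ y * Gamma x + y * x `^ (y - 1) * Gamma (x + 1).
  rewrite Gamma_rec// powRB1//.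
  by field; rewrite gt_eqF.
rewrite /Gamma -!RintegralZl//; try exact: integrable_gamma.
rewrite -RintegralD//=; first last.
- exact: integrableZ_gamma.
- exact: integrableZ_gamma.
apply: le_Rintegral => //=; first exact: integrable_gamma.
  exact: (integrableD _ (integrableZ_gamma _ x0) (integrableZ_gamma _ x10)).
move=> t; rewrite in_itv /= andbT => t0.
rewrite !mulrA -mulrDl ler_wpM2r ?expR_ge0//.
have e1 : t `^ (x + y - 1) = t `^ (x - 1) * t `^ y.
  by rewrite -powRD_gt0//; congr (_ `^ _); ring.
have e2 : t `^ (x + 1 - 1) = t `^ (x - 1) * t.
  by rewrite -[X in _ * X](powRr1 (ltW t0)) -powRD_gt0//; congr (_ `^ _); ring.
apply: le_trans (_ : t `^ (x - 1) * ((1 - y) * x `^ y + y * x `^ (y - 1) * t) <= _).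
  by rewrite e1 ler_wpM2l ?powR_ge0// powR_tangent.
by rewrite e2 mulrDr mulrC lerD2l mulrCA.
Qed.

Lemma Gamma_gt0 x : 0 < x -> 0 < Gamma x.
Proof.
move=> x0; pose m := Num.truncn x.
have /andP[m1 m2] : m%:R <= x < m.+1%:R by rewrite truncn_itv// ltW.
have y01 : 0 <= m.+1%:R - x <= 1.
  by rewrite -natr1; apply/andP; split; move: m1 m2; rewrite -?natr1; lra.
have := Gamma_add_le x0 y01; rewrite addrC subrK Gamma_nat => h.
have : 0 < Gamma x * x `^ (m.+1%:R - x) by apply: lt_le_trans h; rewrite ltr0n fact_gt0.
by rewrite pmulr_lgt0// powR_gt0.
Qed.
End GammaFunction.

(** * Coefficients of (1 - z)^(-x) and their asymptotics *)

Section RisingCoefficients.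
Variable R : realType.
Implicit Types (x y eps : R).

(* The coefficient of z^n in (1 - z)^(-x). *)
Definition rcoef x (n : nat) : R := \prod_(i < n) ((x + i%:R) / i.+1%:R).

Lemma rcoef0 x : rcoef x 0 = 1. Proof. by rewrite /rcoef big_ord0. Qed.

Lemma rcoefS x n : rcoef x n.+1 = rcoef x n * ((x + n%:R) / n.+1%:R).
Proof. by rewrite /rcoef big_ord_recr. Qed.

Lemma rcoefS_mul x n : n.+1%:R * rcoef x n.+1 = (x + n%:R) * rcoef x n.
Proof. by rewrite rcoefS; field; rewrite addrC natr1 pnatr_eq0. Qed.

Lemma rcoef_gt0 x n : 0 < x -> 0 < rcoef x n.
Proof.
move=> x0; apply: prodr_gt0 => i _; rewrite divr_gt0 ?ltr0n//.
by rewrite ltr_pwDl.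
Qed.

Lemma rcoef_ge0 x n : 0 < x -> 0 <= rcoef x n.
Proof. by move=> /rcoef_gt0/ltW. Qed.

Lemma rcoef1 n : rcoef 1 n = 1.
Proof. by rewrite /rcoef big1// => i _; rewrite addrC natr1 divff// pnatr_eq0. Qed.

Lemma rcoef_nonincr x (m n : nat) : 0 < x <= 1 -> (m <= n)%N -> rcoef x n <= rcoef x m.
Proof.
move=> /andP[x0 x1] /subnK <-; elim: (n - m)%N => // k IH.
rewrite addSn; apply: le_trans IH; rewrite rcoefS ler_piMr ?rcoef_ge0//.
by rewrite ler_pdivrMr ?ltr0n// mul1r -natr1 addrC lerD2l.
Qed.

Lemma rcoef_nondecr x (m n : nat) : 1 <= x -> (m <= n)%N -> rcoef x m <= rcoef x n.
Proof.
move=> x1 /subnK <-; have x0 : 0 < x by exact: lt_le_trans x1.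
elim: (n - m)%N => // k IH.
rewrite addSn; apply: le_trans IH _; rewrite rcoefS ler_peMr ?rcoef_ge0//.
by rewrite ler_pdivlMr ?ltr0n// mul1r -natr1 addrC lerD2r.
Qed.

(** Writing [n.+1 = i + (n.+1 - i)] inside the convolution is the product rule for the derivative of
    [(1 - z)^(-x) * (1 - z)^(-y)]; [rcoefS_mul] then closes the recursion. *)
Lemma rcoef_vandermonde x y n :
  \sum_(i < n.+1) rcoef x i * rcoef y (n - i) = rcoef (x + y) n.
Proof.
elim: n => [|n IH]; first by rewrite big_ord_recl big_ord0 addr0 !rcoef0 mulr1.
have n0 : n.+1%:R != 0 :> R by rewrite pnatr_eq0.
apply: (mulfI n0); rewrite rcoefS_mul -IH.
have -> : n.+1%:R * (\sum_(i < n.+2) rcoef x i * rcoef y (n.+1 - i)) =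
  \sum_(i < n.+2) (i%:R * rcoef x i) * rcoef y (n.+1 - i) +
  \sum_(i < n.+2) rcoef x i * ((n.+1 - i)%:R * rcoef y (n.+1 - i)).
  rewrite mulr_sumr -big_split /=; apply: eq_bigr => i _.
  have -> : n.+1%:R = i%:R + (n.+1 - i)%:R :> R by rewrite -natrD subnKC// -ltnS.
  by ring.
rewrite big_ord_recl /= !mul0r add0r.
rewrite [X in _ + X]big_ord_recr /= subnn mul0r mulr0 addr0 mulr_sumr -big_split /=.
apply: eq_bigr => i _; rewrite /bump leq0n add1n subSS rcoefS_mul.
rewrite subSn -1?ltnS// rcoefS_mul natrB -1?ltnS//; ring.
Qed.

Lemma sum_rcoef x n : \sum_(i < n.+1) rcoef x i = rcoef (x + 1) n.
Proof.
by rewrite -rcoef_vandermonde; apply: eq_bigr => i _; rewrite rcoef1 mulr1.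
Qed.

Lemma rcoef_Gamma x n : 0 < x -> rcoef x n * Gamma x = Gamma (x + n%:R) / n`!%:R.
Proof.
move=> x0; elim: n => [|n IH]; first by rewrite rcoef0 mul1r addr0 divr1.
rewrite rcoefS -mulrA [_ / _ * _]mulrC mulrA IH -natr1 addrA Gamma_rec; last by rewrite ltr_pwDl.
have f0 : n`!%:R != 0 :> R by rewrite pnatr_eq0 -lt0n fact_gt0.
rewrite natr1 factS natrM; field.
by rewrite f0 addrC natr1 pnatr_eq0.
Qed.

(** [Gamma_add_le] twice: [Gamma (n + x) <= Gamma n * n^x] from above and
    [n! <= Gamma (n + x) * (n + x)^(1 - x)] from below. Both increments must lie in [0, 1], hence
    the range of [x]. *)
Lemma rcoef_asymp_small x : 0 < x <= 1 -> forall n, (0 < n)%N ->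
  n%:R / n.+1%:R * n%:R `^ (x - 1) <= rcoef x n * Gamma x <= n%:R `^ (x - 1).
Proof.
move=> /andP[x0 x1] [//|n] _; set m := n.+1.
have mr : 0 < m%:R :> R by rewrite ltr0n.
have f0 : 0 < m`!%:R :> R by rewrite ltr0n fact_gt0.
rewrite rcoef_Gamma//; apply/andP; split; last first.
  rewrite ler_pdivrMr// addrC; apply: le_trans (Gamma_add_le mr _) _.
    by rewrite ltW.
  rewrite /m Gamma_nat powRB1// factS natrM.
  by rewrite le_eqVlt; apply/orP; left; apply/eqP; field; rewrite gt_eqF.
have y0 : 0 < x + m%:R by rewrite ltr_pwDl// ltW.
have := @Gamma_add_le _ (x + m%:R) (1 - x) y0.
have -> : 0 <= 1 - x <= 1 by apply/andP; split; lra.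
move=> /(_ isT); rewrite (_ : x + m%:R + (1 - x) = m.+1%:R); last by rewrite -natr1; ring.
rewrite Gamma_nat => h.
rewrite ler_pdivlMr//; set G := Gamma _ in h *.
have G0 : 0 < G by exact: Gamma_gt0.
have hp : (x + m%:R) `^ (1 - x) <= m.+1%:R / m%:R * m%:R `^ (1 - x).
  apply: le_trans (_ : m.+1%:R `^ (1 - x) <= _).
    apply: ge0_ler_powR; rewrite ?nnegrE ?subr_ge0//; first exact: ltW.
    by rewrite -natr1 addrC lerD2l.
  rewrite [X in X `^ _ <= _](_ : _ = m.+1%:R / m%:R * m%:R); last by rewrite divfK// gt_eqF.
  rewrite powRM ?divr_ge0// ler_wpM2r ?powR_ge0// ler1_powR ?gerBl ?(ltW x0)//.
  by rewrite ler_pdivlMr// mul1r ler_nat.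
have v0 : 0 < m%:R `^ (1 - x) :> R by rewrite powR_gt0.
have -> : m%:R `^ (x - 1) = (m%:R `^ (1 - x))^-1 :> R by rewrite -powRN opprB.
have {}h : m`!%:R <= G * (m.+1%:R / m%:R * m%:R `^ (1 - x)).
  by apply: le_trans h _; rewrite ler_wpM2l// ltW.
have u0 : 0 < m.+1%:R / m%:R :> R by rewrite divr_gt0.
by rewrite -[m%:R / _]invf_div -invfM mulrC ler_pdivrMr// mulr_gt0.
Qed.

(** Induction on an integer bound for [x]: [rcoef (z + 1) n * Gamma (z + 1)] is exactly [z + n]
    times [rcoef z n * Gamma z], and [z + n] is asymptotic to [n]. *)
Lemma rcoef_asymp x eps : 0 < x -> 0 < eps -> exists n0 : nat, (0 < n0)%N /\
  forall n, (n0 <= n)%N ->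
    `|rcoef x n * Gamma x - n%:R `^ (x - 1)| <= eps * n%:R `^ (x - 1).
Proof.
suff main (k : nat) : forall y e, 0 < y <= k.+1%:R -> 0 < e -> exists n0 : nat, (0 < n0)%N /\
    forall n, (n0 <= n)%N ->
    `|rcoef y n * Gamma y - n%:R `^ (y - 1)| <= e * n%:R `^ (y - 1).
  move=> x0 e0; apply: (main (Num.truncn x)) => //.
  by rewrite x0 ltW// truncnS_gt.
elim: k => [|k IH] {x eps} y e y01 e0.
  exists (Num.truncn e^-1).+1; split=> // n hn.
  have n0 : (0 < n)%N by apply: leq_trans hn.
  have nr : 0 < n%:R :> R by rewrite ltr0n.
  have /andP[h1 h2] := rcoef_asymp_small y01 n0.
  set p := n%:R `^ (y - 1) in h1 h2 *; have p0 : 0 <= p by exact: powR_ge0.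
  rewrite distrC ger0_norm ?subr_ge0//.
  apply: le_trans (_ : p - n%:R / n.+1%:R * p <= _); first by rewrite lerD2l lerN2.
  have -> : p - n%:R / n.+1%:R * p = n.+1%:R^-1 * p.
    by rewrite -natr1; field; rewrite natr1 pnatr_eq0.
  rewrite ler_wpM2r// -[e]invrK lef_pV2 ?posrE ?invr_gt0 ?ltr0n//.
  apply: le_trans (ltW (truncnS_gt _)) _; rewrite ler_nat; exact: leq_trans hn _.
have [yk|yk] := leP y k.+1%:R; first by apply: IH; rewrite ?yk ?andbT//; case/andP: y01.
pose z := y - 1; have yz : y = z + 1 by rewrite subrK.
have z0 : 0 < z by rewrite subr_gt0 (le_lt_trans _ yk)// ler1n.
have zk : 0 < z <= k.+1%:R.
  by rewrite z0 /= lerBlDr natr1; case/andP: y01.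
have e4 : 0 < e / 4 by rewrite divr_gt0.
have [n1 [n10 h1]] := IH z (e / 4) zk e4.
pose n2 := (Num.truncn (z + 2 * z / e)).+1.
exists (n1 + n2)%N; split=> [|n hn]; first by rewrite addnS.
have nn1 : (n1 <= n)%N by apply: leq_trans hn; exact: leq_addr.
have nr : 0 < n%:R :> R by rewrite ltr0n (leq_trans n10).
have nz : z + 2 * z / e <= n%:R.
  apply: le_trans (ltW (truncnS_gt _)) _; rewrite ler_nat; apply: leq_trans hn; exact: leq_addl.
have {}h1 := h1 n nn1.
set r := rcoef z n * Gamma z in h1; set p := n%:R `^ (z - 1) in h1.
have p0 : 0 <= p by exact: powR_ge0.
have -> : rcoef y n * Gamma y = r * (z + n%:R).
  have znp : 0 < z + n%:R by rewrite addr_gt0.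
  rewrite /r yz (rcoef_Gamma _ (addr_gt0 z0 ltr01)) (rcoef_Gamma _ z0).
  by rewrite addrAC (Gamma_rec znp) -mulrA mulrC.
have -> : n%:R `^ (y - 1) = p * n%:R.
  by rewrite -/z /p (powRB1 z nr) divfK// gt_eqF.
have -> : r * (z + n%:R) - p * n%:R = (r - p) * (z + n%:R) + p * z by ring.
apply: le_trans (ler_normD _ _) _.
have zn0 : 0 <= z + n%:R by rewrite addr_ge0// ltW.
rewrite normrM (ger0_norm zn0) (ger0_norm (mulr_ge0 p0 (ltW z0))).
have zn : z + n%:R <= 2 * n%:R.
  have q0 : 0 <= 2 * z / e by exact: divr_ge0 (mulr_ge0 _ (ltW z0)) (ltW e0).
  have : z <= n%:R by apply: le_trans nz; rewrite lerDl.
  by move: (n%:R : R) => w; lra.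
have ze : z <= e / 2 * n%:R.
  have : 2 * z / e <= n%:R by apply: le_trans nz; rewrite lerDr ltW.
  by rewrite ler_pdivrMr// => h; lra.
apply: le_trans (_ : e / 4 * p * (2 * n%:R) + p * (e / 2 * n%:R) <= _).
  apply: lerD; last by rewrite ler_wpM2l.
  by apply: ler_pM.
by rewrite le_eqVlt; apply/orP; left; apply/eqP; field.
Qed.

Lemma rcoef_le x : 0 < x -> exists C : R, 0 < C /\
  forall n, (0 < n)%N -> rcoef x n <= C * n%:R `^ (x - 1).
Proof.
move=> x0; have G0 := Gamma_gt0 x0.
have [n0 [_ h]] := rcoef_asymp x0 ltr01.
pose S : R := \sum_(k < n0) rcoef x k / k%:R `^ (x - 1).
have S0 : 0 <= S by apply: sumr_ge0 => k _; rewrite divr_ge0 ?rcoef_ge0 ?powR_ge0.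
exists (2 / Gamma x + S); split; first by rewrite ltr_wpDr// divr_gt0.
move=> n np; have nr : 0 < n%:R :> R by rewrite ltr0n.
have p0 : 0 < n%:R `^ (x - 1) :> R by rewrite powR_gt0.
have [hn|hn] := leqP n0 n.
  have : rcoef x n * Gamma x <= 2 * n%:R `^ (x - 1).
    by have := h n hn; rewrite ler_norml mul1r => /andP[_]; lra.
  rewrite -ler_pdivlMr// => h1; apply: le_trans h1 _.
  by rewrite mulrAC [leRHS]mulrDl lerDl mulr_ge0// ltW.
rewrite mulrDl ler_wpDl//.
  by apply: mulr_ge0 (ltW p0); apply: divr_ge0 => //; exact: ltW.
rewrite -ler_pdivrMr// /S (bigD1 (Ordinal hn))//= lerDl.
by apply: sumr_ge0 => k _; rewrite divr_ge0 ?rcoef_ge0 ?powR_ge0.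
Qed.

(** All coefficients are nonnegative, so truncation at [N] can only lower those of the power, and it
    does not affect indices below [N]. *)
Lemma coef_rpoly_expr x (N s n : nat) : 0 < x ->
  0 <= ((\poly_(i < N) rcoef x i) ^+ s)`_n <= rcoef (s%:R * x) n /\
  ((n < N)%N -> ((\poly_(i < N) rcoef x i) ^+ s)`_n = rcoef (s%:R * x) n).
Proof.
move=> x0; elim: s n => [|s IH] n.
  rewrite expr0 mul0r coef1.
  have -> : rcoef 0 n = (n == 0%N)%:R.
    case: n => [|n]; first by rewrite rcoef0.
    by rewrite /rcoef big_ord_recl addr0 !mul0r.
  by split=> //; rewrite ler0n lexx.
have -> : s.+1%:R * x = x + s%:R * x by rewrite -natr1 mulrDl mul1r addrC.
rewrite exprS coefM -rcoef_vandermonde.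
have p0 i : 0 <= (\poly_(i < N) rcoef x i)`_i <= rcoef x i.
  by rewrite coef_poly; case: ifP => _; rewrite ?lexx rcoef_ge0.
split=> [|nN].
  apply/andP; split.
    apply: sumr_ge0 => i _; have [/andP[h _] _] := IH (n - i)%N.
    by rewrite mulr_ge0//; case/andP: (p0 i).
  apply: ler_sum => i _; have [/andP[h1 h2] _] := IH (n - i)%N.
  by have /andP[h3 h4] := p0 i; exact: ler_pM.
apply: eq_bigr => i _; have [_ h] := IH (n - i)%N.
rewrite h ?(leq_ltn_trans (leq_subr _ _))// coef_poly ifT//.
by rewrite (leq_ltn_trans _ nN)// -ltnS.
Qed.
End RisingCoefficients.

(** * The model sum near the origin *)

Section Model.
Variable R : realType.
Implicit Types (x y t al theta eps A : R).

Definition cbrt t : R := t `^ (1 / 3).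

Lemma cbrt_ge0 t : 0 <= cbrt t. Proof. exact: powR_ge0. Qed.
Lemma cbrt_gt0 t : 0 < t -> 0 < cbrt t. Proof. exact: powR_gt0. Qed.
Lemma cbrt3 t : 0 <= t -> cbrt t ^+ 3 = t.
Proof.
move=> t0; rewrite -powR_mulrn ?cbrt_ge0// /cbrt -powRrM.
by rewrite (_ : 1 / 3 * 3%:R = 1) ?powRr1//; field.
Qed.
Lemma cbrtM x y : 0 <= x -> 0 <= y -> cbrt (x * y) = cbrt x * cbrt y.
Proof. exact: powRM. Qed.
Lemma le_cbrt x y : 0 <= x -> x <= y -> cbrt x <= cbrt y.
Proof. by move=> x0 xy; apply: ge0_ler_powR => //; rewrite ?nnegrE; lra. Qed.
Lemma cbrt_X3 t : 0 <= t -> cbrt (t ^+ 3) = t.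
Proof.
move=> t0; apply: (@pexpIrn _ 3) => //; rewrite ?nnegrE ?cbrt_ge0//.
by rewrite cbrt3// exprn_ge0.
Qed.
Lemma cbrtV t : 0 < t -> cbrt t^-1 = (cbrt t)^-1.
Proof.
move=> t0; have c0 : cbrt t != 0 by rewrite gt_eqF// cbrt_gt0.
apply: (mulfI c0); rewrite -cbrtM ?invr_ge0 ?(ltW t0)// divff ?gt_eqF// divff//.
by rewrite /cbrt powR1.
Qed.
Lemma cbrt_div x y : 0 <= x -> 0 < y -> cbrt (x / y) = cbrt x / cbrt y.
Proof. by move=> x0 y0; rewrite cbrtM ?invr_ge0 ?(ltW y0)// cbrtV. Qed.

(* [kappa M * rcoef (1 / 3) n] is asymptotically the increment of t |-> t^(1/3)
   between n/M and (n+1)/M, so [modelsum] imitates [cubesum] near 0. *)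
Definition kappa (M : nat) : R := Gamma (4 / 3) / cbrt M%:R.

Definition modelsum (M P : nat) al : R[i] := (kappa M)%:C%C *
  \sum_(n < (M * P ^ 3).+1) (rcoef (1 / 3) n)%:C%C * expi (al / M%:R) ^+ n.

Lemma kappa_gt0 M : (0 < M)%N -> 0 < kappa M.
Proof. by move=> M0; rewrite divr_gt0 ?Gamma_gt0 ?cbrt_gt0 ?ltr0n. Qed.

Lemma third01 : ((0 : R) < 1 / 3) && ((1 / 3 : R) <= 1).
Proof. by apply/andP; split; lra. Qed.

Lemma sum_rcoef13 n : \sum_(i < n.+1) rcoef (1 / 3) i = rcoef (4 / 3) n :> R.
Proof. by rewrite sum_rcoef; congr rcoef; field. Qed.

Lemma kappa_rcoef_le : exists C : R, 0 < C /\ forall M n : nat, (0 < M)%N -> (0 < n)%N ->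
  kappa M * rcoef (4 / 3) n <= C * cbrt (n%:R / M%:R).
Proof.
have h43 : 0 < 4 / 3 :> R by lra.
have [C [C0 hC]] := rcoef_le h43; have G0 := Gamma_gt0 h43.
exists (Gamma (4 / 3) * C); split=> [|M n M0 n0]; first exact: mulr_gt0.
have Mr : 0 < M%:R :> R by rewrite ltr0n.
have {hC} := hC n n0; rewrite (_ : 4 / 3 - 1 = 1 / 3); last by field.
move=> /(ler_wpM2l (ltW (kappa_gt0 M0))); move/le_trans; apply.
rewrite cbrt_div// le_eqVlt; apply/orP; left; apply/eqP; rewrite /kappa /cbrt.
by field; rewrite gt_eqF// powR_gt0.
Qed.

Lemma abel_le (d : nat -> R) (z : R[i]) (N : nat) (E : R) : cnorm z = 1 ->
  (forall n, (n <= N)%N -> `|\sum_(m < n) d m| <= E) ->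
  cnorm (\sum_(n < N) (d n)%:C%C * z ^+ n) <= E * (1 + N%:R * cnorm (z - 1)).
Proof.
move=> z1 hE; pose D n : R := \sum_(m < n) d m.
have E0 : 0 <= E by apply: le_trans (hE 0%N _).
have e : \sum_(n < N) (d n)%:C%C * z ^+ n =
    (D N)%:C%C * z ^+ N - \sum_(n < N) (D n.+1)%:C%C * (z ^+ n * (z - 1)).
  elim: N {hE} => [|N IH]; first by rewrite !big_ord0 /D big_ord0 mul0r subr0.
  have DS : D N.+1 = D N + d N by rewrite /D big_ord_recr.
  by rewrite !big_ord_recr /= IH DS rmorphD /= exprS; ring.
rewrite e; apply: le_trans (ler_cnormB _ _) _; rewrite mulrDr mulr1; apply: lerD.
  by rewrite cnormM cnorm_real cnormX z1 expr1n mulr1 hE.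
apply: le_trans (ler_cnorm_sum _ _ _) _.
rewrite mulrCA -sumr_ord_const; apply: ler_sum => n _.
by rewrite !cnormM cnorm_real cnormX z1 expr1n mul1r ler_wpM2r ?cnorm_ge0// hE.
Qed.

(** Multiplication by [1 - z] leaves the differences of the decreasing [a], whose total variation
    telescopes; carrying the end term [a k * z ^+ k] in [key] makes the induction close. *)
Lemma monotone_tail_le (a : nat -> R) (z : R[i]) (k : nat) : cnorm z = 1 ->
  (forall n, 0 <= a n) -> (forall n, a n.+1 <= a n) ->
  cnorm (z - 1) * cnorm (\sum_(n < k) (a n)%:C%C * z ^+ n) <= 2 * a 0%N.
Proof.
move=> z1 a0 amono; rewrite cnormB -cnormM.
have key : cnorm ((1 - z) * (\sum_(n < k) (a n)%:C%C * z ^+ n) + (a k)%:C%C * z ^+ k)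
    <= 2 * a 0%N - a k.
  elim: k => [|k IH].
    rewrite big_ord0 mulr0 add0r expr0 mulr1 cnorm_real ger0_norm//; lra.
  rewrite big_ord_recr /=; set S := \sum_(_ < _) _ in IH *.
  have -> : (1 - z) * (S + (a k)%:C%C * z ^+ k) + (a k.+1)%:C%C * z ^+ k.+1 =
     ((1 - z) * S + (a k)%:C%C * z ^+ k) + (a k.+1 - a k)%:C%C * z ^+ k.+1.
    by rewrite rmorphB /= exprS; ring.
  apply: le_trans (ler_cnormD _ _) _.
  rewrite [X in _ + X]cnormM cnorm_real cnormX z1 expr1n mulr1 ler0_norm ?subr_le0//.
  by apply: le_trans (lerD IH (lexx _)) _; lra.
set X := (1 - z) * _ in key *; rewrite -[X](addrK ((a k)%:C%C * z ^+ k)).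
apply: le_trans (ler_cnormB _ _) _.
by rewrite [X in _ + X]cnormM cnorm_real cnormX z1 expr1n mulr1 ger0_norm//; lra.
Qed.

Lemma modelsum_le : exists C : R, 0 < C /\ forall (M P : nat) al, (0 < M)%N -> (0 < P)%N ->
  cnorm (modelsum M P al) <= C * P%:R.
Proof.
have [C [C0 hC]] := kappa_rcoef_le; exists C; split=> // M P al M0 P0.
have Mr : 0 < M%:R :> R by rewrite ltr0n.
have k0 := kappa_gt0 M0.
rewrite /modelsum cnormM cnorm_real gtr0_norm//.
have -> : P%:R = cbrt ((M * P ^ 3)%:R / M%:R) :> R.
  by rewrite natrM [M%:R * _]mulrC mulfK ?gt_eqF// natrX cbrt_X3.
apply: le_trans (hC M (M * P ^ 3)%N M0 _); last by rewrite muln_gt0 M0 expn_gt0 P0.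
rewrite ler_pM2l// -sum_rcoef13; apply: le_trans (ler_cnorm_sum _ _ _) _.
apply: ler_sum => n _; rewrite cnormM cnorm_real cnormX cnorm_expi expr1n mulr1.
by rewrite ger0_norm// rcoef_ge0//; lra.
Qed.

(** The decay [al^(-1/3)] comes from cutting the sum at [1 / u]: the trivial bound below,
    cancellation with decreasing coefficients above. The two match because [rcoef (1 / 3) n] has
    size [n^(-2/3)]. Beyond half a period [M / 2] the model grows again. *)
Lemma modelsum_decay : exists C : R, 0 < C /\ forall (M P : nat) al, (0 < M)%N ->
  0 < al -> al <= M%:R / 2 -> cnorm (modelsum M P al) ^+ 3 * al <= C.
Proof.
have [C [C0 hC]] := kappa_rcoef_le.
exists ((2 * C) ^+ 3); split=> [|M P al M0 al0 alM]; first by rewrite exprn_gt0// mulr_gt0.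
have Mr : 0 < M%:R :> R by rewrite ltr0n.
have k0 := kappa_gt0 M0.
set u := al / M%:R; have u0 : 0 < u by rewrite divr_gt0.
have u2 : u <= 1 / 2 by rewrite ler_pdivrMr//; lra.
set c := rcoef (1 / 3) : nat -> R; set z := expi u; set N := (M * P ^ 3).+1.
have z1 : cnorm z = 1 by exact: cnorm_expi.
have c0 n : 0 <= c n by apply: rcoef_ge0; lra.
have ui : 2 <= u^-1 by rewrite -[2]invrK lef_pV2 ?posrE; lra.
pose m := (Num.truncn u^-1).-1.
have mE : m.+1 = Num.truncn u^-1.
  by rewrite prednK// truncn_ge_nat ?(le_trans _ ui)//; lra.
have /andP[m1 m2] : m.+1%:R <= u^-1 < m.+2%:R.
  by rewrite mE truncn_itv// (le_trans _ ui).
set S := rcoef (4 / 3) m : R.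
have S0 : 0 <= S by apply: rcoef_ge0; lra.
have head (k : nat) : (k <= m.+1)%N -> cnorm (\sum_(n < k) (c n)%:C%C * z ^+ n) <= S.
  move=> km; apply: le_trans (ler_cnorm_sum _ _ _) _.
  rewrite /S -sum_rcoef13.
  apply: le_trans (_ : \sum_(n < k) c n <= _).
    by apply: ler_sum => n _; rewrite cnormM cnorm_real cnormX z1 expr1n mulr1 ger0_norm.
  rewrite (big_ord_widen _ c km) [leRHS](bigID (fun n : 'I_m.+1 => (n < k)%N)) /= lerDl.
  by apply: sumr_ge0.
have cm : m.+1%:R * c m.+1 <= S.
  rewrite /S -sum_rcoef13 -sumr_ord_const; apply: ler_sum => n _.
  by apply: rcoef_nonincr third01 _; exact: ltnW.
have main : cnorm (\sum_(n < N) (c n)%:C%C * z ^+ n) <= 2 * S.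
  have [Nm|Nm] := leqP N m.+1; first by apply: le_trans (head _ Nm) _; lra.
  have -> : \sum_(n < N) (c n)%:C%C * z ^+ n = \sum_(n < m.+1) (c n)%:C%C * z ^+ n +
     z ^+ m.+1 * \sum_(n < N - m.+1) (c (m.+1 + n)%N)%:C%C * z ^+ n.
    rewrite -(big_mkord xpredT (fun n => (c n)%:C%C * z ^+ n)) -[in LHS](subnKC (ltnW Nm)).
    rewrite big_mkord big_split_ord /=; congr (_ + _).
    by rewrite mulr_sumr; apply: eq_bigr => n _; rewrite exprD; ring.
  apply: le_trans (ler_cnormD _ _) _; rewrite mulr_natl mulr2n; apply: lerD; first exact: head.
  rewrite cnormM cnormX z1 expr1n mul1r; set X := cnorm _.
  have amono n : c (m.+1 + n.+1)%N <= c (m.+1 + n)%N.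
    by apply: rcoef_nonincr third01 _; rewrite addnS.
  have := @monotone_tail_le (fun n => c (m.+1 + n)%N) z (N - m.+1) z1 (fun n => c0 _) amono.
  rewrite addn0 -/X; have X0 : 0 <= X by exact: cnorm_ge0.
  have z4 : 4 * u <= cnorm (z - 1).
    by have := @cnorm_expi_sub1_ge R u; rewrite gtr0_norm//; apply.
  move: (c0 m.+1) cm; set cc := c m.+1 => cc0 cm h.
  have um : 1 <= 2 * (m.+1%:R * u).
    have : 1 < m.+2%:R * u by rewrite -ltr_pdivrMr// div1r.
    rewrite -[m.+2%:R]natr1 mulrDl mul1r => h1.
    have : 1 * u <= m.+1%:R * u by rewrite ler_pM2r// ler1n.
    by lra.
  have h2 : 4 * u * X <= 2 * cc by apply: le_trans h; rewrite ler_wpM2r.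
  have h3 : m.+1%:R * (4 * u * X) <= m.+1%:R * (2 * cc) by rewrite ler_wpM2l.
  have h4 : 1 * X <= 2 * (m.+1%:R * u) * X by rewrite ler_wpM2r.
  by move: h3 h4 cm; move: (m.+1%:R : R) => w h3 h4 cm; nra.
have : cnorm (modelsum M P al) <= 2 * C * cbrt al^-1.
  rewrite /modelsum cnormM cnorm_real gtr0_norm//.
  apply: le_trans (ler_wpM2l (ltW k0) main) _.
  have hS : S <= rcoef (4 / 3) m.+1 by apply: rcoef_nondecr => //; lra.
  rewrite mulrCA -mulrA ler_pM2l//.
  apply: le_trans (ler_wpM2l (ltW k0) hS) _; apply: le_trans (hC M m.+1 M0 _) _ => //.
  rewrite ler_pM2l//; apply: le_cbrt; first by rewrite divr_ge0.
  rewrite ler_pdivrMr//; apply: le_trans m1 _.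
  by rewrite /u invf_div mulrC.
move=> h; rewrite -ler_pdivlMr//.
have c30 : 0 <= 2 * C * cbrt al^-1 by rewrite !mulr_ge0 ?cbrt_ge0// ltW.
apply: le_trans (_ : (2 * C * cbrt al^-1) ^+ 3 <= _).
  by rewrite lerXn2r ?nnegrE ?cnorm_ge0.
by rewrite exprMn cbrt3// invr_ge0 ltW.
Qed.

Lemma count_shift_le (P : nat) theta y : 0 <= theta <= 1 -> 0 <= y <= P%:R + 1 ->
  `|(\sum_(k < P | theta + k%:R < y) 1 : R) - y| <= 2.
Proof.
move=> /andP[t0 t1] /andP[y0 yP].
have key : let S : R := \sum_(k < P | theta + k%:R < y) 1 in
    [/\ S <= P%:R, S <= y + 1 & (P%:R <= S \/ y - theta <= S)].
  elim: P {yP} => [|P [h1 h2 h3]] /=.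
    by rewrite big_ord0; split=> //; [rewrite addr_ge0 | left].
  rewrite big_mkcond big_ord_recr -big_mkcond /=.
  set S := \sum_(k < P | _) _ in h1 h2 h3 *; rewrite -natr1.
  case: ifPn => [h|]; last first.
    rewrite -leNgt addr0 => h; split=> //; first lra.
    by case: h3 => h3; [right; lra | right].
  have SP : S = P%:R by apply/eqP; rewrite eq_le h1 /=; case: h3 => //; lra.
  by rewrite SP; split; [ | lra | left].
case: key => h1 h2 h3; rewrite ler_norml; apply/andP; split; last lra.
by case: h3; lra.
Qed.

Lemma cbrt1 : cbrt 1 = 1. Proof. by rewrite /cbrt powR1. Qed.

Lemma cbrtD_le x y : 0 <= x -> 0 <= y -> cbrt (x + y) <= cbrt x + cbrt y.
Proof.
move=> x0 y0; have a0 := cbrt_ge0 x; have b0 := cbrt_ge0 y.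
rewrite -(@ler_pXn2r _ 3) ?nnegrE ?cbrt_ge0 ?addr_ge0//.
rewrite cbrt3 ?addr_ge0// -{1}(cbrt3 x0) -{1}(cbrt3 y0) -subr_ge0.
have -> : (cbrt x + cbrt y) ^+ 3 - (cbrt x ^+ 3 + cbrt y ^+ 3) =
  3 * (cbrt x * cbrt y * (cbrt x + cbrt y)) by ring.
by rewrite !mulr_ge0 ?addr_ge0.
Qed.

(** Both sides become Fourier sums of measures on multiples of [1 / M]: rounding the cubes down to
    such multiples costs at most [8 * A] in total, after which the distribution functions differ by
    at most [3 + K + e1 * P]. Partial summation concludes, because [al * P^3] is bounded. *)
Lemma modelsum_near eps A (M : nat) : 0 < eps -> 0 < A -> (0 < M)%N ->
  exists P0 : nat, forall (P : nat) al theta, (P0 <= P)%N -> 0 <= theta <= 1 ->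
    0 <= al -> al * P%:R ^+ 3 <= A ->
    cnorm (cubesum theta P al - modelsum M P al) <= eps * P%:R.
Proof.
move=> eps0 A0 M0; have Mr : 0 < M%:R :> R by rewrite ltr0n.
have M1 : 1 <= M%:R :> R by rewrite ler1n.
have k0 := kappa_gt0 M0; have h43 : 0 < 4 / 3 :> R by lra.
(* Bounds [1 + N * cnorm (z - 1)], the loss in [abel_le]. *)
pose W := 1 + 16 * A; have W0 : 0 < W by rewrite /W; lra.
pose e1 := eps / 2 / W; have e10 : 0 < e1 by rewrite !divr_gt0.
have [n0 [n00 hn0]] := rcoef_asymp h43 e10.
(* Covers the small indices, where the asymptotic formula is not yet available. *)
pose K := kappa M * rcoef (4 / 3) n0 + cbrt n0%:R.
have r0 n : 0 <= rcoef (4 / 3) n :> R by apply: rcoef_ge0; lra.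
have K0 : 0 <= K by rewrite addr_ge0 ?cbrt_ge0// mulr_ge0// ltW.
pose P0 := (Num.truncn (((3 + K) * W + 8 * A) / (eps / 2))).+1.
exists P0 => P al theta PP0 th al0 alP; have /andP[t0 t1] := th.
have Pbig : (3 + K) * W + 8 * A <= eps / 2 * P%:R.
  rewrite [eps / 2 * _]mulrC -ler_pdivrMr ?divr_gt0//.
  by apply: le_trans (ltW (truncnS_gt _)) _; rewrite ler_nat.
have P1 : 1 <= P%:R :> R by rewrite ler1n (leq_trans _ PP0).
set z := expi (al / M%:R); have z1 : cnorm z = 1 by exact: cnorm_expi.
set N := (M * P ^ 3).+1.
pose idx k := Num.truncn (M%:R * (theta + k%:R) ^+ 3).
have X0 (k : nat) : 0 <= M%:R * (theta + k%:R) ^+ 3.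
  by rewrite mulr_ge0// exprn_ge0// addr_ge0.
have idxN (k : 'I_P) : (idx k < N)%N.
  rewrite /idx -(ltr_nat R); apply: le_lt_trans (_ : M%:R * P%:R ^+ 3 < _); last first.
    by rewrite /N -natrX -natrM ltr_nat.
  have /andP[h _] := truncn_itv (X0 k); apply: le_trans h _.
  rewrite ler_pM2l// lerXn2r ?nnegrE ?addr_ge0//.
  by have : k.+1%:R <= P%:R :> R; [rewrite ler_nat | rewrite -natr1; lra].
pose r n : R := \sum_(k < P | idx k == n) 1.
have rE : \sum_(n < N) (r n)%:C%C * z ^+ n = \sum_(k < P) z ^+ idx k.
  under eq_bigr => n _.
    rewrite /r big_mkcond rmorph_sum mulr_suml /=; over.
  rewrite exchange_big /=; apply: eq_bigr => k _.
  rewrite (bigD1 (Ordinal (idxN k))) //= eqxx mul1r big1 ?addr0// => n nk.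
  case: ifPn => // /eqP h; last by rewrite mul0r.
  by move: nk; rewrite -val_eqE /= h eqxx.
have step1 : cnorm (cubesum theta P al - \sum_(k < P) z ^+ idx k) <= 8 * A.
  rewrite /cubesum -sumrB; apply: le_trans (ler_cnorm_sum _ _ _) _.
  apply: le_trans (_ : \sum_(k < P) 8 * al <= _).
    apply: ler_sum => k _; rewrite -expiM_nat.
    apply: le_trans (cnorm_expiB_le _ _) _; rewrite ler_pM2l//.
    have -> : al * (theta + k%:R) ^+ 3 - (idx k)%:R * (al / M%:R) =
      al * ((M%:R * (theta + k%:R) ^+ 3 - (idx k)%:R) / M%:R) by field; rewrite gt_eqF.
    rewrite normrM (ger0_norm al0) ler_piMr//.
    have /andP[h1 h2] := truncn_itv (X0 k); rewrite -/(idx k) -natr1 in h1 h2.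
    rewrite ger0_norm; last by rewrite divr_ge0 ?subr_ge0// ltW.
    by rewrite ler_pdivrMr// mul1r; lra.
  rewrite sumr_ord_const mulrCA ler_pM2l// mulrC; apply: le_trans alP.
  by rewrite ler_wpM2l// -[leLHS]expr1 ler_weXn2l.
pose d n := r n - kappa M * rcoef (1 / 3) n.
have step2 : \sum_(k < P) z ^+ idx k - modelsum M P al = \sum_(n < N) (d n)%:C%C * z ^+ n.
  rewrite -rE /modelsum mulr_sumr -sumrB; apply: eq_bigr => n _.
  have -> : (d n)%:C%C = (r n)%:C%C - (kappa M)%:C%C * (rcoef (1 / 3) n)%:C%C.
    by rewrite -rmorphM -rmorphB.
  by rewrite mulrBl !mulrA.
(* Of the constant 3, two units come from [count_shift_le] and one from passing between [n] and
   [n.+1] under the cube root. *)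
have dE n : (n <= N)%N -> `|\sum_(m < n) d m| <= 3 + K + e1 * P%:R.
  move=> nN; rewrite sumrB -mulr_sumr.
  have -> : \sum_(m < n) r m = \sum_(k < P | theta + k%:R < cbrt (n%:R / M%:R)) 1.
    rewrite /r; under eq_bigr do rewrite big_mkcond.
    rewrite exchange_big /= [RHS]big_mkcond; apply: eq_bigr => k _.
    have -> : (theta + k%:R < cbrt (n%:R / M%:R)) = (idx k < n)%N.
      rewrite /idx truncn_lt_nat// -(@ltr_pXn2r _ 3) ?nnegrE ?cbrt_ge0 ?addr_ge0//.
      by rewrite cbrt3 ?divr_ge0// ltr_pdivlMr// mulrC.
    case: ltnP => h.
      rewrite (bigD1 (Ordinal h)) //= eqxx big1 ?addr0// => m mk.
      by case: ifPn => // /eqP h'; move: mk; rewrite -val_eqE /= h' eqxx.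
    rewrite big1// => m _; case: ifPn => // /eqP h'.
    by move: h; rewrite h' leqNgt ltn_ord.
  set y := cbrt _; have y0 : 0 <= y by exact: cbrt_ge0.
  have yP : y <= P%:R + 1.
    apply: le_trans (_ : cbrt (P%:R ^+ 3 + 1) <= _).
      apply: le_cbrt; first by rewrite divr_ge0.
      rewrite ler_pdivrMr//; apply: le_trans (_ : N%:R <= _); first by rewrite ler_nat.
      by rewrite /N -natr1 natrM natrX mulrDl mul1r mulrC lerD2l.
    apply: le_trans (cbrtD_le _ _) _ => //.
    by rewrite cbrt_X3// lerD2l /cbrt powR1.
  have := @count_shift_le P theta y th; rewrite y0 yP => /(_ isT).
  set S := \sum_(k < P | _) _ => hS.
  case: n nN @y y0 yP @S hS => [|n] nN y y0 yP S hS.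
    rewrite big_ord0 mulr0 subr0; move: hS.
    rewrite /y mul0r /cbrt powR0; last by lra.
    rewrite subr0; move/le_trans; apply; have : 0 <= e1 * P%:R by rewrite mulr_ge0// ltW.
    by lra.
  rewrite sum_rcoef13; set s := kappa M * _.
  have eP0 : 0 <= e1 * P%:R by rewrite mulr_ge0// ltW.
  have [nn0|nn0] := leqP n0 n; last first.
    have h1 : s <= kappa M * rcoef (4 / 3) n0.
      by rewrite ler_pM2l//; apply: rcoef_nondecr (ltnW nn0); lra.
    have h2 : y <= cbrt n0%:R.
      apply: le_cbrt; first by rewrite divr_ge0.
      rewrite ler_pdivrMr//; apply: le_trans (_ : n0%:R <= _); first by rewrite ler_nat.
      by rewrite ler_peMr.
    have s0 : 0 <= s by rewrite mulr_ge0// ltW.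
    move: hS; rewrite !ler_norml /K => /andP[h3 h4].
    by move: h1 h2 h3 h4 s0 y0 eP0; clear; move=> *; apply/andP; split; lra.
  have {hn0} := hn0 n nn0; rewrite (_ : 4 / 3 - 1 = 1 / 3); last by field.
  rewrite -/(cbrt _) => h; set y' := cbrt (n%:R / M%:R).
  have y'0 : 0 <= y' by exact: cbrt_ge0.
  have y'P : y' <= P%:R.
    rewrite -[leRHS]cbrt_X3//; apply: le_cbrt; first by rewrite divr_ge0.
    by rewrite ler_pdivrMr// -natrX -natrM ler_nat mulnC -ltnS.
  have cM : 0 < cbrt M%:R by rewrite cbrt_gt0.
  have h1 : `|s - y'| <= e1 * P%:R.
    apply: le_trans (_ : e1 * y' <= _); last by rewrite ler_pM2l.
    rewrite /y' cbrt_div// /s /kappa.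
    have -> : Gamma (4 / 3) / cbrt M%:R * rcoef (4 / 3) n - cbrt n%:R / cbrt M%:R =
      (rcoef (4 / 3) n * Gamma (4 / 3) - cbrt n%:R) / cbrt M%:R by ring.
    by rewrite normrM (@gtr0_norm _ (cbrt M%:R)^-1) ?invr_gt0// mulrA ler_pM2r ?invr_gt0.
  have h2 : y <= y' + 1.
    rewrite /y -natr1 mulrDl; apply: le_trans (cbrtD_le _ _) _; rewrite ?divr_ge0//.
    have h2 : 1 / M%:R <= 1 :> R by rewrite ler_pdivrMr// mul1r.
    by rewrite lerD2l; apply: le_trans (le_cbrt _ h2) _; rewrite ?divr_ge0// cbrt1.
  have h3 : y' <= y.
    apply: le_cbrt; first by rewrite divr_ge0.
    by rewrite ler_pM2r ?invr_gt0// ler_nat.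
  move: hS h1; rewrite !ler_norml => /andP[a1 a2] /andP[b1 b2].
  by move: a1 a2 b1 b2 h2 h3 K0; clear; move=> *; apply/andP; split; lra.
have step3 : cnorm (\sum_(k < P) z ^+ idx k - modelsum M P al) <= (3 + K + e1 * P%:R) * W.
  rewrite step2; apply: le_trans (abel_le z1 dE) _.
  apply: ler_wpM2l.
    have : 0 <= e1 * P%:R by rewrite mulr_ge0// ltW.
    by lra.
  rewrite /W lerD2l.
  apply: le_trans (_ : N%:R * (8 * `|al / M%:R|) <= _).
    by rewrite ler_wpM2l// cnorm_expi_sub1_le.
  rewrite ger0_norm; last by rewrite divr_ge0// ltW.
  have NM : N%:R <= 2 * (M%:R * P%:R ^+ 3) :> R.
    rewrite /N -natr1 natrM natrX.
    have : 1 <= M%:R * P%:R ^+ 3 :> R by rewrite mulr_ege1// exprn_ege1.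
    by lra.
  apply: le_trans (_ : 2 * (M%:R * P%:R ^+ 3) * (8 * (al / M%:R)) <= _).
    by rewrite ler_wpM2r// mulr_ge0// divr_ge0// ltW.
  have -> : 2 * (M%:R * P%:R ^+ 3) * (8 * (al / M%:R)) = 16 * (al * P%:R ^+ 3).
    by field; rewrite gt_eqF.
  by rewrite ler_pM2l.
have -> : cubesum theta P al - modelsum M P al =
    (cubesum theta P al - \sum_(k < P) z ^+ idx k) +
    (\sum_(k < P) z ^+ idx k - modelsum M P al) by rewrite addrA subrK.
apply: le_trans (ler_cnormD _ _) _; apply: le_trans (lerD step1 step3) _.
have e1W : e1 * W = eps / 2 by rewrite /e1 divfK// gt_eqF.
have -> : (3 + K + e1 * P%:R) * W = (3 + K) * W + e1 * W * P%:R by ring.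
by rewrite e1W; lra.
Qed.
End Model.

(** * Mean distance between the product and the model *)

Section CircleL1.
Variable R : realType.
Implicit Types (x y al theta eps A : R).

Lemma ler_sum_sub (n : nat) (P Q : pred 'I_n) (F G : 'I_n -> R) :
  (forall k, Q k -> 0 <= G k) -> (forall k, P k -> Q k) ->
  (forall k, P k -> F k <= G k) -> \sum_(k < n | P k) F k <= \sum_(k < n | Q k) G k.
Proof.
move=> G0 PQ FG; apply: le_trans (ler_sum _ FG) _.
rewrite big_mkcond [leRHS]big_mkcond; apply: ler_sum => k _.
by case: ifPn => [/PQ ->//|_]; case: ifPn => // /G0.
Qed.

(** Factors are exchanged one at a time; the factor [K] on the left avoids the exponent [n - 1] on
    the right. *)
Lemma cnorm_prod_sub_le (n : nat) (a : 'I_n -> R[i]) (b : R[i]) (K E : R) :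
  0 <= E -> cnorm b <= K -> (forall i, cnorm (a i) <= K) ->
  (forall i, cnorm (a i - b) <= E) ->
  cnorm (\prod_(i < n) a i - b ^+ n) * K <= n%:R * K ^+ n * E.
Proof.
move=> E0 bK; have K0 : 0 <= K by apply: le_trans (cnorm_ge0 _) bK.
elim: n a => [|n IH] a aK aE; first by rewrite big_ord0 expr0 subrr cnorm0 !mul0r.
rewrite big_ord_recr /= exprSr.
set p := \prod_(i < n) _; set x := a ord_max.
have -> : p * x - b ^+ n * b = (p - b ^+ n) * x + b ^+ n * (x - b) by ring.
have {IH} := IH (fun i => a (widen_ord (leqnSn n) i)) (fun i => aK _) (fun i => aE _).
rewrite -/p; set u := cnorm (p - b ^+ n) => h.
have u0 : 0 <= u by exact: cnorm_ge0.
apply: le_trans (ler_wpM2r K0 (ler_cnormD _ _)) _; rewrite !cnormM cnormX -/u.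
have h1 : u * cnorm x * K <= n%:R * K ^+ n * E * K.
  rewrite mulrAC; apply: ler_pM => //; rewrite ?mulr_ge0 ?cnorm_ge0//; exact: aK.
have h2 : cnorm b ^+ n * cnorm (x - b) * K <= K ^+ n * E * K.
  apply: ler_wpM2r => //; apply: ler_pM; rewrite ?exprn_ge0 ?cnorm_ge0//; last exact: aE.
  by rewrite lerXn2r ?nnegrE ?cnorm_ge0.
rewrite mulrDl; apply: le_trans (lerD h1 h2) _.
by rewrite -[n.+1%:R]natr1 exprSr le_eqVlt; apply/orP; left; apply/eqP; ring.
Qed.

(** Stands in for Hoelder's inequality: the product is at most the [n]-th power of its largest
    factor. *)
Lemma prod_le_sum_exp (n : nat) (x : 'I_n -> R) (i0 : 'I_n) : (forall i, 0 <= x i) ->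
  \prod_(i < n) x i <= \sum_(i < n) x i ^+ n.
Proof.
move=> x0; have [j _ hj] := @arg_maxP _ _ _ i0 xpredT x isT.
apply: le_trans (_ : \prod_(i < n) x j <= _).
  by apply: ler_prod => i _; rewrite x0 /=; exact: hj.
rewrite prodr_const card_ord (bigD1 j)//= lerDl sumr_ge0// => i _.
by rewrite exprn_ge0.
Qed.

(** There are boundedly many arcs, since [q] and [a] are bounded, each of length [<< 1 / P^3]. *)
Lemma near_frac_count (B T : nat) : exists C : R, 0 <= C /\ forall P L : nat,
  (0 < P)%N -> (P ^ 3 <= L)%N ->
  \sum_(k < T * L | `[< near_frac B P (k%:R / L%:R : R) >]) (1 : R) <= C * (L%:R / P%:R ^+ 3).
Proof.
pose D := (B * (6 * T + B)).+1.
exists ((B.+1)%:R * (D%:R * (2 * (B%:R / 6) + 1))); split.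
  by rewrite !mulr_ge0// addr_ge0// mulr_ge0// divr_ge0.
move=> P L P0 PL; have Pr : 0 < P%:R ^+ 3 :> R by rewrite exprn_gt0// ltr0n.
have P1 : 1 <= P%:R ^+ 3 :> R by rewrite exprn_ege1// ler1n.
have L0 : 0 < L%:R :> R by rewrite ltr0n (leq_trans _ PL)// expn_gt0 P0.
set V := L%:R / P%:R ^+ 3; have V1 : 1 <= V.
  by rewrite ler_pdivlMr// mul1r -natrX ler_nat.
pose c (q a : nat) : R := a%:R * L%:R / (6 * q%:R).
apply: le_trans (_ : \sum_(k < T * L) \sum_(q < B.+1) \sum_(a < D)
    (if `|k%:R - c q a| <= B%:R / 6 * V then 1 else 0 : R) <= _).
  rewrite big_mkcond; apply: ler_sum => k _; case: asboolP => [[q [a [q0 qB cop h]]]|_].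
    have qr : 0 < q%:R :> R by rewrite ltr0n.
    have aD : (a < D)%N.
      rewrite ltnS -(ler_nat R) natrM natrD natrM.
      have kT : k%:R / L%:R <= T%:R :> R.
        by rewrite ler_pdivrMr// -natrM ler_nat ltnW.
      have h1 : `|6 * (k%:R / L%:R) - a%:R / q%:R| <= B%:R :> R.
        apply: le_trans h; rewrite ler_peMl//.
      have h2 : a%:R / q%:R <= 6 * T%:R + B%:R :> R.
        by move: h1; rewrite ler_norml => /andP[h1 _]; lra.
      rewrite ler_pdivrMr// mulrC in h2.
      by apply: le_trans h2 _; rewrite ler_wpM2r ?addr_ge0 ?mulr_ge0// ler_nat.
    rewrite (bigD1 (Ordinal (qB : (q < B.+1)%N)))//= (bigD1 (Ordinal aD))//=.
    have -> : `|k%:R - c q a| <= B%:R / 6 * V.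
      have -> : k%:R - c q a = (L%:R / 6) * (6 * (k%:R / L%:R) - a%:R / q%:R).
        by rewrite /c; field; rewrite !gt_eqF.
      rewrite normrM gtr0_norm ?divr_gt0//.
      have -> : B%:R / 6 * V = (L%:R / 6) * (B%:R / P%:R ^+ 3) by rewrite /V; ring.
      by rewrite ler_pM2l ?divr_gt0// ler_pdivlMr// mulrC.
    rewrite -addrA lerDl addr_ge0// ?sumr_ge0// => [i _|i _]; first by case: ifP.
    by apply: sumr_ge0 => j _; case: ifP.
  by apply: sumr_ge0 => i _; apply: sumr_ge0 => j _; case: ifP.
rewrite exchange_big /= -[leRHS]mulrA -(sumr_ord_const B.+1); apply: ler_sum => q _.
rewrite exchange_big /= -[leRHS]mulrA -(sumr_ord_const D); apply: ler_sum => a _.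
rewrite -big_mkcond /=; apply: le_trans (@count_near_le R _ _ _ _) _.
  by rewrite mulr_ge0 ?divr_ge0// (le_trans _ V1).
have -> : (2 * (B%:R / 6) + 1) * V = 2 * (B%:R / 6 * V) + V by ring.
by rewrite lerD2l.
Qed.

(** Off the central range the product and the model are small separately, so only there are they
    compared. The parameters form a chain: [B] comes from the minor arcs, [e3] from the number of
    grid points on the major arcs, the width [A] of the centre from [B] and the tail of the model,
    and the accuracy [e1] from [A]. *)
Lemma circle_L1 (s : nat) (theta : 'I_s -> R) (i0 : 'I_s) (T M : nat) eps :
  (11 <= s)%N -> (forall i, 0 <= theta i <= 1) ->
  (forall n, (0 < n)%N -> rho (n%:R * theta i0) != 0) ->
  0 < eps -> (0 < T)%N -> (2 * T <= M)%N ->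
  exists P0 : nat, forall P L : nat, (P0 <= P)%N -> (6 * P ^ 3 <= L)%N ->
    \sum_(k < T * L) cnorm (\prod_(i < s) cubesum (theta i) P (k%:R / L%:R) -
       modelsum M P (k%:R / L%:R) ^+ s) <= eps * L%:R * P%:R ^+ (s - 3).
Proof.
move=> s11 th irr eps0 T0 TM.
have M0 : (0 < M)%N by apply: leq_trans TM; rewrite muln_gt0.
have s0 : 0 < s%:R :> R by rewrite ltr0n (leq_trans _ s11).
have [C1 [C10 hC1]] := @modelsum_le R; have [C2 [C20 hC2]] := @modelsum_decay R.
pose e4 := eps / 4; have e40 : 0 < e4 by rewrite divr_gt0.
pose e2 := e4 / s%:R; have e20 : 0 < e2 by rewrite divr_gt0.
have [B [P2 [B0 P20 hmin]]] := minor_arcs T e20.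
have [CB [CB0 hCB]] := near_frac_count B T.
pose e3 := e4 / (CB + 1); have CB1 : 0 < CB + 1 by lra.
have e30 : 0 < e3 by rewrite divr_gt0.
have [P3 hirr] := @near_frac_small R (theta i0) B T e3 (th i0) e30 irr.
pose K2 := C1 ^+ (s - 6) * C2 ^+ 2; have K20 : 0 < K2 by rewrite mulr_gt0 ?exprn_gt0.
(* At least [B], so that [near_frac_small] applies outside the centre; the last term makes the tail
   [4 * K2 / A] of the model at most [e4]. *)
pose A := B%:R + 1 + 4 * K2 / e4.
have Ke0 : 0 < 4 * K2 / e4 by rewrite divr_gt0// mulr_gt0.
have AB : B%:R <= A by rewrite /A; lra.
have A1 : 1 <= A.
  by have : 0 <= B%:R :> R by []; rewrite /A; lra.
have A0 : 0 < A by lra.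
have AK : 4 * K2 / A <= e4.
  by rewrite ler_pdivrMr// [e4 * A]mulrC -ler_pdivrMr// /A lerDr addr_ge0.
pose C := C1 + 1; have C_1 : 1 <= C by rewrite lerDr ltW.
have Cs0 : 0 < C ^+ s by rewrite exprn_gt0//; lra.
pose e1 := e4 / ((2 * A + 1) * (s%:R * C ^+ s)).
have DA : 0 < (2 * A + 1) * (s%:R * C ^+ s) by rewrite !mulr_gt0//; lra.
have e10 : 0 < e1 by rewrite divr_gt0.
have [P1 hnear] := modelsum_near e10 A0 M0.
exists (maxn (maxn P1 P2) (maxn P3 1)) => P L; rewrite !geq_max => /andP[/andP[PP1 PP2] /andP[PP3 P_0]] PL.
have Pr : 0 < P%:R :> R by rewrite ltr0n.
have P1r : 1 <= P%:R :> R by rewrite ler1n.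
have P3r : 0 < P%:R ^+ 3 :> R by rewrite exprn_gt0.
have PL' : (P ^ 3 <= L)%N by apply: leq_trans PL; rewrite leq_pmull.
have L0 : 0 < L%:R :> R by rewrite ltr0n (leq_trans _ PL')// expn_gt0 P_0.
set V := L%:R / P%:R ^+ 3 : R.
have V1 : 1 <= V by rewrite ler_pdivlMr// mul1r -natrX ler_nat.
have Ps3 : P%:R ^+ s = P%:R ^+ (s - 3) * P%:R ^+ 3 :> R.
  by rewrite -exprD subnK// (leq_trans _ s11).
have VP : V * P%:R ^+ s = L%:R * P%:R ^+ (s - 3) by rewrite Ps3 /V; field; rewrite gt_eqF.
set LP := L%:R * P%:R ^+ (s - 3) in VP *.
have LP0 : 0 < LP by rewrite mulr_gt0 ?exprn_gt0.
pose f i (k : nat) := cubesum (theta i) P (k%:R / L%:R).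
pose h (k : nat) := modelsum M P (k%:R / L%:R : R).
pose ctr (k : nat) := k%:R / L%:R * P%:R ^+ 3 <= A.
have alT (k : 'I_(T * L)) : 0 <= (k%:R / L%:R : R) <= T%:R.
  by rewrite divr_ge0//= ler_pdivrMr// -natrM ler_nat ltnW.
have fP i (k : nat) : cnorm (f i k) <= P%:R by exact: cnorm_cubesum_le.
have hP (k : nat) : cnorm (h k) <= C1 * P%:R by exact: hC1.
have ctrE (k : nat) : ctr k = (`|k%:R - 0| <= A * V).
  rewrite /ctr subr0 ger0_norm// /V [A * _]mulrA ler_pdivlMr// mulrAC ler_pdivrMr//.
rewrite (bigID (fun k : 'I_(T * L) => ctr k)) /=.
have part1 : \sum_(k < T * L | ctr k) cnorm (\prod_(i < s) f i k - h k ^+ s) <= e4 * LP.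
  have c0 : 0 <= s%:R * C ^+ s * e1 * P%:R ^+ s.
    exact: (mulr_ge0 (mulr_ge0 (mulr_ge0 (ltW s0) (ltW Cs0)) (ltW e10)) (exprn_ge0 s (ltW Pr))).
  apply: le_trans (_ : \sum_(k < T * L | `|k%:R - 0| <= A * V) s%:R * C ^+ s * e1 * P%:R ^+ s <= _).
    apply: ler_sum_sub => k; last 1 first.
    - rewrite /ctr => hk; have /andP[a0 aT] := alT k.
      have K0 : 0 < C * P%:R by exact: mulr_gt0 (lt_le_trans ltr01 C_1) Pr.
      have E0 : 0 <= e1 * P%:R by rewrite mulr_ge0 ?ltW.
      have := @cnorm_prod_sub_le s (fun i => f i k) (h k) (C * P%:R) (e1 * P%:R) E0 _ _ _.
      have b1 : cnorm (h k) <= C * P%:R.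
        by apply: le_trans (hP k) _; rewrite ler_pM2r// lerDl.
      have b2 i : cnorm (f i k) <= C * P%:R.
        by apply: le_trans (fP i k) _; rewrite ler_peMl// ltW.
      have b3 i : cnorm (f i k - h k) <= e1 * P%:R by apply: hnear.
      move=> /(_ b1 b2 b3); set X := cnorm _ => hX.
      have X0 : 0 <= X by exact: cnorm_ge0.
      rewrite -(ler_pM2r Pr); apply: le_trans (_ : X * (C * P%:R) <= _).
        by rewrite ler_wpM2l// ler_peMl// ltW.
      apply: le_trans hX _; rewrite (exprMn s) le_eqVlt; apply/orP; left; apply/eqP; ring.
    - by [].
    - by rewrite ctrE.
  rewrite (eq_bigr (fun=> (s%:R * C ^+ s * e1 * P%:R ^+ s) * 1)) => [|k _]; last by rewrite mulr1.
  rewrite -mulr_sumr.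
  have AV0 : 0 <= A * V by exact: mulr_ge0 (ltW A0) (le_trans ler01 V1).
  apply: le_trans (ler_wpM2l c0 (@count_near_le R (T * L) 0 (A * V) AV0)) _.
  apply: le_trans (_ : s%:R * C ^+ s * e1 * P%:R ^+ s * ((2 * A + 1) * V) <= _).
    rewrite ler_wpM2l// (_ : (2 * A + 1) * V = 2 * (A * V) + V); last by ring.
    by rewrite lerD2l.
  have e1E : e1 * ((2 * A + 1) * (s%:R * C ^+ s)) = e4 by rewrite /e1 divfK// gt_eqF.
  by rewrite -VP -e1E le_eqVlt; apply/orP; left; apply/eqP; ring.
have part2 : \sum_(k < T * L | ~~ ctr k) cnorm (h k) ^+ s <= e4 * LP.
  have nct (k : nat) : ~~ ctr k -> A * V < k%:R by rewrite ctrE subr0 ger0_norm// -ltNge.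
  have AV1 : 1 <= A * V by rewrite mulr_ege1.
  apply: le_trans (_ : \sum_(k < T * L | A * V <= `|k%:R - 0|)
      K2 * P%:R ^+ (s - 6) * L%:R ^+ 2 * ((k%:R - 0) ^+ 2)^-1 <= _).
    apply: ler_sum_sub => k; last 1 first.
    - move=> /nct hk; have /andP[a0 aT] := alT k.
      have k0 : 0 < k%:R :> R by exact: lt_trans (lt_le_trans ltr01 AV1) hk.
      have al0 : 0 < k%:R / L%:R :> R by rewrite divr_gt0.
      have aM : k%:R / L%:R <= M%:R / 2 :> R.
        have : (2 * T)%:R <= M%:R :> R by rewrite ler_nat.
        by move: aT; rewrite natrM; clear; lra.
      have := hC2 M P _ M0 al0 aM; rewrite -/(h k); set H := cnorm _ => hH.
      have H0 : 0 <= H by exact: cnorm_ge0.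
      (* Six factors, each [<< al^(-1/3)], give the summable inverse square; the others are bounded
         trivially. *)
      have s6 : s = (s - 6 + 3 * 2)%N by rewrite subnK// (leq_trans _ s11).
      rewrite {1}s6 exprD (exprM H 3 2) subr0.
      have hH2 : (H ^+ 3) ^+ 2 <= C2 ^+ 2 * L%:R ^+ 2 * (k%:R ^+ 2)^-1.
        have -> : C2 ^+ 2 * L%:R ^+ 2 * (k%:R ^+ 2)^-1 = (C2 / (k%:R / L%:R)) ^+ 2.
          by field; rewrite !gt_eqF.
        rewrite lerXn2r ?nnegrE ?exprn_ge0 ?divr_ge0 ?(ltW C20)//.
        by rewrite ler_pdivlMr.
      have -> : K2 * P%:R ^+ (s - 6) * L%:R ^+ 2 * (k%:R ^+ 2)^-1 =
        (C1 * P%:R) ^+ (s - 6) * (C2 ^+ 2 * L%:R ^+ 2 * (k%:R ^+ 2)^-1).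
        by rewrite /K2 (exprMn (s - 6)); ring.
      apply: ler_pM; rewrite ?exprn_ge0//.
      by rewrite lerXn2r ?nnegrE// ?mulr_ge0 ?(ltW C10)//; exact: hP.
    - by rewrite mulr_ge0 ?invr_ge0 ?exprn_even_ge0// !mulr_ge0 ?exprn_ge0 ?ltW.
    - by move/nct => hk; rewrite subr0 ger0_norm// ltW.
  rewrite -mulr_sumr.
  have c0 : 0 <= K2 * P%:R ^+ (s - 6) * L%:R ^+ 2 by rewrite !mulr_ge0 ?exprn_ge0 ?ltW.
  apply: le_trans (ler_wpM2l c0 (@inv_sq_sum_le R (T * L) 0 (A * V) AV1)) _.
  have -> : K2 * P%:R ^+ (s - 6) * L%:R ^+ 2 * (4 / (A * V)) = 4 * K2 / A * LP.
    rewrite /LP /V (_ : (s - 3 = s - 6 + 3)%N); last by move: s11; clear; lia.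
    by rewrite exprD; field; rewrite !gt_eqF.
  by rewrite ler_pM2r.
have part3 : \sum_(k < T * L | ~~ ctr k) \prod_(i < s) cnorm (f i k) <= e4 * LP + e4 * LP.
  pose nf (k : 'I_(T * L)) := `[< near_frac B P (k%:R / L%:R : R) >].
  rewrite (bigID nf) /=; apply: lerD.
    apply: le_trans (_ : \sum_(k < T * L | nf k) e3 * P%:R ^+ s <= _).
      apply: ler_sum_sub => k; last 1 first.
      - move=> /andP[hk /asboolP nk].
        have hf : cnorm (f i0 k) <= e3 * P%:R.
          apply: hirr => //.
          by rewrite mulrC; apply: le_lt_trans AB _; rewrite ltNge.
        rewrite (bigD1 i0)//=.
        have -> : e3 * P%:R ^+ s = (e3 * P%:R) * P%:R ^+ (s.-1).
          by rewrite -mulrA -exprS prednK// (leq_trans _ s11).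
        apply: ler_pM => //; rewrite ?cnorm_ge0//.
          by apply: prodr_ge0 => i _; rewrite cnorm_ge0.
        apply: le_trans (_ : \prod_(i < s | i != i0) P%:R <= _).
          by apply: ler_prod => i _; rewrite cnorm_ge0 fP.
        by rewrite prodr_const cardC1 card_ord.
      - by move=> _; rewrite mulr_ge0 ?exprn_ge0 ?ltW.
      - by case/andP.
    rewrite (eq_bigr (fun=> (e3 * P%:R ^+ s) * 1)) => [|k _]; last by rewrite mulr1.
    rewrite -mulr_sumr.
    have c0 : 0 <= e3 * P%:R ^+ s by rewrite mulr_ge0 ?exprn_ge0 ?ltW.
    apply: le_trans (ler_wpM2l c0 (hCB P L P_0 PL')) _; rewrite -/V.
    have -> : e3 * P%:R ^+ s * (CB * V) = e3 * CB * LP by rewrite -VP; ring.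
    by rewrite ler_pM2r// /e3 mulrAC ler_pdivrMr// ler_pM2l// lerDl ler01.
  apply: le_trans (_ : \sum_(k < T * L | ~~ nf k)
      \sum_(i < s) P%:R ^+ (s - 11) * cnorm (f i k) ^+ 11 <= _).
    apply: ler_sum_sub => k; last 1 first.
    - move=> _; apply: le_trans (prod_le_sum_exp i0 _) _ => [i|]; first exact: cnorm_ge0.
      apply: ler_sum => i _; rewrite -{1}(subnK s11) exprD.
      apply: ler_wpM2r; first by rewrite exprn_ge0 ?cnorm_ge0.
      by rewrite lerXn2r ?nnegrE ?cnorm_ge0.
    - move=> _; apply: sumr_ge0 => i _.
      by rewrite mulr_ge0 ?exprn_ge0 ?cnorm_ge0.
    - by case/andP.
  rewrite exchange_big /=.
  apply: le_trans (_ : \sum_(i < s) e2 * LP <= _); last first.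
    by rewrite sumr_ord_const mulrA ler_pM2r// /e2 mulrC divfK// gt_eqF.
  apply: ler_sum => i _; rewrite -mulr_sumr.
  have := hmin P L (theta i) PP2 PL (th i).
  move=> /(ler_wpM2l (exprn_ge0 (s - 11) (ltW Pr))) /le_trans; apply.
  rewrite /LP (_ : (s - 3 = s - 11 + 8)%N); last by move: s11; clear; lia.
  by rewrite exprD le_eqVlt; apply/orP; left; apply/eqP; ring.
have -> : eps * L%:R * P%:R ^+ (s - 3) = e4 * LP + (e4 * LP + e4 * LP + e4 * LP).
  by rewrite /LP /e4; field.
apply: lerD; first exact: part1.
apply: le_trans (_ : \sum_(k < T * L | ~~ ctr k) (\prod_(i < s) cnorm (f i k) + cnorm (h k) ^+ s) <= _).
  apply: ler_sum => k _; apply: le_trans (ler_cnormB _ _) _.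
  by rewrite cnorm_prod cnormX.
by rewrite big_split /=; apply: lerD.
Qed.
End CircleL1.

(** * Fejer kernels and smoothing *)

Section Kernel.
Variable R : realType.
Implicit Types (u t r d : R).

(* A periodic Fejer kernel: as L grows it approximates T * (sin (pi T u) / (pi T u))^2,
   but it involves only the frequencies k / L with k < T * L. *)
Definition kern (T L : nat) u : R :=
  cnorm (\sum_(j < T * L) expi (u / L%:R) ^+ j) ^+ 2 / (T%:R * L%:R ^+ 2).

Lemma kern_ge0 T L u : 0 <= kern T L u.
Proof. by rewrite divr_ge0 ?sqr_ge0// mulr_ge0// sqr_ge0. Qed.

Lemma abs_rho_small u : `|u| <= 1 / 2 -> `|rho u| = `|u|.
Proof.
move=> h; have [e|ne] := eqVneq u (1 / 2).
  rewrite e (@rho_eq _ _ 1); last lra.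
  by rewrite [in RHS]ger0_norm; [rewrite ler0_norm; lra | lra].
rewrite (@rho_eq _ _ 0) ?subr0//.
by move: h; rewrite ler_norml => /andP[-> h]; rewrite lt_neqAle ne.
Qed.

Lemma kern_le_rho (T L : nat) u r : (0 < T)%N -> (0 < L)%N -> 0 < r ->
  r <= `|rho (u / L%:R)| -> kern T L u <= (4 * T%:R * (r * L%:R) ^+ 2)^-1.
Proof.
move=> T0 L0 r0 h; have Tr : 0 < T%:R :> R by rewrite ltr0n.
have Lr : 0 < L%:R :> R by rewrite ltr0n.
have -> : (4 * T%:R * (r * L%:R) ^+ 2)^-1 = ((2 * r)^-1) ^+ 2 / (T%:R * L%:R ^+ 2).
  by field; rewrite !gt_eqF.
rewrite /kern ler_pM2r ?invr_gt0 ?mulr_gt0 ?exprn_gt0//.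
rewrite lerXn2r ?nnegrE ?cnorm_ge0 ?invr_ge0 ?mulr_ge0 ?(ltW r0)//.
by apply: le_trans (cnorm_geom_expi _ (leqnn _)) _; apply: mbound_le_inv.
Qed.

Lemma kern_le (T L : nat) u d : (0 < T)%N -> (0 < L)%N -> 0 < d -> d <= `|u| ->
  `|u| <= L%:R / 2 -> kern T L u <= (4 * T%:R * d ^+ 2)^-1.
Proof.
move=> T0 L0 d0 du uL; have Lr : 0 < L%:R :> R by rewrite ltr0n.
rewrite -[in leRHS](divfK (lt0r_neq0 Lr) d); apply: kern_le_rho; rewrite ?divr_gt0//.
have e : `|u / L%:R| = `|u| / L%:R by rewrite normrM normfV (gtr0_norm Lr).
by rewrite abs_rho_small e ?ler_pM2r ?invr_gt0// ler_pdivrMr//; lra.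
Qed.

Lemma kern_expand (T L : nat) u : kern T L u =
  complex.Re (\sum_(j < T * L) \sum_(i < T * L) expi ((j%:R - i%:R) * (u / L%:R)))
    / (T%:R * L%:R ^+ 2).
Proof.
rewrite /kern; congr (_ / _).
rewrite -[LHS]/(complex.Re (_%:C)%C) cnorm_sqr_conj; congr complex.Re.
rewrite conjc_sum mulr_suml; apply: eq_bigr => j _.
rewrite mulr_sumr; apply: eq_bigr => i _.
by rewrite mulrBl expiB !expiM_nat.
Qed.

Lemma expi_neq1 u : 0 < `|u| -> `|u| < 1 -> expi u != 1.
Proof.
move=> u0 u1; apply/eqP => e; have := cnorm_expi_rho_ge u.
rewrite e subrr cnorm0 => h; have r0 : rho u = 0.
  by apply/eqP; rewrite -normr_le0; lra.
move: r0; rewrite /rho => /eqP; rewrite subr_eq0 => /eqP ue.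
move: u0 u1; rewrite ue -intr_norm ltr0z ltrz1; lia.
Qed.

(** Orthogonality: each off-diagonal term is a full geometric sum over powers of a root of unity of
    order dividing [D * L], nontrivial because [|j - i| < T * L <= D * L]. *)
Lemma kern_sum (T D L : nat) u : (0 < T)%N -> (0 < L)%N -> (T <= D)%N ->
  \sum_(l < D * L) kern T L (u - l%:R / D%:R) = D%:R.
Proof.
move=> T0 L0 TD; have D0 : (0 < D)%N by apply: leq_trans TD.
have Tr : 0 < T%:R :> R by rewrite ltr0n.
have Lr : 0 < L%:R :> R by rewrite ltr0n.
have Dr : 0 < D%:R :> R by rewrite ltr0n.
under eq_bigr do rewrite kern_expand.
rewrite -mulr_suml -Re_sum exchange_big /=; under eq_bigr do rewrite exchange_big /=.
have -> : \sum_(j < T * L) \sum_(i < T * L) \sum_(l < D * L)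
   expi ((j%:R - i%:R) * ((u - l%:R / D%:R) / L%:R)) = \sum_(j < T * L) ((D * L)%:R : R)%:C%C.
  apply: eq_bigr => j _; rewrite (bigD1 j)//= subrr.
  rewrite (eq_bigr (fun=> 1)) => [|l _]; last by rewrite mul0r expi0.
  rewrite sumr_const card_ord rmorph_nat big1 ?addr0// => i ij.
  pose w := expi ((i%:R - j%:R) / (D%:R * L%:R) : R).
  rewrite (eq_bigr (fun l : 'I_(D * L) => expi ((j%:R - i%:R) * (u / L%:R)) * w ^+ l)); last first.
    move=> l _; rewrite -expiM_nat -expiD; congr expi; field.
    by rewrite !gt_eqF.
  rewrite -mulr_sumr.
  have wD : w ^+ (D * L) = 1.
    rewrite -expiM_nat natrM mulrC divfK ?gt_eqF ?mulr_gt0// expiB !expi_nat.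
    by rewrite rmorph1 mulr1.
  have w1 : w != 1.
    have dE : (i%:R - j%:R : R) = (i%:Z - j%:Z)%:~R by rewrite intrB -!pmulrn.
    apply: expi_neq1; rewrite normrM normfV (gtr0_norm (mulr_gt0 Dr Lr)).
      rewrite divr_gt0 ?mulr_gt0// normr_gt0 dE intr_eq0.
      by move: ij; rewrite -val_eqE /=; lia.
    rewrite ltr_pdivrMr ?mulr_gt0// mul1r -natrM dE -intr_norm pmulrn ltr_int.
    have hTD : (T * L <= D * L)%N by rewrite leq_mul2r TD orbT.
    have := leq_trans (ltn_ord i) hTD; have := leq_trans (ltn_ord j) hTD.
    by move: (D * L)%N => n; lia.
  have : (w - 1) * \sum_(l < D * L) w ^+ l = 0 by rewrite -subrX1 wD subrr.
  by move/eqP; rewrite mulf_eq0 subr_eq0 (negPf w1) /= => /eqP ->; rewrite mulr0.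
rewrite Re_sum sumr_ord_const /= !natrM.
by field; rewrite !gt_eqF.
Qed.

Lemma kern_tail (T D L : nat) t d : (0 < T)%N -> (0 < L)%N -> (T <= D)%N -> 0 < d ->
  1 <= d * D%:R -> d <= t -> t <= L%:R / 2 ->
  \sum_(l < D * L | d <= `|l%:R / D%:R - t|) kern T L (t - l%:R / D%:R) <=
    2 * D%:R / (T%:R * d).
Proof.
move=> T0 L0 TD d0 dD dt tL; have D0 : (0 < D)%N by apply: leq_trans TD.
have Tr : 0 < T%:R :> R by rewrite ltr0n.
have Lr : 0 < L%:R :> R by rewrite ltr0n.
have Dr : 0 < D%:R :> R by rewrite ltr0n.
(* The kernel has period [L]: as [l / D] runs over [0, L) it peaks at [t], and more than half a
   period further on it is controlled by the peak at [t + L]. *)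
pose c1 := t * D%:R; pose c2 := (t + L%:R) * D%:R.
pose W := d * D%:R.
pose F c (l : 'I_(D * L)) : R := if W <= `|l%:R - c| then ((l%:R - c) ^+ 2)^-1 else 0.
have F0 c l : 0 <= F c l by rewrite /F; case: ifP => // _; rewrite invr_ge0 sqr_ge0.
have FS c : \sum_(l < D * L) F c l <= 4 / W.
  by rewrite /F -big_mkcond /=; apply: inv_sq_sum_le.
have K0 : 0 <= D%:R ^+ 2 / (4 * T%:R) :> R by rewrite divr_ge0 ?sqr_ge0// mulr_ge0.
apply: le_trans (_ : \sum_(l < D * L) D%:R ^+ 2 / (4 * T%:R) * (F c1 l + F c2 l) <= _).
  rewrite big_mkcond; apply: ler_sum => l _; case: ifPn => [h|_]; last first.
    by rewrite mulr_ge0// addr_ge0.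
  have lL : l%:R / D%:R < L%:R :> R by rewrite ltr_pdivrMr// mulrC -natrM ltr_nat.
  have l0 : 0 <= l%:R / D%:R :> R by rewrite divr_ge0.
  set v := t - l%:R / D%:R.
  have vd : d <= `|v| by rewrite -normrN opprB.
  have [hv|hv] := leP (- (L%:R / 2)) v.
    apply: le_trans (_ : D%:R ^+ 2 / (4 * T%:R) * F c1 l <= _); last first.
      by rewrite ler_wpM2l// lerDl.
    have lc : l%:R - c1 = - (v * D%:R) by rewrite /v /c1; field; rewrite gt_eqF.
    rewrite /F lc normrN normrM (gtr0_norm Dr) ler_pM2r// vd sqrrN.
    have v0 : v != 0 by rewrite -normr_gt0 (lt_le_trans d0).
    apply: le_trans (@kern_le T L v `|v| _ _ _ _ _) _ => //; first by rewrite (lt_le_trans d0).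
      by rewrite ler_norml hv /= /v; lra.
    rewrite real_normK ?num_real// le_eqVlt; apply/orP; left; apply/eqP.
    by field; rewrite v0 !gt_eqF.
  have vL0 : 0 < v + L%:R by rewrite /v; lra.
  have vLt : t <= v + L%:R by rewrite /v; lra.
  have vL2 : v + L%:R <= L%:R / 2 by lra.
  apply: le_trans (_ : D%:R ^+ 2 / (4 * T%:R) * F c2 l <= _); last first.
    by rewrite ler_wpM2l// lerDr.
  have lc : l%:R - c2 = - ((v + L%:R) * D%:R) by rewrite /v /c2; field; rewrite gt_eqF.
  rewrite /F lc normrN normrM (gtr0_norm Dr) (gtr0_norm vL0) ler_pM2r// (le_trans dt vLt) sqrrN.
  have -> : kern T L v = kern T L (v + L%:R).
    by rewrite /kern [in RHS]mulrDl divff ?gt_eqF// expiD expi1 mulr1.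
  apply: le_trans (@kern_le T L (v + L%:R) (v + L%:R) _ _ _ _ _) _ => //; rewrite ?(gtr0_norm vL0)//.
  rewrite le_eqVlt; apply/orP; left; apply/eqP.
  by field; rewrite !gt_eqF.
rewrite -mulr_sumr big_split /=.
apply: le_trans (ler_wpM2l K0 (lerD (FS c1) (FS c2))) _.
rewrite le_eqVlt /W; apply/orP; left; apply/eqP.
by field; rewrite !gt_eqF.
Qed.

(** One Fejer kernel has zeros, but two copies half a unit apart never vanish together, since
    [|e(u) - 1|^2 + |e(u + 1/2) - 1|^2 = 4]. Their sum therefore dominates a multiple of
    [1 / (|u| + 1/2)^2]. *)
Lemma kern1_ge (L : nat) u : (0 < L)%N ->
  4 <= 64 * (`|u| + 1 / 2) ^+ 2 * (kern 1 L u + kern 1 L (u + 1 / 2)).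
Proof.
move=> L0; have Lr : 0 < L%:R :> R by rewrite ltr0n.
have key v : cnorm (expi v - 1) ^+ 2 <= 64 * v ^+ 2 * kern 1 L v.
  rewrite /kern mul1n; set S := \sum_(_ < _) _.
  have e : expi v - 1 = (expi (v / L%:R) - 1) * S.
    by rewrite -subrX1 -expiM_nat mulrC divfK ?gt_eqF.
  have h : cnorm (expi v - 1) <= 8 * `|v / L%:R| * cnorm S.
    by rewrite e cnormM ler_wpM2r ?cnorm_ge0// cnorm_expi_sub1_le.
  have -> : 64 * v ^+ 2 * (cnorm S ^+ 2 / (1 * L%:R ^+ 2)) = (8 * `|v / L%:R| * cnorm S) ^+ 2.
    rewrite !(exprMn 2) real_normK ?num_real//; field; by rewrite gt_eqF.
  by rewrite lerXn2r ?nnegrE ?cnorm_ge0// !mulr_ge0 ?cnorm_ge0.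
have half : expi (1 / 2 : R) = -1.
  rewrite /expi (_ : 2 * pi * (1 / 2) = pi); last by field.
  by rewrite cospi sinpi; apply/eqP; rewrite eq_complex /= oppr0 !eqxx.
have sum4 : 4 = cnorm (expi u - 1) ^+ 2 + cnorm (expi (u + 1 / 2) - 1) ^+ 2.
  rewrite expiD half mulrN1; have := cnorm_sqr (expi u); rewrite cnorm_expi expr1n.
  rewrite !cnorm_sqr; case: (expi u) => a b /= h.
  by move: h; rewrite ?oppr0 ?subr0 => h; lra.
rewrite {1}sum4 mulrDr; apply: lerD.
  apply: le_trans (key _) _; rewrite ler_wpM2r ?kern_ge0// ler_pM2l//.
  by rewrite -(real_normK (num_real u)) lerXn2r ?nnegrE ?addr_ge0// lerDl.
apply: le_trans (key _) _; rewrite ler_wpM2r ?kern_ge0// ler_pM2l//.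
rewrite -(real_normK (num_real (u + 1 / 2))) lerXn2r ?nnegrE ?addr_ge0//.
by apply: le_trans (ler_normD _ _) _; rewrite lerD2l ger0_norm.
Qed.

(** Expanding the kernel produces the trigonometric sums at all differences [j - i]. For each [j] a
    value of [|j - i|] occurs at most twice, and conjugation handles the negative differences. *)
Lemma kern_trig_le (I : finType) (w p : I -> R) (T L : nat) t : (0 < T)%N -> (0 < L)%N ->
  `|\sum_i w i * kern T L (p i - t)| <=
  2 / L%:R * \sum_(k < T * L) cnorm (\sum_i (w i)%:C%C * expi (k%:R / L%:R * p i)).
Proof.
move=> T0 L0; have Tr : 0 < T%:R :> R by rewrite ltr0n.
have Lr : 0 < L%:R :> R by rewrite ltr0n.
have TL0 : 0 < T%:R * L%:R ^+ 2 :> R by rewrite mulr_gt0// exprn_gt0.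
pose Fr x := \sum_i (w i)%:C%C * expi (x / L%:R * p i).
pose Phi (k : nat) := cnorm (Fr k%:R).
have Phi0 k : 0 <= Phi k by exact: cnorm_ge0.
have FrN x : cnorm (Fr (- x)) = cnorm (Fr x).
  rewrite -[RHS]cnorm_conj /Fr conjc_sum; congr cnorm; apply: eq_bigr => i _.
  by rewrite rmorphM /= mulNr mulNr expiN /= oppr0.
have -> : \sum_i w i * kern T L (p i - t) = complex.Re (\sum_(j < T * L) \sum_(i < T * L)
     expi (- ((j%:R - i%:R) * (t / L%:R))) * Fr (j%:R - i%:R)) / (T%:R * L%:R ^+ 2).
  under eq_bigr do rewrite kern_expand mulrA -Re_mulC mulr_sumr.
  rewrite -mulr_suml; congr (_ / _); rewrite -Re_sum; congr complex.Re.
  rewrite exchange_big /=; apply: eq_bigr => j _.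
  under eq_bigr do rewrite mulr_sumr.
  rewrite exchange_big /=; apply: eq_bigr => i _.
  rewrite /Fr mulr_sumr; apply: eq_bigr => x _.
  rewrite [RHS]mulrCA -expiD; congr (_ * expi _); field; by rewrite gt_eqF.
rewrite normrM normfV (gtr0_norm TL0) ler_pdivrMr//.
apply: le_trans (ler_Re_cnorm _) _; apply: le_trans (ler_cnorm_sum _ _ _) _.
have row (j : 'I_(T * L)) : \sum_(i < T * L) cnorm (Fr (j%:R - i%:R)) <=
    2 * \sum_(k < T * L) Phi k.
  apply: le_trans (_ : \sum_(i < T * L) \sum_(k < T * L)
      ((if (j == i + k :> nat)%N then Phi k else 0) + (if (i == j + k :> nat)%N then Phi k else 0)) <= _).
    apply: ler_sum => i _.
    have F0 (k : 'I_(T * L)) : 0 <= (if (j == i + k :> nat)%N then Phi k else 0) +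
       (if (i == j + k :> nat)%N then Phi k else 0) by rewrite addr_ge0//; case: ifP.
    have [ij|ij] := leqP i j.
      have kl : (j - i < T * L)%N by apply: leq_ltn_trans (leq_subr _ _) (ltn_ord j).
      rewrite (bigD1 (Ordinal kl))//= subnKC// eqxx.
      apply: le_trans (_ : Phi (j - i)%N <= _); first by rewrite /Phi natrB.
      rewrite -addrA lerDl addr_ge0//; first by case: ifP.
      by apply: sumr_ge0 => k _; exact: F0.
    have kl : (i - j < T * L)%N by apply: leq_ltn_trans (leq_subr _ _) (ltn_ord i).
    rewrite (bigD1 (Ordinal kl))//= [X in _ <= _ + X + _]ifT; last by rewrite subnKC// ltnW.
    apply: le_trans (_ : Phi (i - j)%N <= _).
      by rewrite /Phi natrB ?(ltnW ij)// -FrN opprB.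
    rewrite addrAC lerDr addr_ge0//; first by case: ifP.
    by apply: sumr_ge0 => k _; exact: F0.
  rewrite exchange_big /= mulr_sumr; apply: ler_sum => k _.
  rewrite big_split /= mulr_natl mulr2n; apply: lerD; rewrite -big_mkcond /= sumr_const.
    rewrite -mulr_natr ler_piMr// lern1.
    apply/card_le1_eqP => i1 i2; rewrite !unfold_in => /eqnP e1 /eqnP e2.
    by apply: val_inj => /=; move: e1 e2; clear; lia.
  rewrite -mulr_natr ler_piMr// lern1.
  apply/card_le1_eqP => i1 i2; rewrite !unfold_in => /eqnP e1 /eqnP e2.
  by apply: val_inj => /=; move: e1 e2; clear; lia.
apply: le_trans (_ : \sum_(j < T * L) (2 * \sum_(k < T * L) Phi k) <= _).
  apply: ler_sum => j _; apply: le_trans (ler_cnorm_sum _ _ _) _.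
  apply: le_trans (row j); apply: ler_sum => i _.
  by rewrite cnormM cnorm_expi mul1r.
rewrite sumr_ord_const natrM le_eqVlt; apply/orP; left; apply/eqP.
by rewrite /Phi /Fr; field; rewrite gt_eqF.
Qed.
End Kernel.

(** * Sandwiching the interval between sums of kernels *)

Section Smoothing.
Variable R : realType.
Implicit Types (tau eta delta U B : R).

(** All [T * L] translates by multiples of [1 / T] add up to exactly [T] at every point. The first
    [2 * m + 1] of them reach beyond the interval by [delta] on either side, so at a point inside it
    the omitted ones contribute at most [2 / delta]. *)
Lemma smooth_upper (I : finType) (p : I -> R) tau eta delta U (T L m : nat) :
  0 < delta -> (0 < T)%N -> (0 < L)%N -> 1 <= delta * T%:R ->
  eta + delta <= m%:R / T%:R -> eta + m%:R / T%:R <= L%:R / 2 ->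
  ((2 * m).+1 <= T * L)%N ->
  (forall t, `|t - tau| <= m%:R / T%:R -> \sum_i kern T L (p i - t) <= U) ->
  (\sum_(i | `|p i - tau| < eta) 1) * (1 - 2 / (delta * T%:R)) <=
    (2 * m).+1%:R / T%:R * U.
Proof.
move=> d0 T0 L0 dT hm mL mTL hU.
have Tr : 0 < T%:R :> R by rewrite ltr0n.
pose tl (l : nat) : R := tau - m%:R / T%:R + l%:R / T%:R.
have step i : `|p i - tau| < eta ->
    T%:R - 2 / delta <= \sum_(l < (2 * m).+1) kern T L (p i - tl l).
  move=> hi; set c := p i - tau + m%:R / T%:R.
  have [h1 h2] : - eta < p i - tau /\ p i - tau < eta.
    by move: hi; rewrite ltr_norml => /andP[].
  have cd : delta <= c by rewrite /c; lra.
  have cL : c <= L%:R / 2 by rewrite /c; lra.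
  have tlE (l : nat) : kern T L (p i - tl l) = kern T L (c - l%:R / T%:R).
    by congr kern; rewrite /tl /c; ring.
  under eq_bigr do rewrite tlE.
  have := @kern_tail R T T L c delta T0 L0 (leqnn T) d0 dT cd cL.
  have := @kern_sum R T T L c T0 L0 (leqnn T).
  rewrite (bigID (fun l : 'I_(T * L) => l < (2 * m).+1)%N) /= => tot tail.
  rewrite (big_ord_widen _ (fun l => kern T L (c - l%:R / T%:R)) mTL).
  set S2 := \sum_(l < T * L | ~~ _) _ in tot.
  have : S2 <= 2 * T%:R / (T%:R * delta).
    apply: le_trans tail; apply: ler_sum_sub => l; rewrite ?kern_ge0// -leqNgt => hl.
    have : (2 * m).+1%:R <= l%:R :> R by rewrite ler_nat.
    rewrite -natr1 natrM => hl'.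
    have : (2 * m%:R + 1) / T%:R <= l%:R / T%:R :> R by rewrite ler_pM2r ?invr_gt0.
    have : 0 < T%:R^-1 :> R by rewrite invr_gt0.
    rewrite mulrDl -mulrA mul1r => q1 q2.
    by rewrite ler_normr; apply/orP; left; rewrite /c; lra.
  have -> : 2 * T%:R / (T%:R * delta) = 2 / delta by field; rewrite !gt_eqF.
  by lra.
have big : (\sum_(i | `|p i - tau| < eta) 1) * (T%:R - 2 / delta) <= (2 * m).+1%:R * U.
  rewrite mulr_suml; under eq_bigr do rewrite mul1r.
  apply: le_trans (_ : \sum_i \sum_(l < (2 * m).+1) kern T L (p i - tl l) <= _).
    rewrite big_mkcond; apply: ler_sum => i _; case: ifPn => [/step//|_].
    by apply: sumr_ge0 => l _; exact: kern_ge0.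
  rewrite exchange_big /= -sumr_ord_const; apply: ler_sum => l _; apply: hU.
  have -> : tl l - tau = (l%:R - m%:R) / T%:R by rewrite /tl; ring.
  rewrite normrM normfV (gtr0_norm Tr) ler_pM2r ?invr_gt0//.
  have : l%:R <= (2 * m)%:R :> R by rewrite ler_nat -ltnS.
  by have : 0 <= l%:R :> R by []; rewrite natrM ler_norml => a b; apply/andP; split; lra.
rewrite mulrAC ler_pdivlMr// -mulrA mulrBl mul1r.
by rewrite (_ : 2 / (delta * T%:R) * T%:R = 2 / delta)//; field; rewrite !gt_eqF.
Qed.

(** Translates centred within [eta - delta] of [tau] add up to at most [T] at any point, but their
    tails also see the points outside the interval. Two kernels with [T = 1] dominate these tails up
    to a factor [1 / T], and [U] bounds their sums over all points. *)
Lemma smooth_lower (I : finType) (p : I -> R) tau eta delta U B (T L m : nat) :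
  0 < delta -> delta < eta -> (0 < T)%N -> (0 < L)%N ->
  m%:R / T%:R <= eta - delta -> ((2 * m).+1 <= T * L)%N ->
  (forall i, `|p i - tau| <= L%:R / 4) -> eta <= L%:R / 4 ->
  (forall t, `|t - tau| <= eta -> B <= \sum_i kern T L (p i - t)) ->
  (forall t, `|t - tau| <= 1 / 2 -> \sum_i kern 1 L (p i - t) <= U) ->
  (2 * m).+1%:R * B <= T%:R * (\sum_(i | `|p i - tau| < eta) 1) +
    (2 * m).+1%:R * (8 * ((eta + 1 / 2) / delta) ^+ 2 / T%:R * U).
Proof.
move=> d0 de T0 L0 hm mTL pL eL hB hU.
have Tr : 0 < T%:R :> R by rewrite ltr0n.
pose tl (l : nat) : R := tau - m%:R / T%:R + l%:R / T%:R.
have tld (l : 'I_(2 * m).+1) : `|tl l - tau| <= eta - delta.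
  apply: le_trans hm.
  have -> : tl l - tau = (l%:R - m%:R) / T%:R by rewrite /tl; ring.
  rewrite normrM normfV (gtr0_norm Tr) ler_pM2r ?invr_gt0//.
  have : l%:R <= (2 * m)%:R :> R by rewrite ler_nat -ltnS.
  by have : 0 <= l%:R :> R by []; rewrite natrM ler_norml => a b; apply/andP; split; lra.
(* The largest value of [(|u| + 1/2)^2 / (|u| - (eta - delta))^2] over [|u| >= eta], attained at
   [|u| = eta]. *)
pose K := ((eta + 1 / 2) / delta) ^+ 2.
have K0 : 0 < K by rewrite exprn_gt0// divr_gt0//; lra.
have KT0 : 0 < 4 * K / T%:R by apply: divr_gt0 Tr; apply: mulr_gt0 K0.
pose Q i := kern 1 L (p i - tau) + kern 1 L (p i - (tau - 1 / 2)).
have Q0 i : 0 <= Q i by rewrite addr_ge0 ?kern_ge0.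
have far i (l : 'I_(2 * m).+1) : eta <= `|p i - tau| ->
    kern T L (p i - tl l) <= 4 * K / T%:R * Q i.
  move=> hi; set u := p i - tau in hi *.
  pose x := `|u| - (eta - delta).
  have x0 : 0 < x by rewrite /x; lra.
  have tl1 := tld l.
  have xu : x <= `|p i - tl l|.
    have : `|u| <= `|p i - tl l| + `|tl l - tau|.
      by apply: le_trans (ler_normD _ _); rewrite addrA subrK.
    by rewrite /x; lra.
  have uL : `|p i - tl l| <= L%:R / 2.
    have : `|p i - tl l| <= `|u| + `|tl l - tau|.
      by apply: le_trans (ler_normB _ _); rewrite opprB addrA subrK.
    by have := pL i; rewrite -/u; lra.
  apply: le_trans (@kern_le R T L _ x T0 L0 x0 xu uL) _.
  have := @kern1_ge R L u L0.
  have -> : kern 1 L u + kern 1 L (u + 1 / 2) = Q i.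
    by rewrite /Q; congr (_ + kern 1 L _); rewrite /u; ring.
  set y := `|u| + 1 / 2 => hQ.
  have y0 : 0 < y by rewrite /y; have := normr_ge0 u; lra.
  have xy : y ^+ 2 <= K * x ^+ 2.
    have ed0 : 0 <= (eta + 1 / 2) / delta by apply: divr_ge0; lra.
    rewrite /K -exprMn lerXn2r ?nnegrE ?(ltW y0)//; first exact: mulr_ge0 ed0 (ltW x0).
    rewrite mulrAC ler_pdivlMr// /y /x; move: hi de d0; move: `|u| => v hi de d0.
    by nra.
  have -> : (4 * T%:R * x ^+ 2)^-1 = (4 * T%:R)^-1 * (x ^+ 2)^-1 by rewrite invfM.
  have -> : 4 * K / T%:R * Q i = (4 * T%:R)^-1 * (16 * K * Q i) by field; rewrite gt_eqF.
  rewrite ler_pM2l ?invr_gt0 ?mulr_gt0//.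
  have x20 : 0 < x ^+ 2 by rewrite exprn_gt0.
  rewrite -div1r ler_pdivrMr//.
  have : 64 * y ^+ 2 * Q i <= 64 * (K * x ^+ 2) * Q i.
    by rewrite ler_wpM2r// ler_pM2l.
  by lra.
have near i : \sum_(l < (2 * m).+1) kern T L (p i - tl l) <= T%:R.
  rewrite -[leRHS](@kern_sum R T T L (p i - tau + m%:R / T%:R) T0 L0 (leqnn T)).
  have tlE (l : nat) : kern T L (p i - tl l) = kern T L (p i - tau + m%:R / T%:R - l%:R / T%:R).
    by congr kern; rewrite /tl; ring.
  under eq_bigr do rewrite tlE.
  rewrite (big_ord_widen _ (fun l => kern T L (p i - tau + m%:R / T%:R - l%:R / T%:R)) mTL).
  by apply: ler_sum_sub => // l _; exact: kern_ge0.
apply: le_trans (_ : \sum_(l < (2 * m).+1) \sum_i kern T L (p i - tl l) <= _).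
  rewrite -sumr_ord_const; apply: ler_sum => l _; apply: hB.
  by apply: le_trans (tld l) _; lra.
rewrite exchange_big /= (bigID (fun i => `|p i - tau| < eta)) /=; apply: lerD.
  rewrite mulr_sumr; apply: ler_sum => i _; rewrite mulr1; exact: near.
apply: le_trans (_ : \sum_i (2 * m).+1%:R * (4 * K / T%:R * Q i) <= _).
  rewrite big_mkcond; apply: ler_sum => i _; case: ifPn => [|_]; last first.
    exact: mulr_ge0 (ler0n _ _) (mulr_ge0 (ltW KT0) (Q0 i)).
  rewrite -leNgt => hi; rewrite -sumr_ord_const; apply: ler_sum => l _.
  exact: far.
rewrite -mulr_sumr ler_pM2l// -mulr_sumr /Q big_split /=.
have -> : 8 * K / T%:R * U = 4 * K / T%:R * (U + U) by ring.
rewrite (ler_pM2l KT0); apply: lerD; apply: hU.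
  by rewrite subrr normr0.
by rewrite addrAC subrr sub0r normrN ger0_norm.
Qed.
End Smoothing.

(** * Counting solutions *)

Section ModelDensity.
Variable R : realType.
Implicit Types (x t e al tau eps : R).

Lemma powR_near1 e eps : 0 < eps -> exists d : R, 0 < d < 1 /\
  forall x, `|x - 1| <= d -> `|x `^ e - 1| <= eps.
Proof.
move=> eps0.
have cont : {for (1 : R), continuous (fun r : R => expR (e * ln r))}.
  apply: continuous_comp; last exact: continuous_expR.
  apply: continuousM; first exact: cst_continuous.
  exact: continuous_ln.
have /cvgrPdist_le/(_ eps eps0) := cont.
rewrite ln1 mulr0 expR0 => /nbhs_ballP[r /= r0 hr].
exists (Num.min r 1 / 2); have m0 : 0 < Num.min r 1 by rewrite lt_min r0 ltr01.
have m1 : Num.min r 1 <= 1 by rewrite ge_min lexx orbT.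
have mr : Num.min r 1 <= r by rewrite ge_min lexx.
split; first by lra.
move=> x hx; have x0 : 0 < x by move: hx; rewrite ler_norml => /andP[h _]; lra.
have := hr x; rewrite -ball_normE /= distrC [in X in _ -> X]distrC => h.
by rewrite /powR gt_eqF//; apply: h; lra.
Qed.

Lemma kernN (T L : nat) (u : R) : kern T L (- u) = kern T L u.
Proof.
rewrite /kern -[in RHS]cnorm_conj conjc_sum; congr (cnorm _ ^+ 2 / _).
by apply: eq_bigr => j _; rewrite rmorphXn /= mulNr expiN.
Qed.

Definition rpoly (M P : nat) : {poly R} := \poly_(i < (M * P ^ 3).+1) rcoef (1 / 3) i.

(* [modelsum ^+ s] is the trigonometric sum of the measure with mass
   [mweight s M P n] at n / M. *)
Definition mweight (s M P n : nat) : R := kappa R M ^+ s * (rpoly M P ^+ s)`_n.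

Lemma size_rpoly_exp s M P : (size (rpoly M P ^+ s) <= (M * P ^ 3 * s).+1)%N.
Proof.
apply: leq_trans (size_poly_exp_leq _ _) _; rewrite ltnS leq_mul2r; apply/orP; right.
by have := size_poly (M * P ^ 3).+1 (rcoef (1 / 3) : nat -> R); rewrite -/(rpoly M P); lia.
Qed.

Lemma modelsum_expr (s M P D : nat) al : (M * P ^ 3 * s < D)%N ->
  modelsum M P al ^+ s = \sum_(n < D) (mweight s M P n)%:C%C * expi (al * (n%:R / M%:R)).
Proof.
move=> hD; set z := expi (al / M%:R).
have -> : modelsum M P al = (kappa R M)%:C%C * (map_poly (real_complex R) (rpoly M P)).[z].
  rewrite /modelsum; congr (_ * _).
  rewrite (@horner_coef_wide _ (M * P ^ 3).+1); last first.
    by rewrite size_map_poly size_poly.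
  by apply: eq_bigr => n _; rewrite coef_map coef_poly ltn_ord.
have mapX : map_poly (real_complex R) (rpoly M P) ^+ s =
    map_poly (real_complex R) (rpoly M P ^+ s) by rewrite rmorphXn.
rewrite exprMn -horner_exp mapX (@horner_coef_wide _ D); last first.
  by rewrite size_map_poly (leq_trans (size_rpoly_exp _ _ _)).
rewrite mulr_sumr; apply: eq_bigr => n _; rewrite coef_map /= mulrA.
rewrite /mweight -rmorphXn -rmorphM /=; congr (_ * _).
by rewrite -expiM_nat; congr expi; rewrite /z; ring.
Qed.

Lemma expi_sum (I : Type) (r : seq I) (F : I -> R) :
  expi (\sum_(i <- r) F i) = \prod_(i <- r) expi (F i).
Proof. by apply: (big_morph (@expi R)); [exact: expiD | exact: expi0]. Qed.

Definition cpoint (s P : nat) (theta : 'I_s -> R) (k : {ffun 'I_s -> 'I_P}) : R :=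
  \sum_(i < s) (theta i + (k i)%:R) ^+ 3.

Lemma prod_cubesum (s P : nat) (theta : 'I_s -> R) al :
  \prod_(i < s) cubesum (theta i) P al =
  \sum_(k : {ffun 'I_s -> 'I_P}) expi (al * cpoint theta k).
Proof.
rewrite /cubesum bigA_distr_bigA; apply: eq_bigr => k _.
by rewrite /cpoint mulr_sumr expi_sum.
Qed.

(** Both measures are put on one index set, with weights 1 and [- mweight], so that [kern_trig_le]
    applies to their difference. *)
Lemma kern_compare (s P M T L : nat) (theta : 'I_s -> R) (E : R) t :
  (0 < T)%N -> (0 < L)%N -> (M * P ^ 3 * s < M * L)%N ->
  \sum_(k < T * L) cnorm (\prod_(i < s) cubesum (theta i) P (k%:R / L%:R) -
       modelsum M P (k%:R / L%:R) ^+ s) <= E * L%:R ->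
  `|\sum_(k : {ffun 'I_s -> 'I_P}) kern T L (cpoint theta k - t) -
    \sum_(n < M * L) mweight s M P n * kern T L (n%:R / M%:R - t)| <= 2 * E.
Proof.
move=> T0 L0 ML hE; have Lr : 0 < L%:R :> R by rewrite ltr0n.
pose I := ({ffun 'I_s -> 'I_P} + 'I_(M * L))%type.
pose w (i : I) : R := match i with inl _ => 1 | inr n => - mweight s M P n end.
pose p (i : I) : R := match i with inl k => cpoint theta k | inr n => n%:R / M%:R end.
have := @kern_trig_le R I w p T L t T0 L0.
have -> : \sum_i w i * kern T L (p i - t) =
    \sum_(k : {ffun 'I_s -> 'I_P}) kern T L (cpoint theta k - t) -
    \sum_(n < M * L) mweight s M P n * kern T L (n%:R / M%:R - t).
  rewrite big_sumType /=; congr (_ + _); first by apply: eq_bigr => k _; rewrite mul1r.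
  by rewrite -sumrN; apply: eq_bigr => n _; rewrite mulNr.
move/le_trans; apply.
rewrite (eq_bigr (fun k : 'I_(T * L) =>
  cnorm (\prod_(i < s) cubesum (theta i) P (k%:R / L%:R) -
       modelsum M P (k%:R / L%:R) ^+ s))); last first.
  move=> k _; congr cnorm; rewrite big_sumType /= prod_cubesum (modelsum_expr _ ML).
  congr (_ + _); first by apply: eq_bigr => j _; rewrite mul1r.
  by rewrite -sumrN; apply: eq_bigr => n _; rewrite rmorphN mulNr.
apply: le_trans (ler_wpM2l _ hE) _; first by rewrite divr_ge0.
by rewrite mulrCA divfK ?gt_eqF// mulrC.
Qed.

(** The asymptotic density of the values [cpoint] near [tau]; the main term of the count is
    [2 * eta * lam]. *)
Definition lam (s : nat) tau : R :=
  Gamma (4 / 3) ^+ s / Gamma (s%:R / 3) * tau `^ (s%:R / 3 - 1).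

Lemma lam_gt0 s tau : (0 < s)%N -> 0 < tau -> 0 < lam s tau.
Proof.
move=> s0 t0; rewrite /lam mulr_gt0 ?powR_gt0// divr_gt0 ?exprn_gt0 ?Gamma_gt0//.
by rewrite divr_gt0// ltr0n.
Qed.

Lemma kappa_lam (s M : nat) tau : (0 < s)%N -> (0 < M)%N -> 0 <= tau ->
  kappa R M ^+ s * ((M%:R * tau) `^ (s%:R / 3 - 1) / Gamma (s%:R / 3)) = lam s tau / M%:R.
Proof.
move=> s0 M0 t0; have Mr : 0 < M%:R :> R by rewrite ltr0n.
have cM : cbrt (M%:R : R) ^+ s = M%:R `^ (s%:R / 3 - 1) * M%:R.
  rewrite -powR_mulrn ?cbrt_ge0// /cbrt -powRrM -[X in _ = _ * X]powRr1//.
  rewrite -powRD; first by congr (_ `^ _); field.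
  by apply/implyP => _; rewrite gt_eqF.
have Me : 0 < M%:R `^ (s%:R / 3 - 1) :> R by rewrite powR_gt0.
have Gx : 0 < Gamma (s%:R / 3 : R) by rewrite Gamma_gt0// divr_gt0// ltr0n.
rewrite /kappa expr_div_n cM powRM ?(ltW Mr)// /lam.
by field; rewrite !gt_eqF.
Qed.

Lemma mweight_ge0 (s M P n : nat) : (0 < M)%N -> 0 <= mweight s M P n.
Proof.
move=> M0; rewrite mulr_ge0 ?exprn_ge0 ?(ltW (kappa_gt0 _ M0))//.
have third0 : 0 < 1 / 3 :> R by lra.
by have [/andP[]] := @coef_rpoly_expr R (1 / 3) (M * P ^ 3).+1 s n third0.
Qed.

(** For [n <= M * P ^ 3] the truncation is not felt: up to [kappa R M ^+ s] the weight is a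
    coefficient of [(1 - z)^(-s/3)], to which [rcoef_asymp] applies. Moving from [n / M] to [tau]
    costs a factor close to 1. *)
Lemma mweight_near (s M : nat) eps : (4 <= s)%N -> (0 < M)%N -> 0 < eps ->
  exists d : R, 0 < d < 1 /\ exists tau0 : R, 0 < tau0 /\
  forall tau (P n : nat), tau0 <= tau -> (n <= M * P ^ 3)%N ->
    `|n%:R / M%:R - tau| <= d * tau ->
    `|mweight s M P n - lam s tau / M%:R| <= eps * (lam s tau / M%:R).
Proof.
move=> s4 M0 eps0; have Mr : 0 < M%:R :> R by rewrite ltr0n.
have s0 : (0 < s)%N by apply: leq_trans s4.
pose x : R := s%:R / 3; have x0 : 0 < x by rewrite divr_gt0// ltr0n.
pose e1 := Num.min eps 1 / 3.
have m0 : 0 < Num.min eps 1 by rewrite lt_min eps0 ltr01.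
have m1 : Num.min eps 1 <= 1 by rewrite ge_min lexx orbT.
have me : Num.min eps 1 <= eps by rewrite ge_min lexx.
have e10 : 0 < e1 by rewrite divr_gt0.
have e1e : 3 * e1 <= eps by rewrite /e1; lra.
have e11 : e1 <= 1 by rewrite /e1; lra.
have [d [/andP[d0 d1] hd]] := @powR_near1 (x - 1) e1 e10.
have [n0 [n00 hn0]] := rcoef_asymp x0 e10.
exists d; split; first by rewrite d0.
have d10 : 0 < 1 - d by lra.
have n0r : 0 < n0%:R :> R by rewrite ltr0n.
exists (n0%:R / (1 - d)); split=> [|tau P n ht nP htau]; first by rewrite divr_gt0.
have t0 : 0 < tau by apply: lt_le_trans ht; rewrite divr_gt0.
have Gx : 0 < Gamma x by exact: Gamma_gt0.
have [h1 h2] : (1 - d) * tau <= n%:R / M%:R /\ n%:R / M%:R <= (1 + d) * tau.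
  by move: htau; rewrite ler_norml => /andP[a b]; split; lra.
have nn0 : (n0 <= n)%N.
  rewrite -(ler_nat R); move: ht; rewrite ler_pdivrMr// mulrC => ht.
  apply: le_trans ht _; apply: le_trans h1 _.
  by rewrite ler_pdivrMr// ler_peMr// ler1n.
have third0 : 0 < 1 / 3 :> R by lra.
have [_ /(_ _)] := @coef_rpoly_expr R (1 / 3) (M * P ^ 3).+1 s n third0.
rewrite ltnS nP => /(_ isT) coefE.
rewrite /mweight /rpoly coefE (_ : s%:R * (1 / 3) = x); last by rewrite /x; field.
rewrite -kappa_lam// ?(ltW t0)// -/x.
set Y := (M%:R * tau) `^ (x - 1).
have Y0 : 0 < Y by rewrite powR_gt0// mulr_gt0.
have := hn0 n nn0; set X := rcoef x n * Gamma x.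
have rE : rcoef x n = X / Gamma x by rewrite /X mulfK// gt_eqF.
set r := n%:R / (M%:R * tau).
have nE : n%:R = r * (M%:R * tau) by rewrite /r divfK// gt_eqF// mulr_gt0.
have r0 : 0 <= r by rewrite divr_ge0// mulr_ge0// ltW.
have rd : `|r - 1| <= d.
  have -> : r - 1 = (n%:R / M%:R - tau) / tau by rewrite /r; field; rewrite !gt_eqF.
  by rewrite normrM normfV (gtr0_norm t0) ler_pdivrMr.
have /hd := rd; rewrite {1 2}nE (powRM _ r0 (ltW (mulr_gt0 Mr t0))) -/Y.
set q := r `^ _ => hq hX.
have key : `|X - Y| <= eps * Y.
  have q2 : q <= 1 + e1 by move: hq; rewrite ler_norml => /andP[_ h]; lra.
  have -> : X - Y = (X - q * Y) + (q - 1) * Y by ring.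
  apply: le_trans (ler_normD _ _) _; rewrite normrM (gtr0_norm Y0).
  have b1 : `|q - 1| * Y <= e1 * Y by rewrite ler_pM2r.
  have b2 : e1 * (q * Y) <= 2 * e1 * Y.
    by rewrite mulrA [2 * e1]mulrC ler_pM2r// ler_pM2l//; lra.
  have b3 : 3 * e1 * Y <= eps * Y by rewrite ler_pM2r.
  by apply: le_trans (lerD hX b1) _; lra.
have k0 : 0 < kappa R M ^+ s by rewrite exprn_gt0// kappa_gt0.
have -> : kappa R M ^+ s * rcoef x n - kappa R M ^+ s * (Y / Gamma x) =
  kappa R M ^+ s / Gamma x * (X - Y) by rewrite rE; ring.
rewrite normrM gtr0_norm ?divr_gt0//.
have -> : eps * (kappa R M ^+ s * (Y / Gamma x)) = kappa R M ^+ s / Gamma x * (eps * Y) by ring.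
by rewrite ler_pM2l// divr_gt0.
Qed.

(** Past the truncation only an upper bound survives. It is uniform in [n] because the weights
    vanish for [n > M * P ^ 3 * s], and this limit is at most [32 * s * M * tau]. *)
Lemma mweight_le (s : nat) : (4 <= s)%N -> exists C : R, 0 < C /\
  forall tau (M P n : nat), (0 < M)%N -> (0 < P)%N -> P%:R ^+ 3 <= 32 * tau ->
    mweight s M P n <= C * (lam s tau / M%:R).
Proof.
move=> s4; have s0 : (0 < s)%N by apply: leq_trans s4.
have sr : 0 < s%:R :> R by rewrite ltr0n.
pose x : R := s%:R / 3; have x0 : 0 < x by rewrite divr_gt0.
have x1 : 1 <= x by rewrite /x ler_pdivlMr// mul1r ler_nat (leq_trans _ s4).
have Gx : 0 < Gamma x by exact: Gamma_gt0.
have [C1 [C10 hC1]] := rcoef_le x0.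
exists (C1 * (32 * s%:R) `^ (x - 1) * Gamma x); split.
  by rewrite !mulr_gt0// powR_gt0// mulr_gt0.
move=> tau M P n M0 P0 hP; have Mr : 0 < M%:R :> R by rewrite ltr0n.
have P30 : 0 < P%:R ^+ 3 :> R by rewrite exprn_gt0// ltr0n.
have t0 : 0 < tau by lra.
rewrite -kappa_lam// ?(ltW t0)// -/x.
have k0 : 0 < kappa R M ^+ s by rewrite exprn_gt0// kappa_gt0.
have -> : C1 * (32 * s%:R) `^ (x - 1) * Gamma x *
    (kappa R M ^+ s * ((M%:R * tau) `^ (x - 1) / Gamma x)) =
  kappa R M ^+ s * (C1 * ((32 * s%:R) `^ (x - 1) * (M%:R * tau) `^ (x - 1))).
  by field; rewrite gt_eqF.
rewrite -powRM ?mulr_ge0 ?(ltW t0) ?(ltW sr)// /mweight (ler_pM2l k0).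
have [nD|nD] := leqP n (M * P ^ 3 * s); last first.
  rewrite nth_default; last exact: leq_trans (size_rpoly_exp _ _ _) nD.
  by rewrite mulr_ge0 ?powR_ge0// ltW.
have third0 : 0 < 1 / 3 :> R by lra.
have [/andP[_ h _]] := @coef_rpoly_expr R (1 / 3) (M * P ^ 3).+1 s n third0.
apply: le_trans h _; rewrite (_ : s%:R * (1 / 3) = x); last by rewrite /x; field.
apply: le_trans (rcoef_nondecr x1 nD) _; apply: le_trans (hC1 _ _) _.
  by rewrite muln_gt0 s0 andbT muln_gt0 M0 expn_gt0 P0.
rewrite ler_pM2l//; apply: ge0_ler_powR; rewrite ?nnegrE ?mulr_ge0 ?(ltW t0)//; first lra.
rewrite (natrM _ (M * P ^ 3)) (natrM _ M) natrX.
have -> : 32 * s%:R * (M%:R * tau) = M%:R * (32 * tau) * s%:R by ring.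
by rewrite ler_pM2r// ler_pM2l.
Qed.

(** The kernel values at the atoms [n / M] sum to [M]. Atoms within [d'], a fixed fraction of [tau],
    have weight close to [lam / M]; the others lie in the tail of the kernel, of relative size
    [1 / (T * d')]. *)
Lemma model_kern (s T M : nat) V eps : (4 <= s)%N -> (0 < T)%N -> (T <= M)%N ->
  0 < eps -> exists tau0 : R, 0 < tau0 /\ forall tau (P L : nat) t, tau0 <= tau ->
    2 * tau <= P%:R ^+ 3 -> P%:R ^+ 3 <= 32 * tau -> (0 < L)%N -> 4 * tau <= L%:R ->
    `|t - tau| <= V ->
    `|\sum_(n < M * L) mweight s M P n * kern T L (n%:R / M%:R - t) - lam s tau|
      <= eps * lam s tau.
Proof.
move=> s4 T0 TM eps0; have M0 : (0 < M)%N by apply: leq_trans TM.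
have Mr : 0 < M%:R :> R by rewrite ltr0n.
have M1 : 1 <= M%:R :> R by rewrite ler1n.
have T1 : 1 <= T%:R :> R by rewrite ler1n.
have s0 : (0 < s)%N by apply: leq_trans s4.
have e20 : 0 < eps / 2 by rewrite divr_gt0.
have [d [/andP[d0 d1] [tau1 [tau10 hnear]]]] := mweight_near s4 M0 e20.
have [C [C0 hC]] := mweight_le s4.
pose D0 := `|V| + 1 + 4 * (C + 1) / eps.
have K0 : 0 < 4 * (C + 1) / eps by rewrite divr_gt0// mulr_gt0//; lra.
have D00 : 1 <= D0 by have := normr_ge0 V; rewrite /D0; lra.
exists (tau1 + D0 / (d / 2)); have D1 : 0 < D0 / (d / 2) by rewrite divr_gt0 ?divr_gt0//; lra.
split=> [|tau P L t ht tP Pt L0 tL htV]; first by rewrite addr_gt0.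
have t0 : 0 < tau by lra.
have P0 : (0 < P)%N by move: tP; case: (P) => //; rewrite expr0n /=; lra.
pose d' := d / 2 * tau.
have d'D : D0 <= d' by rewrite /d' mulrC -ler_pdivrMr ?divr_gt0//; lra.
have d'0 : 0 < d' by lra.
have d'V : V <= d' by have := ler_norm V; move: d'D; rewrite /D0; lra.
have d'1 : 1 <= d' by lra.
have d't2 : d' <= tau / 2.
  have : d * tau <= 1 * tau by rewrite ler_pM2r// ltW.
  by rewrite /d'; lra.
have [tb1 tb2] : tau - d' <= t /\ t <= tau + d'.
  move: htV; rewrite ler_norml => /andP[a b].
  by move: a b d'V; clear; move=> *; split; lra.
have l0 := lam_gt0 s0 t0; set la := lam s tau in l0 *.
have lM : 0 < la / M%:R by rewrite divr_gt0.
pose k (n : nat) := kern T L (t - n%:R / M%:R).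
have kE (n : nat) : kern T L (n%:R / M%:R - t) = k n by rewrite /k -kernN opprB.
have k0 n : 0 <= k n by exact: kern_ge0.
have tot : \sum_(n < M * L) k n = M%:R by exact: kern_sum.
have -> : \sum_(n < M * L) mweight s M P n * kern T L (n%:R / M%:R - t) - la =
    \sum_(n < M * L) (mweight s M P n - la / M%:R) * k n.
  rewrite -[X in _ - X](divfK (lt0r_neq0 Mr)) -[X in _ - _ * X]tot mulr_sumr -sumrB.
  by apply: eq_bigr => n _; rewrite kE mulrBl.
apply: le_trans (ler_norm_sum _ _ _) _.
have tail : \sum_(n < M * L | d' <= `|n%:R / M%:R - t|) k n <= 2 * M%:R / (T%:R * d').
  apply: kern_tail => //; first by rewrite mulr_ege1.
    by lra.
  by lra.
apply: le_trans (_ : \sum_(n < M * L) (eps / 2 * (la / M%:R) * k n +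
   (if d' <= `|n%:R / M%:R - t| then (C + 1) * (la / M%:R) * k n else 0)) <= _).
  apply: ler_sum => n _; rewrite normrM (ger0_norm (k0 n)).
  case: ifPn => [far|]; last first.
    rewrite -ltNge addr0 ltr_norml => /andP[a b]; rewrite ler_wpM2r//.
    apply: hnear; first lra.
      have hn : n%:R / M%:R <= P%:R ^+ 3 :> R by lra.
      by move: hn; rewrite ler_pdivrMr// -natrX -natrM ler_nat [(P ^ 3 * M)%N]mulnC.
    have -> : d * tau = d' + d' by rewrite /d'; field.
    move: a b tb1 tb2; rewrite ler_norml; clear; move=> *.
    by apply/andP; split; lra.
  apply: le_trans (_ : (C + 1) * (la / M%:R) * k n <= _); last first.
    by rewrite lerDr mulr_ge0// mulr_ge0// ltW.
  rewrite ler_wpM2r//; apply: le_trans (ler_normB _ _) _.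
  rewrite (ger0_norm (mweight_ge0 _ _ _ M0)) (gtr0_norm lM) mulrDl mul1r lerD2r.
  exact: hC.
rewrite big_split /= -mulr_sumr tot -big_mkcond /= -mulr_sumr.
have -> : eps * la = eps / 2 * (la / M%:R) * M%:R + eps / 2 * la by field; rewrite gt_eqF.
rewrite lerD2l.
have c0 : 0 <= (C + 1) * (la / M%:R) by rewrite mulr_ge0 ?(ltW lM)//; lra.
apply: le_trans (ler_wpM2l c0 tail) _.
have -> : (C + 1) * (la / M%:R) * (2 * M%:R / (T%:R * d')) = 2 * (C + 1) / (T%:R * d') * la.
  by field; rewrite !gt_eqF//; lra.
rewrite ler_pM2r// ler_pdivrMr; last by rewrite mulr_gt0//; lra.
apply: le_trans (_ : eps / 2 * d' <= _); last by rewrite ler_pM2l// ler_peMl// ltW.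
have : 4 * (C + 1) / eps <= d' by have := normr_ge0 V; move: d'D; rewrite /D0; lra.
by rewrite ler_pdivrMr//; lra.
Qed.

Lemma disc_kern (s : nat) (theta : 'I_s -> R) (i0 : 'I_s) (T : nat) V eps :
  (11 <= s)%N -> (forall i, 0 <= theta i <= 1) ->
  (forall n, (0 < n)%N -> rho (n%:R * theta i0) != 0) -> (0 < T)%N -> 0 < eps ->
  exists tau0 : R, 0 < tau0 /\ forall tau (P : nat), tau0 <= tau ->
    2 * tau <= P%:R ^+ 3 -> P%:R ^+ 3 <= 32 * tau ->
    exists L0 : nat, forall (L : nat) t, (L0 <= L)%N -> `|t - tau| <= V ->
      `|\sum_(k : {ffun 'I_s -> 'I_P}) kern T L (cpoint theta k - t) - lam s tau|
        <= eps * lam s tau.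
Proof.
move=> s11 th irr T0 eps0.
have s4 : (4 <= s)%N by apply: leq_trans s11.
have s0 : (0 < s)%N by apply: leq_trans s11.
pose M := (2 * T)%N; have M0 : (0 < M)%N by rewrite muln_gt0.
have TM : (T <= M)%N by rewrite leq_pmull.
have e20 : 0 < eps / 2 by rewrite divr_gt0.
have [tau1 [tau10 hmod]] := model_kern V s4 T0 TM e20.
pose x : R := s%:R / 3; have x0 : 0 < x by rewrite divr_gt0// ltr0n.
have Gx : 0 < Gamma x by exact: Gamma_gt0.
have G43 : 0 < Gamma (4 / 3 : R) ^+ s by apply: exprn_gt0; apply: Gamma_gt0; lra.
(* Converts the scale of the mean-value error into that of the main term:
   [P^(s - 3) <= C3 * lam]. *)
pose C3 := 32 `^ (x - 1) * (Gamma x / Gamma (4 / 3) ^+ s).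
have C30 : 0 < C3 by rewrite mulr_gt0 ?powR_gt0// divr_gt0.
pose e1 := eps / 4 / C3; have e10 : 0 < e1 by rewrite divr_gt0// divr_gt0.
have [P1 hcirc] := circle_L1 s11 th irr e10 T0 (leqnn M).
exists (tau1 + P1%:R ^+ 3); split=> [|tau P ht tP Pt].
  by rewrite ltr_wpDr// exprn_ge0.
have P13 : 0 <= P1%:R ^+ 3 :> R by rewrite exprn_ge0.
have t0 : 0 < tau by lra.
have PP1 : (P1 <= P)%N.
  by rewrite -(ler_nat R) -(@ler_pXn2r _ 3) ?nnegrE//; lra.
exists ((6 * P ^ 3 + P ^ 3 * s).+1 + (Num.truncn (4 * tau)).+1)%N => L t hL htV.
have L0 : (0 < L)%N by apply: leq_trans hL.
have tL : 4 * tau <= L%:R.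
  apply: le_trans (ltW (truncnS_gt _)) _; rewrite ler_nat.
  by apply: leq_trans hL; rewrite leq_addl.
have PL : (6 * P ^ 3 <= L)%N.
  apply: leq_trans hL; apply: leq_trans (leq_addr _ _); apply: leqW; exact: leq_addr.
have PL2 : (P ^ 3 * s < L)%N.
  by apply: leq_trans hL; apply: leq_trans (leq_addr _ _); rewrite ltnS; exact: leq_addl.
have := hmod tau P L t _ tP Pt L0 tL htV; set la := lam s tau => hm.
have l0 : 0 < la by exact: lam_gt0.
have hc : `|\sum_(k : {ffun 'I_s -> 'I_P}) kern T L (cpoint theta k - t) -
    \sum_(n < M * L) mweight s M P n * kern T L (n%:R / M%:R - t)| <=
    2 * (e1 * P%:R ^+ (s - 3)).
  apply: kern_compare => //; first by rewrite -mulnA ltn_pmul2l.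
  by have := hcirc P L PP1 PL; rewrite [e1 * L%:R * _]mulrAC.
have hP : P%:R ^+ (s - 3) <= C3 * la.
  have -> : C3 * la = (32 * tau) `^ (x - 1).
    by rewrite powRM ?(ltW t0)// /C3 /la /lam -/x; field; rewrite !gt_eqF.
  have -> : P%:R ^+ (s - 3) = (P%:R ^+ 3) `^ (x - 1) :> R.
    rewrite -powR_mulrn// -(powR_mulrn 3)// -powRrM; congr (_ `^ _).
    by rewrite natrB ?(leq_trans _ s4)// /x; field.
  apply: ge0_ler_powR; rewrite ?nnegrE ?exprn_ge0// ?mulr_ge0 ?(ltW t0)//.
  by rewrite subr_ge0 /x ler_pdivlMr// mul1r ler_nat (leq_trans _ s4).
have h2 : 2 * (e1 * P%:R ^+ (s - 3)) <= eps / 2 * la.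
  apply: le_trans (_ : 2 * (e1 * (C3 * la)) <= _); first by rewrite ler_pM2l// ler_pM2l.
  by rewrite /e1 le_eqVlt; apply/orP; left; apply/eqP; field; rewrite gt_eqF.
set A := \sum_(k : {ffun _}) _ in hc *; set B := \sum_(n < _) _ in hc hm.
have -> : A - la = (A - B) + (B - la) by rewrite addrA subrK.
apply: le_trans (ler_normD _ _) _.
have hm' : `|B - la| <= eps / 2 * la by apply: hm; lra.
by apply: le_trans (lerD (le_trans hc h2) hm') _; lra.
Qed.
End ModelDensity.

(** * Two-sided counts in the box *)

Section Counting.
Variable R : realType.
Implicit Types (eta tau eps : R).

Lemma natr_gt_exists (a : R) : exists n : nat, (0 < n)%N /\ a <= n%:R.
Proof. by exists (Num.truncn a).+1; split=> //; exact: ltW (truncnS_gt _). Qed.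

Lemma count_upper (s : nat) (theta : 'I_s -> R) (i0 : 'I_s) eta eps :
  (11 <= s)%N -> (forall i, 0 <= theta i <= 1) ->
  (forall n, (0 < n)%N -> rho (n%:R * theta i0) != 0) -> 0 < eta -> 0 < eps ->
  exists tau0 : R, 0 < tau0 /\ forall tau (P : nat), tau0 <= tau ->
    2 * tau <= P%:R ^+ 3 -> P%:R ^+ 3 <= 32 * tau ->
    \sum_(k : {ffun 'I_s -> 'I_P} | `|cpoint theta k - tau| < eta) 1 <=
      (2 * eta + eps) * lam s tau.
Proof.
move=> s11 th irr eta0 eps0.
have s0 : (0 < s)%N by apply: leq_trans s11.
(* Makes [(2 * eta + 3 * d) * (1 + d) <= (2 * eta + eps) * (1 - d)], the comparison that ends the
   proof. *)
pose d := Num.min (1 / 2) (eps / (2 * (6 + 4 * eta))).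
have q0 : 0 < 2 * (6 + 4 * eta) by lra.
have d0 : 0 < d by rewrite lt_min divr_gt0//= divr_gt0.
have d2 : d <= 1 / 2 by rewrite ge_min lexx.
have de : d * (2 * (6 + 4 * eta)) <= eps.
  by rewrite -ler_pdivlMr// ge_min lexx orbT.
(* The first term absorbs the rounding in [m]; the second makes the loss [2 / (d * T)] at most
   [d]. *)
have [T [T0 hT]] := natr_gt_exists (3 / d + 2 / d ^+ 2).
have d20 : 0 < d ^+ 2 by rewrite exprn_gt0.
have Tr : 0 < T%:R :> R by rewrite ltr0n.
have T1 : 1 <= T%:R :> R by rewrite ler1n.
have a0 : 0 < 3 / d by rewrite divr_gt0.
have b0 : 0 < 2 / d ^+ 2 by rewrite divr_gt0.
have T3 : 3 <= d * T%:R by rewrite mulrC -ler_pdivrMr//; lra.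
have T2 : 2 <= d ^+ 2 * T%:R by rewrite mulrC -ler_pdivrMr//; lra.
have Tz : T%:R != 0 :> R by rewrite gt_eqF.
pose m := (Num.truncn ((eta + d) * T%:R)).+1.
have ed0 : 0 <= (eta + d) * T%:R by rewrite mulr_ge0//; lra.
have /andP[m1 m2] := truncn_itv ed0; rewrite -/m in m2.
have m3 : m%:R <= (eta + d) * T%:R + 1 by rewrite /m -natr1 lerD2r.
have mT1 : eta + d <= m%:R / T%:R by rewrite ler_pdivlMr// ltW.
have mT2 : m%:R / T%:R <= eta + d + 1.
  rewrite ler_pdivrMr// mulrDl; lra.
have [tau0 [tau00 hdisc]] := disc_kern (eta + d + 1) s11 th irr T0 d0.
exists tau0; split=> // tau P ht tP Pt.
have [L0 hL0] := hdisc tau P ht tP Pt.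
have t0 : 0 < tau by exact: lt_le_trans tau00 ht.
have l0 := lam_gt0 s0 t0; set la := lam s tau in l0 hL0 *.
have [L1 [L10 hL1]] := natr_gt_exists (2 * (eta + (eta + d + 1))).
pose L := (L0 + L1 + (2 * m).+1)%N.
have Lp : (0 < L)%N by rewrite /L addnS.
have LL0 : (L0 <= L)%N by rewrite /L -addnA leq_addr.
have Lr : 2 * (eta + (eta + d + 1)) <= L%:R.
  by apply: le_trans hL1 _; rewrite ler_nat /L addnAC leq_addl.
have mTL : ((2 * m).+1 <= T * L)%N.
  by apply: leq_trans (leq_pmull _ T0); rewrite /L leq_addl.
have dT1 : 1 <= d * T%:R by move: T3; clear; lra.
have mL : eta + m%:R / T%:R <= L%:R / 2 by move: Lr mT2; clear; lra.
have hU t : `|t - tau| <= m%:R / T%:R ->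
    \sum_(k : {ffun 'I_s -> 'I_P}) kern T L (cpoint theta k - t) <= (1 + d) * la.
  move=> h; have := hL0 L t LL0 (le_trans h mT2).
  by rewrite ler_norml => /andP[_]; rewrite mulrDl mul1r; clear; lra.
have := smooth_upper d0 T0 Lp dT1 mT1 mL mTL hU.
set N := \sum_(k | _) _ => hN.
have N0 : 0 <= N by rewrite sumr_ge0.
have x1 : 2 / (d * T%:R) <= d.
  by rewrite ler_pdivrMr ?mulr_gt0// mulrA -expr2.
have c1 : (2 * m).+1%:R / T%:R <= 2 * eta + 3 * d.
  rewrite ler_pdivrMr// -natr1 natrM.
  by move: m3 T3; rewrite !mulrDl; clear; lra.
have h1 : N * (1 - d) <= (2 * eta + 3 * d) * ((1 + d) * la).
  apply: le_trans (_ : N * (1 - 2 / (d * T%:R)) <= _); first by rewrite ler_wpM2l// lerD2l lerN2.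
  apply: le_trans hN _; rewrite ler_wpM2r// mulr_ge0 ?(ltW l0)//; lra.
have h2 : (2 * eta + 3 * d) * (1 + d) <= (2 * eta + eps) * (1 - d).
  by move: eta0 d0 d2 de eps0; clear; nra.
have h3 : N * (1 - d) <= (2 * eta + eps) * la * (1 - d).
  apply: le_trans h1 _; rewrite mulrA [leRHS]mulrAC ler_wpM2r// ltW//.
by rewrite ler_pM2r in h3 => //; lra.
Qed.

Lemma cpoint_itv (s P : nat) (theta : 'I_s -> R) (k : {ffun 'I_s -> 'I_P}) :
  (forall i, 0 <= theta i <= 1) -> 0 <= cpoint theta k <= s%:R * P%:R ^+ 3.
Proof.
move=> th; have ge i : 0 <= theta i + (k i)%:R.
  by have /andP[h _] := th i; rewrite addr_ge0.
apply/andP; split; first by apply: sumr_ge0 => i _; rewrite exprn_ge0.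
rewrite -sumr_ord_const; apply: ler_sum => i _; rewrite lerXn2r ?nnegrE//.
have : (k i).+1%:R <= P%:R :> R by rewrite ler_nat.
by have /andP[_ h] := th i; rewrite -natr1; lra.
Qed.

Lemma count_lower (s : nat) (theta : 'I_s -> R) (i0 : 'I_s) eta eps :
  (11 <= s)%N -> (forall i, 0 <= theta i <= 1) ->
  (forall n, (0 < n)%N -> rho (n%:R * theta i0) != 0) -> 0 < eta -> 0 < eps ->
  exists tau0 : R, 0 < tau0 /\ forall tau (P : nat), tau0 <= tau ->
    2 * tau <= P%:R ^+ 3 -> P%:R ^+ 3 <= 32 * tau ->
    (2 * eta - eps) * lam s tau <=
    \sum_(k : {ffun 'I_s -> 'I_P} | `|cpoint theta k - tau| < eta) 1.
Proof.
move=> s11 th irr eta0 eps0.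
have s0 : (0 < s)%N by apply: leq_trans s11.
(* Makes [2 * eta - eps <= (2 * eta - 3 * d) * (1 - d) - d], where the last [d] pays for the points
   outside the interval. *)
pose d := Num.min (Num.min (eta / 2) 1) (eps / (4 + 2 * eta)).
have q0 : 0 < 4 + 2 * eta by lra.
have d0 : 0 < d by rewrite !lt_min ltr01 divr_gt0//= divr_gt0.
have d1 : d <= 1 by rewrite !ge_min lexx orbT.
have d2 : d <= eta / 2 by rewrite !ge_min lexx.
have de : d * (4 + 2 * eta) <= eps by rewrite -ler_pdivlMr// ge_min lexx orbT.
pose K := ((eta + 1 / 2) / d) ^+ 2.
have K0 : 0 < K by apply: exprn_gt0; apply: divr_gt0 => //; lra.
have [T [T0 hT]] := natr_gt_exists (1 / d + (2 * eta + 1) * (16 * K) / d).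
have Tr : 0 < T%:R :> R by rewrite ltr0n.
have a0 : 0 < 1 / d by rewrite divr_gt0.
have b0 : 0 < (2 * eta + 1) * (16 * K).
  by apply: mulr_gt0; [lra | exact: mulr_gt0].
have c0 : 0 < (2 * eta + 1) * (16 * K) / d by exact: divr_gt0.
have T1 : 1 <= d * T%:R by rewrite mulrC -ler_pdivrMr//; lra.
have TK : (2 * eta + 1) * (16 * K) <= d * T%:R.
  by rewrite [leRHS]mulrC -ler_pdivrMr//; lra.
have T11 : 1 <= T%:R :> R by rewrite ler1n.
pose m := Num.truncn ((eta - d) * T%:R).
have ed0 : 0 <= (eta - d) * T%:R by apply: mulr_ge0 => //; lra.
have /andP[m1] := truncn_itv ed0; rewrite -/m -natr1 in m1 * => m2.
have mT : m%:R / T%:R <= eta - d by rewrite ler_pdivrMr.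
have [tau1 [tau10 hd1]] := disc_kern eta s11 th irr T0 d0.
(* The case [T = 1] yields the upper bound [2 * lam] needed for the points outside the interval. *)
have [tau2 [tau20 hd2]] := disc_kern (1 / 2) s11 th irr (ltn0Sn 0) d0.
exists (tau1 + tau2); split=> [|tau P ht tP Pt]; first by rewrite addr_gt0.
have [L1 hL1] := hd1 tau P (ltac:(lra)) tP Pt.
have [L2 hL2] := hd2 tau P (ltac:(lra)) tP Pt.
have t0 : 0 < tau by lra.
have l0 := lam_gt0 s0 t0; set la := lam s tau in l0 hL1 hL2 *.
have sP0 : 0 <= s%:R * P%:R ^+ 3 :> R by rewrite mulr_ge0.
have [L3 [L30 hL3]] := natr_gt_exists (4 * (s%:R * P%:R ^+ 3 + tau + eta)).
pose L := (L1 + L2 + L3 + (2 * m).+1)%N.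
have Lp : (0 < L)%N by rewrite /L addnS.
have LL1 : (L1 <= L)%N by rewrite /L -!addnA leq_addr.
have LL2 : (L2 <= L)%N by rewrite /L [(L1 + L2)%N]addnC -!addnA leq_addr.
have Lr : 4 * (s%:R * P%:R ^+ 3 + tau + eta) <= L%:R.
  by apply: le_trans hL3 _; rewrite ler_nat /L addnAC leq_addl.
have mTL : ((2 * m).+1 <= T * L)%N.
  by apply: leq_trans (leq_pmull _ T0); rewrite /L leq_addl.
have pL (k : {ffun 'I_s -> 'I_P}) : `|cpoint theta k - tau| <= L%:R / 4.
  have /andP[h1 h2] := cpoint_itv k th.
  move: h1 h2 Lr eta0 t0 sP0; rewrite ler_norml; clear; move=> *.
  by apply/andP; split; lra.
have eL : eta <= L%:R / 4 by lra.
have hB t : `|t - tau| <= eta ->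
    (1 - d) * la <= \sum_(k : {ffun 'I_s -> 'I_P}) kern T L (cpoint theta k - t).
  move=> h; have := hL1 L t LL1 h.
  by rewrite ler_norml => /andP[h1 _]; rewrite mulrBl mul1r; lra.
have hU t : `|t - tau| <= 1 / 2 ->
    \sum_(k : {ffun 'I_s -> 'I_P}) kern 1 L (cpoint theta k - t) <= 2 * la.
  move=> h; have := hL2 L t LL2 h.
  have : d * la <= 1 * la by rewrite ler_pM2r.
  by rewrite ler_norml => q /andP[_ h1]; lra.
have dle : d < eta by lra.
have := smooth_lower d0 dle T0 Lp mT mTL pL eL hB hU.
set N := \sum_(k | _) _; rewrite -/K => hN.
have N0 : 0 <= N by rewrite sumr_ge0.
set c := (2 * m).+1%:R in hN.
have cE : c = 2 * m%:R + 1 by rewrite /c -natr1 natrM.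
have c1 : c <= (2 * eta + 1) * T%:R.
  have dT0 : 0 < d * T%:R by lra.
  by rewrite cE; move: m1 dT0 T11; clear; lra.
have c2 : (2 * eta - 3 * d) * T%:R <= c.
  by rewrite cE; move: m2 T1; rewrite !mulrBl; lra.
have K2 : c * (8 * K / T%:R * (2 * la)) <= d * la * T%:R.
  apply: le_trans (_ : (2 * eta + 1) * T%:R * (8 * K / T%:R * (2 * la)) <= _).
    apply: ler_wpM2r c1; apply: mulr_ge0; last by apply: mulr_ge0 (ltW l0).
    by apply: divr_ge0 => //; apply: mulr_ge0 (ltW K0).
  have -> : (2 * eta + 1) * T%:R * (8 * K / T%:R * (2 * la)) =
     (2 * eta + 1) * (16 * K) * la by field; rewrite gt_eqF.
  by rewrite [leRHS]mulrAC (ler_pM2r l0).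
have B1 : (2 * eta - 3 * d) * T%:R * ((1 - d) * la) <= c * ((1 - d) * la).
  by apply: ler_wpM2r c2; apply: mulr_ge0 (ltW l0); lra.
have h2 : (2 * eta - eps) <= (2 * eta - 3 * d) * (1 - d) - d.
  by move: eta0 d0 d2 de eps0; clear; nra.
have h3 : (2 * eta - eps) * (la * T%:R) <= ((2 * eta - 3 * d) * (1 - d) - d) * (la * T%:R).
  by rewrite ler_pM2r// mulr_gt0.
rewrite -(ler_pM2r Tr).
by move: hN K2 B1 h3; clear; lra.
Qed.

(** The value of [n - x] at the least integer [n > x], so it lies in (0, 1]; this makes [k = 0] the
    first index allowed by the strict inequality in [solutions]. *)
Definition shift_frac (x : R) : R := (Num.floor x)%:~R + 1 - x.

Lemma shift_frac_itv (x : R) : 0 <= shift_frac x <= 1.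
Proof.
have := floor_itv x; rewrite intrD => /andP[h1 h2].
by rewrite /shift_frac; apply/andP; split; lra.
Qed.

Lemma irrational_shift_frac (x : R) (n : nat) : irrational x -> (0 < n)%N ->
  rho (n%:R * shift_frac x) != 0.
Proof.
move=> irr n0; apply/negP => /eqP; rewrite /rho; set z := Num.floor (_ + _).
move/eqP; rewrite subr_eq0 => /eqP h; apply: irr.
have nr : n%:R != 0 :> R by rewrite pnatr_eq0 -lt0n.
exists ((Num.floor x)%:~R + 1 - z%:~R / n%:R) => //.
rewrite rmorphB rmorphD fmorph_div /= !ratr_int ratr_nat rmorph1 -h /shift_frac.
by field.
Qed.

(** All cubes are positive, so each is below [tau + eta <= P^3], and the box of side [P] misses no
    solution. *)
Lemma Nsol_count (s P : nat) (mu : 'I_s -> R) eta tau : tau + eta <= P%:R ^+ 3 ->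
  (Nsol mu eta tau)%:R = \sum_(k : {ffun 'I_s -> 'I_P} |
     `|cpoint (fun i => shift_frac (mu i)) k - tau| < eta) (1 : R).
Proof.
move=> hP; pose th i := shift_frac (mu i).
pose g (k : {ffun 'I_s -> 'I_P}) : {ffun 'I_s -> int} :=
  [ffun i => Num.floor (mu i) + 1 + (k i : nat)%:Z].
have gE k i : (g k i)%:~R - mu i = th i + (k i)%:R.
  by rewrite ffunE !intrD /th /shift_frac -pmulrn; ring.
have ginj : injective g.
  move=> k1 k2 /ffunP e; apply/ffunP => i; apply: val_inj => /=.
  by have := e i; rewrite !ffunE => /addrI [].
have cubE k : shifted_cubes mu (g k) = cpoint th k.
  by apply: eq_bigr => i _; rewrite gE.
have -> : Nsol mu eta tau = #|[pred k : {ffun 'I_s -> 'I_P} | `|cpoint th k - tau| < eta]|.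
  rewrite /Nsol.
  have -> : fset_set (solutions mu eta tau) =
      [fset g k | k in [pred k : {ffun 'I_s -> 'I_P} | `|cpoint th k - tau| < eta]]%fset.
    apply/fsetP => x; rewrite in_fset_set; last exact: finite_solutions.
    apply/idP/imfsetP => [|[k /= hk ->]]; last first.
      apply/mem_set; split; last by rewrite cubE.
      move=> i; rewrite -subr_gt0 gE.
      have := floor_itv (mu i); rewrite intrD => /andP[_ h].
      by rewrite ltr_wpDr// /th /shift_frac; lra.
    move/set_mem => -[xpos xlt].
    have xE i : x i = Num.floor (mu i) + 1 + (absz (x i - (Num.floor (mu i) + 1))%R)%:Z.
      have : Num.floor (mu i) < x i by rewrite floor_lt_int.
      by rewrite -lezD1 => h; rewrite gez0_abs ?subr_ge0// addrC subrK.
    have kE i : (x i)%:~R - mu i = th i + (absz (x i - (Num.floor (mu i) + 1))%R)%:R.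
      move: (xE i); move: (absz _) => k ->.
      by rewrite !intrD /th /shift_frac -pmulrn; ring.
    have kP i : (absz (x i - (Num.floor (mu i) + 1))%R < P)%N.
      rewrite -(ltr_nat R); have := kE i; move: (absz _) => k {}kE.
      have /andP[h0 h1] := shift_frac_itv (mu i).
      have h2 : 0 <= th i + k%:R by rewrite addr_ge0.
      apply: le_lt_trans (_ : th i + k%:R < _); first by rewrite lerDr.
      rewrite -(@ltr_pXn2r _ 3) ?nnegrE//; apply: lt_le_trans hP.
      apply: le_lt_trans (_ : shifted_cubes mu x < _); last first.
        by move: xlt; rewrite ltr_norml => /andP[_ h]; lra.
      rewrite /shifted_cubes (bigD1 i)//= kE lerDl sumr_ge0// => j _.
      by rewrite exprn_ge0// subr_ge0 ltW.
    exists [ffun i => Ordinal (kP i)].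
      have e : cpoint th [ffun i => Ordinal (kP i)] = shifted_cubes mu x.
        by apply: eq_bigr => i _; rewrite kE ffunE.
      by change (`|cpoint th [ffun i => Ordinal (kP i)] - tau| < eta); rewrite e.
    by apply/ffunP => i; rewrite !ffunE /= -xE.
  by rewrite card_imfset//= cardE.
by rewrite -sum1_card natr_sum.
Qed.
End Counting.

Theorem theorem1p5 (R : realType) (s : nat) (hs : (11 <= s)%N)
    (eta : R) (heta : 0 < eta) (mu : 'I_s -> R)
    (hmu : irrational (mu (Ordinal (leq_trans (isT : (0 < 11)%N) hs)))) :
  (Nsol mu eta tau)%:R /
    (2 * eta * Gamma (4 / 3) ^+ s * (Gamma (s%:R / 3))^-1 *
       tau `^ (s%:R / 3 - 1)) @[tau --> +oo] --> (1 : R).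
Proof.
have s0 : (0 < s)%N by rewrite (leq_trans _ hs).
set i0 := Ordinal _ in hmu.
pose th i := shift_frac (mu i).
have thI i : 0 <= th i <= 1 by exact: shift_frac_itv.
have irr n : (0 < n)%N -> rho (n%:R * th i0) != 0 by exact: irrational_shift_frac.
apply/cvgrPdist_le => eps eps0.
have e0 : 0 < 2 * eta * eps by rewrite !mulr_gt0.
have [tau1 [tau10 hup]] := count_upper hs thI irr heta e0.
have [tau2 [tau20 hlo]] := count_lower hs thI irr heta e0.
(* The term [eta] gives [tau + eta <= 2 * tau <= P^3], and the 1 gives [1 <= cbrt (2 * tau)]. *)
exists (tau1 + tau2 + eta + 1); split=> [|tau htau]; first exact: num_real.
have t0 : 0 < tau by lra.
(* Then [cbrt (2 * tau) < P <= 2 * cbrt (2 * tau)], hence [2 * tau <= P^3 <= 16 * tau]. *)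
pose P := (Num.truncn (cbrt (2 * tau))).+1.
have c0 : 0 <= cbrt (2 * tau) by exact: cbrt_ge0.
have c3 : cbrt (2 * tau) ^+ 3 = 2 * tau by rewrite cbrt3//; lra.
have c1 : 1 <= cbrt (2 * tau).
  by have := @le_cbrt R 1 (2 * tau) ler01; rewrite cbrt1; apply; lra.
have /andP[P1 P2] := truncn_itv c0; rewrite -/P in P2.
have P3 : P%:R <= 2 * cbrt (2 * tau) by rewrite /P -natr1; lra.
have tP : 2 * tau <= P%:R ^+ 3 by rewrite -c3 lerXn2r ?nnegrE// ltW.
have Pt : P%:R ^+ 3 <= 32 * tau.
  apply: le_trans (_ : (2 * cbrt (2 * tau)) ^+ 3 <= _).
    by rewrite lerXn2r ?nnegrE// mulr_ge0.
  by rewrite exprMn c3; lra.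
have hP : tau + eta <= P%:R ^+ 3 by lra.
rewrite (Nsol_count mu hP).
have {hup} := hup tau P (ltac:(lra)) tP Pt; have {hlo} := hlo tau P (ltac:(lra)) tP Pt.
set N := \sum_(k | _) _ => hlo hup.
have l0 := lam_gt0 s0 t0.
have -> : 2 * eta * Gamma (4 / 3) ^+ s * (Gamma (s%:R / 3))^-1 * tau `^ (s%:R / 3 - 1) =
    2 * eta * lam s tau by rewrite /lam; ring.
have d0 : 0 < 2 * eta * lam s tau by apply: mulr_gt0 l0; exact: mulr_gt0.
have -> : 1 - N / (2 * eta * lam s tau) = (2 * eta * lam s tau - N) / (2 * eta * lam s tau).
  by rewrite mulrBl divff ?gt_eqF.
rewrite normrM normfV (gtr0_norm d0) ler_pdivrMr//.
by move: hlo hup; rewrite ler_norml !mulrDl mulNr => hlo hup; apply/andP; split; lra.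
Qed.
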